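(* Let $H$ be a fixed connected graph with $h$ vertices, $2\le h<\infty$, and for finite $\mathcal X\subset\mathbb R^d$ let $\psi_H(\mathcal X)$ be the $H$-packing number of the graph $G(\mathcal X,1)$. Then for every $\lambda>0$ the limit $\rho(\lambda):=\lim_{s\to\infty}\mathbb E[\psi_H(\mathcal H_{\lambda,s})]/(\lambda s^d)$ exists in $\mathbb R$. Also, if $nr_n^d\to t\in(0,\infty)$ as $n\to\infty$, then $$n^{-1}\psi_H(r_n^{-1}\mathcal X_n)\to\int_{\mathbb R^d}\rho(tf_\mu(x))f_\mu(x)\,dx+\frac1h\,\mu^\perp(\mathbb R^d)$$ as $n\to\infty$, both completely and in $L^2$.
   Context: Fix $d\in\mathbb N$. $\mu$ is a diffuse probability measure on $\mathbb R^d$ ($\mu(\{x\})=0$ for all $x$); $X_1,X_2,\dots$ are i.i.d. with distribution $\mu$; $\mathcal X_n:=\{X_1,\dots,X_n\}$. $(r_n)_{n\ge1}$ is a sequence of positive reals. In the Lebesgue decomposition of $\mu$, $f_\mu$ is the density of the absolutely continuous part and $\mu^\perp$ is the singular part; the integrand is taken as $0$ where $f_\mu(x)=0$. $Q_s:=[-s/2,s/2)^d$; $\mathcal H_\lambda$ is a homogeneous Poisson point process of intensity $\lambda$ on $\mathbb R^d$; $\mathcal H_{\lambda,s}:=\mathcal H_\lambda\cap Q_s$. $\xi_n\to c$ completely means $\sum_n\mathbb P[|\xi_n-c|>\varepsilon]<\infty$ for all $\varepsilon>0$. $G(\mathcal X,r)$ is the graph on vertex set $\mathcal X$ with an edge between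 distinct points at Euclidean distance at most $r$. The $H$-packing number of a finite graph $G$ is the maximum number of pairwise vertex-disjoint subgraphs of $G$ (not necessarily induced) each isomorphic to $H$. Thus $\psi_H(r^{-1}\mathcal X)$ is the $H$-packing number of $G(\mathcal X,r)$. *)

(* Defs.v *)
(* The space R^d is d.-tuple R, whose library sigma-algebra
   is the one generated by the coordinates, i.e. the Borel sigma-algebra. *)
From HB Require Import structures.
From mathcomp Require Import all_boot all_order all_algebra finmap.
From mathcomp Require Import all_classical all_reals all_analysis.

Set Implicit Arguments.
Unset Strict Implicit.
Unset Printing Implicit Defensive.

Import Order.TTheory GRing.Theory Num.Theory.
Import numFieldNormedType.Exports.

Local Open Scope classical_set_scope.
Local Open Scope ring_scope.

Section lebesgue_tuple.
Context {R : realType}.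

(* [measurableTypeR R] is R, with the display under which the library states
   [lebesgue_measure]. *)
Definition tuple_cons n (p : measurableTypeR R * n.-tuple R) : n.+1.-tuple R :=
  [tuple of (p.1 : R) :: p.2].

Lemma measurable_tuple_cons n : measurable_fun setT (@tuple_cons n).
Proof.
apply: (measurable_cons (f := fun p => p.1 : R) (g := snd)) => //.
exact: measurable_fst.
Qed.

Lemma behead_tuple_cons n (p : measurableTypeR R * n.-tuple R) :
  [tuple of behead (tuple_cons p)] = p.2 :> n.-tuple R.
Proof. exact/val_inj. Qed.

Definition lebesgue_cons n
    (m : {sigma_finite_measure set (n.-tuple R) -> \bar R}) :
    set (n.+1.-tuple R) -> \bar R :=
  pushforward ((@lebesgue_measure R) \x m)%E (@tuple_cons n).

Section instances.
Variables (n : nat) (m : {sigma_finite_measure set (n.-tuple R) -> \bar R}).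

Let pm : {measure set (measurableTypeR R * n.-tuple R) -> \bar R} :=
  ((@lebesgue_measure R) \x m)%E.

Let lebesgue_cons0 : lebesgue_cons m set0 = 0%E.
Proof. by rewrite /lebesgue_cons /pushforward preimage_set0; exact: (measure0 pm). Qed.

Let lebesgue_cons_ge0 A : (0 <= lebesgue_cons m A)%E.
Proof. exact: (measure_ge0 pm). Qed.

Let lebesgue_cons_sigma_additive : semi_sigma_additive (lebesgue_cons m).
Proof.
move=> F mF tF mUF; rewrite /lebesgue_cons /pushforward preimage_bigcup.
apply: (measure_semi_sigma_additive (s := pm)) => [k||].
- by rewrite -[X in measurable X]setTI; exact: measurable_tuple_cons.
- apply/trivIsetP => /= i j _ _ ij; rewrite -preimage_setI.
  by move/trivIsetP : tF => /(_ _ _ _ _ ij) ->//; rewrite preimage_set0.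
- rewrite -preimage_bigcup -[X in measurable X]setTI.
  exact: measurable_tuple_cons.
Qed.

HB.instance Definition _ := isMeasure.Build _ _ _ (lebesgue_cons m)
  lebesgue_cons0 lebesgue_cons_ge0 lebesgue_cons_sigma_additive.

Lemma lebesgue_consE (A : set R) (B : set (n.-tuple R)) :
  measurable A -> measurable B ->
  lebesgue_cons m [set x | A (thead x) /\ B [tuple of behead x]] =
  (lebesgue_measure A * m B)%E.
Proof.
move=> mA mB; rewrite -product_measure1E//; congr (pm _).
apply/seteqP; split => -[a b] /=; rewrite behead_tuple_cons theadE.
  by move=> [Aa Bb]; split.
by move=> [/= Aa Bb]; split.
Qed.

Let measurable_thead : measurable_fun [set: n.+1.-tuple R] (@thead n R).
Proof. exact: measurable_tnth. Qed.

Let lebesgue_cons_sigma_finite : sigma_finite setT (lebesgue_cons m).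
Proof.
have /sigma_finiteP[F [TF ndF Foo]] := sigma_finiteT (@lebesgue_measure R).
have /sigma_finiteP[G [TG ndG Goo]] := sigma_finiteT m.
exists (fun k => [set x | F k (thead x) /\ G k [tuple of behead x]]).
  apply/esym/seteqP; split => // x _.
  have [i _ Fi] : (\bigcup_i F i) (thead x) by rewrite -TF.
  have [j _ Gj] : (\bigcup_i G i) [tuple of behead x] by rewrite -TG.
  exists (maxn i j) => //; split.
  - by move: Fi; exact/subsetPset/ndF/leq_maxl.
  - by move: Gj; exact/subsetPset/ndG/leq_maxr.
move=> k; have [mF Fk] := Foo k; have [mG Gk] := Goo k; split.
  rewrite (_ : [set _ | _] = (@thead n R) @^-1` F k `&`
      (fun x : n.+1.-tuple R => [tuple of behead x]) @^-1` G k)//.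
  apply: measurableI; rewrite -[X in measurable X]setTI.
    exact: measurable_thead.
  exact: measurable_behead.
by rewrite lebesgue_consE// lte_mul_pinfty// ge0_fin_numE.
Qed.

HB.instance Definition _ := Measure_isSigmaFinite.Build _ _ _ (lebesgue_cons m)
  lebesgue_cons_sigma_finite.

End instances.

Fixpoint lebesgue_tuple d : {sigma_finite_measure set (d.-tuple R) -> \bar R} :=
  match d with
  | 0%N => \d_([tuple] : 0.-tuple R)
  | n.+1 => lebesgue_cons (lebesgue_tuple n)
  end.

Let tnth_behead_lift n (x : n.+1.-tuple R) (i : 'I_n) :
  tnth [tuple of behead x] i = tnth x (lift ord0 i).
Proof. by rewrite [in RHS](tuple_eta x) tnthS. Qed.

Lemma lebesgue_tuple_box d (A : 'I_d -> set R) :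
  (forall i, measurable (A i)) ->
  lebesgue_tuple d [set x | forall i, A i (tnth x i)] =
  (\prod_(i < d) lebesgue_measure (A i))%E.
Proof.
elim: d A => [|n IHn] A mA /=.
  rewrite big_ord0 diracE mem_set//= => -[]//.
have mB : measurable [set x : n.-tuple R | forall i, A (lift ord0 i) (tnth x i)].
  rewrite (_ : [set _ | _] = \bigcap_(i in [set: 'I_n])
      ((fun x : n.-tuple R => tnth x i) @^-1` A (lift ord0 i))).
    apply: fin_bigcap_measurable => // i _.
    rewrite -[X in measurable X]setTI.
    exact: measurable_tnth.
  by apply/seteqP; split => x /= H i => [_|]; exact: H.
rewrite big_ord_recl -IHn// -lebesgue_consE//; congr (lebesgue_cons _ _).
apply/seteqP; split => x /=.
  move=> H; split; first exact: (H ord0).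
  by move=> i; rewrite tnth_behead_lift; exact: H.
move=> [H0 H] i; case: (unliftP ord0 i) => [j ->|->//].
by rewrite -tnth_behead_lift.
Qed.

End lebesgue_tuple.

Record graph (T : choiceType) := Graph {
  vertices : {fset T};
  adj : rel T;
  adj_sym : symmetric adj;
  adj_irr : irreflexive adj;
  adj_vertices : forall x y, adj x y -> x \in vertices }.

Definition connected_graph (T : choiceType) (G : graph T) :=
  {in vertices G &, forall x y, exists2 p, path (adj G) x p & last x p = y}.

Definition subgraph (T : choiceType) (K G : graph T) :=
  (vertices K `<=` vertices G)%fset /\ forall x y, adj K x y -> adj G x y.

Definition isomorphic (U T : choiceType) (H : graph U) (K : graph T) :=
  exists f : U -> T, [/\ {in vertices H &, injective f},
    [fset f x | x in vertices H]%fset = vertices K &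
    {in vertices H &, forall x y, adj K (f x) (f y) = adj H x y}].

Definition has_packing (U T : choiceType) (H : graph U) (G : graph T) k :=
  exists F : 'I_k -> graph T,
    (forall i, subgraph (F i) G /\ isomorphic H (F i)) /\
    (forall i j, i != j -> [disjoint vertices (F i) & vertices (F j)]%fset).

(* For H with at least one vertex, every packing of G has at most
   #|` vertices G| members, so the range of k loses nothing. *)
Definition packing_number (U T : choiceType) (H : graph U) (G : graph T) : nat :=
  \max_(k < #|` vertices G|.+1 | `[< has_packing H G k >]) k.

Section geometric.
Context {R : realType} {d : nat}.
Implicit Types (x y : d.-tuple R) (X : {fset d.-tuple R}).

Definition edist x y : R := Num.sqrt (\sum_(i < d) (tnth x i - tnth y i) ^+ 2).

Lemma edistC x y : edist x y = edist y x.
Proof.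
by rewrite /edist; congr Num.sqrt; apply: eq_bigr => i _; rewrite -sqrrN opprB.
Qed.

Definition geom_adj X (r : R) : rel (d.-tuple R) :=
  fun x y => [&& x \in X, y \in X, x != y & edist x y <= r].

Lemma geom_adj_sym X r : symmetric (geom_adj X r).
Proof. by move=> x y; rewrite /geom_adj andbCA eq_sym edistC. Qed.

Lemma geom_adj_irr X r : irreflexive (geom_adj X r).
Proof. by move=> x; rewrite /geom_adj eqxx !andbF. Qed.

Lemma geom_adj_vertices X r x y : geom_adj X r x y -> x \in X.
Proof. by case/andP. Qed.

Definition geometric_graph X (r : R) : graph (d.-tuple R) :=
  Graph (@geom_adj_sym X r) (@geom_adj_irr X r) (@geom_adj_vertices X r).

Definition psi (U : choiceType) (H : graph U) X : nat :=
  packing_number H (geometric_graph X 1).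

Definition dilate (a : R) x : d.-tuple R := [tuple a * tnth x i | i < d].

Definition dilate_fset a X : {fset d.-tuple R} := [fset dilate a x | x in X]%fset.

Definition cube (s : R) : set (d.-tuple R) :=
  [set x | forall i, - (s / 2) <= tnth x i < s / 2].

End geometric.

Section probability.
Context {R : realType}.

Definition mutually_independent d (Omega : measurableType d)
    (P : probability Omega R) d' (T : measurableType d') (I : choiceType)
    (X : I -> Omega -> T) :=
  forall (J : {fset I}) (B : I -> set T), (forall i, measurable (B i)) ->
    P (\bigcap_(i in [set` J]) X i @^-1` B i) =
    (\prod_(i <- J) P (X i @^-1` B i))%E.

Definition mutually_singular d (T : measurableType d)
    (mu nu : set T -> \bar R) :=
  exists A, [/\ measurable A, mu A = 0%E & nu (~` A) = 0%E].

Section random_sets.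
Context {d : nat} {dO : measure_display} {Omega : measurableType dO}
  (P : probability Omega R).
Implicit Type N : Omega -> set (d.-tuple R).

(* [fset_set] is empty on infinite sets; below it is only used on bounded parts
   of locally finite sets. *)
Definition count_in N (A : set (d.-tuple R)) (w : Omega) : nat :=
  #|` fset_set (N w `&` A)|.

Definition bounded_borel (A : set (d.-tuple R)) :=
  measurable A /\ exists s, A `<=` cube s.

(* The library's [poisson_prob] ignores its second argument, and is the Dirac
   mass at 0 when the rate is 0 (needed for Lebesgue-null sets). *)
Definition poisson_process (lambda : R) N :=
  [/\ forall w s, finite_set (N w `&` cube s),
      forall A, bounded_borel A -> measurable_fun setT (count_in N A),
      forall A, bounded_borel A -> forall B : set nat,
        P (count_in N A @^-1` B) =
        poisson_prob (lambda * fine (lebesgue_tuple d A)) 0%N B &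
      forall A : nat -> set (d.-tuple R), (forall i, bounded_borel (A i)) ->
        trivIset setT A ->
        mutually_independent P (fun i => count_in N (A i))].

End random_sets.

Definition converges_completely d (Omega : measurableType d)
    (P : probability Omega R) (xi : nat -> Omega -> R) (c : R) :=
  forall eps, 0 < eps ->
    (\sum_(1 <= n <oo) P [set w | (eps < `|xi n w - c|)%R] < +oo)%E.

Definition converges_L2 d (Omega : measurableType d)
    (P : probability Omega R) (xi : nat -> Omega -> R) (c : R) :=
  ('E_P[fun w => ((xi n w - c) ^+ 2)%R])%E @[n --> \oo] --> 0%E.

End probability.

(* Main.v *)
From HB Require Import structures.
From mathcomp Require Import all_boot all_order all_algebra finmap.
From mathcomp Require Import all_classical all_reals all_analysis.
From mathcomp Require Import measurable_realfun zify ring lra.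
Require Import Defs.

(** The packing number changes by at most one when a point is added and, [H]
    being connected, is additive over distant parts, so on a finite grid its mean under [k]
    independent uniform points can be handled by elementary means: [psi_unif k s]
    is the infimum of these means over all grids of the cube of side [s], and
    [psi_unif k s / s ^ d] converges as [s] and [k / s ^ d] do, by comparing a big
    cube with its division into smaller ones. The limit at density [lambda] is
    [lambda * rho lambda].

    For a Poisson process, the points in a cube are uniform given their number,
    and that number has variance [lambda * s ^ d].

    For a general law, cut a big cube into cells. Outside a union [B] of cells of
    small volume carrying most of the singular part, the law is nearly uniform on
    each cell and the cells contribute independently up to boundary effects, which
    gives the integral. In [B] a packing inside cliques of diameter [r_n] leaves
    fewer than [h] unused points per clique, and [B] has room for few cliques only:
    it contributes [1 / h] times its mass.

    Finally the exponential moments of a functional with unit increments give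
    geometric tails, hence complete convergence, and boundedness gives L2. *)

Set Implicit Arguments.
Unset Strict Implicit.
Unset Printing Implicit Defensive.

Import Order.TTheory GRing.Theory Num.Theory.
Import numFieldNormedType.Exports.

Local Open Scope classical_set_scope.
Local Open Scope ring_scope.

(** * Packing numbers of lists *)

(** Means over configurations of points are computed as finite weighted sums, by recording only the
    cells that contain the points. Cells count as adjacent when they might contain points at
    distance at most one, so a given finite set of points is seen correctly once the mesh is fine.
    The discretized functionals are thus eventually equal to the true one on each outcome, and
    bounded convergence yields both its measurability and its mean. Several points may share a cell,
    hence packings of lists with repetitions instead of sets. Two scales are in play. The fine grid
    goes to its limit with the sample size fixed. The coarse cells, of side c, stay fixed while n
    grows, so their side c / r_n in units of the radius tends to infinity. About vol(B) / r_n^d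
    cliques are used in B, that is n vol(B) / t up to a factor depending on d; this is why B must
    have small volume and not only carry the singular part. Binomial and Poisson counts enter only
    through their variance, because mean packing numbers are Lipschitz in the number of points. *)

Section packing_sequences.
Variables (h : nat) (a : rel nat).

(** Connectedness in the form that packings use: taking as label the side on which a vertex falls
    confines a copy to one side, with no path to follow. *)
Definition index_connected := forall P : nat -> bool,
  (forall i j, (i < h)%N -> (j < h)%N -> a i j -> P i = P j) ->
  forall i j, (i < h)%N -> (j < h)%N -> P i = P j.

Section one_type.
Variable C : eqType.
Implicit Types (e : rel C) (s l : seq C) (L : seq (seq C)).

(** The entries of [l] are the images of the indices below [h]. Equal entries are allowed, as
    several points may lie in one cell; [packs] then counts entries with multiplicity. *)
Definition copy e l := size l = h /\
  forall x0 i j, (i < h)%N -> (j < h)%N -> a i j -> e (nth x0 l i) (nth x0 l j).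

Definition packs e s L := (forall l, l \in L -> copy e l) /\
  exists rest, perm_eq (flatten L ++ rest) s.

Definition pk e s : nat :=
  \max_(k < (size s).+1 | `[< exists2 L, packs e s L & size L = k >]) k.

Hypothesis h_gt0 : (0 < h)%N.

Lemma copies_size e L : (forall l, l \in L -> copy e l) ->
  size (flatten L) = (h * size L)%N.
Proof.
elim: L => [|l L IH] cL /=; first by rewrite muln0.
rewrite size_cat mulnS IH => [|l' l'L]; last by apply: cL; rewrite inE l'L orbT.
by have [-> _] := cL l (mem_head _ _).
Qed.

Lemma packs_size e s L : packs e s L -> (h * size L <= size s)%N.
Proof.
by move=> [cL [rest /perm_size]]; rewrite size_cat (copies_size cL) => <-; apply: leq_addr.
Qed.

Lemma packs_pk e s L : packs e s L -> (size L <= pk e s)%N.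
Proof.
move=> pL; have kb : (size L < (size s).+1)%N.
  rewrite ltnS; apply: leq_trans (packs_size pL).
  by rewrite leq_pmull.
by apply: (bigop.bigmax_sup (Ordinal kb)) => //; apply/asboolP; exists L.
Qed.

Lemma pk_packs e s : exists2 L, packs e s L & size L = pk e s.
Proof.
have /(bigop.eq_bigmax_cond (fun i => nat_of_ord i)) :
    (0 < #|[pred k : 'I_(size s).+1 | `[< exists2 L, packs e s L & size L = k >]]|)%N.
  apply/card_gt0P; exists ord0; apply/asboolP => /=.
  by exists (@nil (seq C)) => //; split => //; exists s.
move=> [i /asboolP[L pL sL] E]; exists L; first exact: pL.
by rewrite sL -E; apply: eq_bigl => k; rewrite inE.
Qed.

Lemma pk_leP e s k : (forall L, packs e s L -> (size L <= k)%N) -> (pk e s <= k)%N.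
Proof. by have [L pL <-] := pk_packs e s; apply. Qed.

Lemma pk_size e s : (h * pk e s <= size s)%N.
Proof. by have [L pL <-] := pk_packs e s; exact: packs_size pL. Qed.

Lemma pk_perm e s t : perm_eq s t -> pk e s = pk e t.
Proof.
suff H s' t' : perm_eq s' t' -> (pk e s' <= pk e t')%N.
  by move=> st; apply/eqP; rewrite eqn_leq !H// perm_sym.
move=> st; apply: pk_leP => L [cL [rest pr]]; apply: packs_pk; split => //.
by exists rest; apply: perm_trans st.
Qed.

Lemma pk_cat e s t : (pk e s + pk e t <= pk e (s ++ t))%N.
Proof.
have [L [cL [u pu]] <-] := pk_packs e s; have [K [cK [v pv]] <-] := pk_packs e t.
rewrite -size_cat; apply: packs_pk; split.
  by move=> l; rewrite mem_cat => /orP[/cL|/cK].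
exists (u ++ v); rewrite flatten_cat -catA.
rewrite (perm_trans _ (perm_cat pu pv))// -!catA perm_cat2l.
by rewrite !catA perm_cat2r perm_catC.
Qed.

Lemma pk_nil e : pk e [::] = 0%N.
Proof. by have := pk_size e [::]; rewrite leqn0 muln_eq0; case: h h_gt0 => //= ? _ /eqP. Qed.

Lemma pk_cons_ge e x s : (pk e s <= pk e (x :: s))%N.
Proof. by apply: leq_trans (pk_cat e [:: x] s); apply: leq_addl. Qed.

(** A new point belongs to at most one member of a packing; discarding that member leaves a packing
    of the old points. *)
Lemma pk_cons_le e x s : (pk e (x :: s) <= (pk e s).+1)%N.
Proof.
apply: pk_leP => L [cL [u pu]].
have : x \in flatten L ++ u by rewrite (perm_mem pu) mem_head.
rewrite mem_cat; have [xL _|xL /= xu] := boolP (x \in flatten L); last first.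
  apply: leqW; apply: packs_pk; split => //; exists (rem x u).
  rewrite -(perm_cons x) (perm_trans _ pu)//.
  by rewrite -[x :: _]/([:: x] ++ _) perm_catCA perm_cat2l perm_sym perm_to_rem.
have /flattenP[l lL xl] := xL.
have PL := perm_to_rem lL.
have sL : size L = (size (rem l L)).+1 by rewrite (perm_size PL).
rewrite sL ltnS; apply: packs_pk; split.
  by move=> l' /mem_rem; apply: cL.
exists (rem x l ++ u); rewrite -(perm_cons x) (perm_trans _ pu)//.
have Pf : perm_eq (flatten L) (flatten (l :: rem l L)) by apply: perm_flatten.
rewrite perm_sym (perm_trans (perm_cat Pf (perm_refl u)))//=.
rewrite (perm_trans (_ : perm_eq _ ((x :: rem x l) ++ flatten (rem l L) ++ u)))//.
  by rewrite -catA perm_cat2r perm_to_rem.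
by rewrite /= perm_cons perm_catCA.
Qed.

Lemma pk_sub e e' s : {in s &, forall x y, e x y -> e' x y} -> (pk e s <= pk e' s)%N.
Proof.
move=> ee'; apply: pk_leP => L [cL [u pu]]; apply: packs_pk; split; last by exists u.
move=> l lL; have [sl el] := cL _ lL; split => // x0 i j ih jh aij.
have ls y : y \in l -> y \in s.
  by move=> yl; rewrite -(perm_mem pu) mem_cat; apply/orP; left; apply/flattenP; exists l.
by apply: ee'; rewrite ?ls ?mem_nth ?sl//; apply: el.
Qed.

Lemma pk_filter_le e (P : pred C) s : (pk e (seq.filter P s) <= pk e s)%N.
Proof.
elim: s => //= x s IH; case: ifP => _; last exact: leq_trans (pk_cons_ge _ _ _).
have [L [cL [u pu]] <-] := pk_packs e (x :: seq.filter P s).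
apply: packs_pk; split => //; exists (u ++ seq.filter (predC P) s).
by rewrite catA (perm_trans (perm_cat pu (perm_refl _)))//= perm_cons perm_filterC.
Qed.

Lemma pk_filter_count e (P : pred C) s :
  (pk e s <= pk e (seq.filter P s) + count (predC P) s)%N.
Proof.
elim: s => [|x s IH] /=; first by rewrite addn0.
case: (P x) => /=.
  have := pk_cons_ge e x (seq.filter P s).
  rewrite add0n; have [L [cL [u pu]] sL] := pk_packs e (x :: s).
  move=> _; rewrite -(pk_perm e (_ : perm_eq ((x :: seq.filter P s) ++ seq.filter (predC P) s) _)).
    elim: (seq.filter (predC P) s) (count (predC P) s) (size_filter (predC P) s) => [|y t IHt] k <-.
      by rewrite cats0 addn0.
    rewrite (pk_perm e (_ : perm_eq _ (y :: ((x :: seq.filter P s) ++ t)))).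
      by rewrite (leq_trans (pk_cons_le _ _ _))//= addnS ltnS IHt.
    by rewrite -[y :: t]cat1s -[y :: (_ ++ t)]cat1s perm_catCA.
  by rewrite /= perm_cons perm_filterC.
by rewrite add1n addnS; apply: leq_trans (pk_cons_le _ _ _) _; rewrite ltnS.
Qed.

Lemma pk_split_ge e (P : pred C) s :
  (pk e (seq.filter P s) + pk e (seq.filter (predC P) s) <= pk e s)%N.
Proof.
apply: leq_trans (pk_cat _ _ _) _.
by rewrite (@pk_perm e (_ ++ _) s)// perm_filterC.
Qed.

Hypothesis a_conn : index_connected.

(* A copy is connected, hence cannot meet two sides with no edge in between. *)
Lemma pk_split_le e (P : pred C) s : {in s &, forall x y, e x y -> P x = P y} ->
  (pk e s <= pk e (seq.filter P s) + pk e (seq.filter (predC P) s))%N.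
Proof.
move=> eP; apply: pk_leP => L [cL [u pu]].
have hom l : l \in L -> exists b, all (fun x => P x == b) l.
  move=> lL; have [sl el] := cL l lL.
  have [->|[x0 _]] : l = [::] \/ exists x0 : C, True.
    by case: (l) => [|x ?]; [left|right; exists x].
  by exists true.
  exists (P (nth x0 l 0)); apply/(all_nthP x0) => i; rewrite sl => ih; apply/eqP.
  apply: (a_conn (P := fun i => P (nth x0 l i))) => // {ih}i j ih jh aij.
  have ls y : y \in l -> y \in s.
    by move=> yl; rewrite -(perm_mem pu) mem_cat; apply/orP; left; apply/flattenP; exists l.
  by apply: eP; rewrite ?ls ?mem_nth ?sl//; apply: el.
have key (Q : pred C) : (forall l, l \in L -> exists b, all (fun x => Q x == b) l) ->
    (size (seq.filter (all Q) L) <= pk e (seq.filter Q s))%N.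
  move=> homQ; apply: packs_pk; split.
    by move=> l; rewrite mem_filter => /andP[_ /cL].
  exists (seq.filter Q u); rewrite (perm_trans _ (perm_filter Q pu))//.
  rewrite filter_cat perm_cat2r; elim: (L) homQ => //= l K IH hK.
  have {}IH : perm_eq (flatten [seq x <- K | all Q x]) [seq x <- flatten K | Q x].
    by apply: IH => l' l'K; apply: hK; rewrite inE l'K orbT.
  have [b lb] := hK l (mem_head _ _).
  rewrite filter_cat; case: ifPn => [lQ|lQ] /=.
    by rewrite (all_filterP lQ) perm_cat2l.
  suff -> : seq.filter Q l = [::] by [].
  case: b lb => [lb|/allP lb].
    by case/negP: lQ; apply/allP => x /(allP lb) /eqP.
  by apply/eqP; rewrite -[_ == _]negbK -has_filter; apply/hasPn => x /lb /eqP ->.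
have homC l : l \in L -> exists b, all (fun x => predC P x == b) l.
  move=> /hom[b lb]; exists (~~ b); apply: sub_all lb => x /= /eqP ->//.
apply: leq_trans (leq_add (key _ hom) (key _ homC)).
rewrite !size_filter -(count_predC (all P) L) leq_add2l.
rewrite -!size_filter.
have : {in L, forall l, predC (all P) l -> all (predC P) l}.
  move=> l /hom[b /allP lb] /= nP; apply/allP => x xl /=.
  case: b lb => [lb|lb]; last by rewrite (eqP (lb _ xl)).
  by case/negP: nP; apply/allP => y /lb /eqP.
elim: (L) => //= l K IH hK.
have {}IH := IH (fun l lK => hK l (mem_behead (s := _ :: _) lK)).
have := hK l (mem_head _ _) => /=; case: (all P l) => /= [_|/(_ isT) ->//].
by apply: (leq_trans IH); case: ifP.
Qed.

End one_type.

Section by_key.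
Variables (C : eqType) (K : eqType) (kappa : C -> K) (e : rel C).
Hypothesis h_gt0 : (0 < h)%N.

Lemma pk_key_ge (ks : seq K) s : uniq ks ->
  (\sum_(k <- ks) pk e (seq.filter (fun x => kappa x == k) s) <= pk e s)%N.
Proof.
elim: ks s => [|k ks IH] s /=; first by rewrite big_nil.
move=> /andP[kks uks]; rewrite big_cons.
apply: leq_trans (pk_split_ge h_gt0 e (fun x => kappa x == k) s).
rewrite leq_add2l; apply: leq_trans (IH _ uks); rewrite leq_eqVlt; apply/orP; left; apply/eqP.
apply: eq_big_seq => k' k'ks; congr (pk _ _); rewrite -filter_predI.
apply: eq_filter => x /=; have [->|//] := eqVneq (kappa x) k'.
by rewrite (_ : k' == k = false)//; apply: contraNF kks => /eqP <-.
Qed.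

Lemma pk_key_le (ks : seq K) s : index_connected -> uniq ks ->
  {in s, forall x, kappa x \in ks} -> {in s &, forall x y, e x y -> kappa x = kappa y} ->
  (pk e s <= \sum_(k <- ks) pk e (seq.filter (fun x => kappa x == k) s))%N.
Proof.
move=> aco; elim: ks s => [|k ks IH] s /=.
  by case: s => [|x s _ /(_ x (mem_head _ _))//]; rewrite pk_nil.
move=> /andP[kks uks] sk ek; rewrite big_cons.
apply: leq_trans (pk_split_le h_gt0 aco (P := fun x => kappa x == k) _) _.
  by move=> x y xs ys exy; rewrite (ek x y).
rewrite leq_add2l; apply: leq_trans (IH _ uks _ _) _.
- move=> x; rewrite mem_filter => /andP[/= nk /sk]; rewrite inE => /orP[kk|//].
  by rewrite kk in nk.
- by move=> x y; rewrite !mem_filter => /andP[_ xs] /andP[_ ys]; apply: ek.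
rewrite leq_eqVlt; apply/orP; left; apply/eqP.
apply: eq_big_seq => k' k'ks; congr (pk _ _); rewrite -filter_predI.
apply: eq_filter => x /=; have [->|//] := eqVneq (kappa x) k'.
by rewrite (_ : k' == k = false)//; apply: contraNF kks => /eqP <-.
Qed.

Lemma pk_clique s : {in s &, forall x y, e x y} -> (size s <= h * pk e s + h)%N.
Proof.
have [n] := ubnP (size s); elim: n s => // n IH s sn cl.
have [sh|hs] := leqP (size s) h; first by apply: leq_trans sh (leq_addl _ _).
have := cat_take_drop h s => E.
have st : size (take h s) = h by rewrite size_takel// ltnW.
have p1 : (1 <= pk e (take h s))%N.
  apply: (@packs_pk _ h_gt0 e (take h s) [:: take h s]); split.
    move=> l; rewrite inE => /eqP ->; split => // x0 i j ih jh aij.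
    by apply: cl; apply: (@mem_take h); rewrite mem_nth// st.
  by exists [::]; rewrite /= !cats0.
have := pk_cat h_gt0 e (take h s) (drop h s); rewrite E => pc.
have H : (size (drop h s) <= h * pk e (drop h s) + h)%N.
  apply: IH => [|x y /mem_drop xs /mem_drop ys]; last exact: cl.
  by rewrite size_drop; move: h_gt0; lia.
rewrite size_drop in H; move: H p1 pc hs h_gt0.
move: (size s) (pk e (drop h s)) (pk e (take h s)) (pk e s) => S D T K0; nia.
Qed.

Lemma pk_clique_key (ks : seq K) s : uniq ks ->
  {in s, forall x, kappa x \in ks} -> {in s &, forall x y, kappa x = kappa y -> e x y} ->
  (size s <= h * pk e s + h * size ks)%N.
Proof.
move=> uks sk ke; apply: leq_trans (_ : h * \sum_(k <- ks) pk e (seq.filter (fun x => kappa x == k) s)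
   + h * size ks <= _)%N; last by rewrite leq_add2r leq_mul2l pk_key_ge ?orbT.
rewrite big_distrr/= (_ : h * size ks = \sum_(k <- ks) h)%N; last first.
  by rewrite big_const_seq count_predT iter_addn_0.
rewrite -big_split/=.
apply: leq_trans (_ : \sum_(k <- ks) size (seq.filter (fun x => kappa x == k) s) <= _)%N.
  elim: s sk {ke} => //= x s IH sk.
  have {}IH := IH (fun y ys => sk y (mem_behead (s := _ :: _) ys)).
  have xk := sk x (mem_head _ _).
  rewrite (eq_bigr (fun k => (kappa x == k) + size (seq.filter (fun x => kappa x == k) s))%N); last first.
    by move=> k _; case: ifP.
  rewrite big_split/= -add1n leq_add//.
  by rewrite (big_rem _ xk)/= eqxx.
apply: leq_sum => k _; apply: pk_clique => x y.
by rewrite !mem_filter => /andP[/eqP xk xs] /andP[/eqP yk ys]; apply: ke; rewrite // xk.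
Qed.

End by_key.

Section two_types.
Variables (C D : eqType) (g : C -> D) (e : rel C) (e' : rel D).
Hypothesis h_gt0 : (0 < h)%N.

Lemma pk_map_ge s : {in s &, forall x y, e x y -> e' (g x) (g y)} ->
  (pk e s <= pk e' (map g s))%N.
Proof.
move=> ee; apply: (pk_leP (k := pk e' _)) => L [cL [u pu]].
rewrite -(size_map (map g) L); apply: packs_pk => //; split.
  move=> _ /mapP[l lL ->]; have [sl el] := cL l lL; split; first by rewrite size_map.
  have ls y : y \in l -> y \in s.
    by move=> yl; rewrite -(perm_mem pu) mem_cat; apply/orP; left; apply/flattenP; exists l.
  move=> x1 i j ih jh aij.
  case: l sl el lL ls => [|x0 l] sl el lL ls; first by rewrite -sl in ih.
  rewrite !(nth_map x0) ?sl//; apply: ee; rewrite ?ls ?mem_nth ?sl//; exact: el.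
by exists (map g u); rewrite -map_flatten -map_cat; apply: perm_map.
Qed.

(** The map [g] need not be injective, so a packing of the image has to be pulled back by positions
    and not by values. *)
Lemma perm_map_lift s t : perm_eq t (map g s) -> exists2 s', perm_eq s' s & t = map g s'.
Proof.
case: s => [|x0 s]; first by move=> /perm_size/size0nil ->; exists [::].
move: (x0 :: s) => {}s p.
have /(perm_iotaP (g x0)) [Is pI ->] := p.
rewrite size_map in pI.
exists (map (nth x0 s) Is).
  rewrite (perm_trans (perm_map _ pI))//.
  by rewrite (_ : map _ _ = s)// -[RHS](mkseq_nth x0).
rewrite -map_comp; apply/eq_in_map => i iI /=; rewrite (nth_map x0)//.
by have := perm_mem pI i; rewrite iI mem_iota/= add0n => <-.
Qed.

Lemma pk_map_le s : {in s &, forall x y, e' (g x) (g y) -> e x y} ->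
  (pk e' (map g s) <= pk e s)%N.
Proof.
move=> ee; apply: (pk_leP (k := pk e _)) => L [cL [u pu]].
have [s' ps' E] := perm_map_lift pu.
have L' : exists2 L0 : seq (seq C), L = map (map g) L0 & exists u0, s' = flatten L0 ++ u0.
  elim: (L) {ps' cL pu} s' E => [|l K IH] s' /= E; first by exists [::] => //; exists s'.
  have E1 : l = map g (take (size l) s') by rewrite map_take -E -catA take_size_cat.
  have E2 : flatten K ++ u = map g (drop (size l) s') by rewrite map_drop -E -catA drop_size_cat.
  have [K0 -> [u0 E3]] := IH _ E2.
  exists (take (size l) s' :: K0); first by rewrite /= -E1.
  by exists u0; rewrite /= -catA -E3 cat_take_drop.
have [L0 LE [u0 sE]] := L'; rewrite LE size_map; apply: packs_pk => //; split; last first.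
  by exists u0; rewrite -sE.
move=> l lL0; have [] := cL (map g l); first by rewrite LE map_f.
rewrite size_map => sl el; split => // x0 i j ih jh aij.
have ls y : y \in l -> y \in s.
  by move=> yl; rewrite -(perm_mem ps') sE mem_cat; apply/orP; left; apply/flattenP; exists l.
apply: ee; rewrite ?ls ?mem_nth ?sl//.
by have := el (g x0) i j ih jh aij; rewrite !(nth_map x0) ?sl.
Qed.

Lemma pk_map s : {in s &, forall x y, e' (g x) (g y) = e x y} ->
  pk e' (map g s) = pk e s.
Proof.
move=> ee; apply/eqP; rewrite eqn_leq pk_map_le ?pk_map_ge//.
all: by move=> x y xs ys; rewrite ee.
Qed.

End two_types.

End packing_sequences.

(** * Graph packings as list packings *)

Section graph_packings.
Variables (U : choiceType) (H : graph U) (u0 : U).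

Let vs := enum_fset (vertices H).
Let h := #|` vertices H|.

Let vs_uniq : uniq vs. Proof. exact: fset_uniq. Qed.

(** Enumerating the vertices turns [H] into a relation on indices; [u0] is only a default for
    [nth]. *)
Definition index_adj : rel nat := fun i j => adj H (nth u0 vs i) (nth u0 vs j).

Lemma index_adj_connected : connected_graph H -> index_connected h index_adj.
Proof.
move=> Hc P aP i j ih jh.
have iv : nth u0 vs i \in vertices H by apply: mem_nth.
have jv : nth u0 vs j \in vertices H by apply: mem_nth.
have [p pth lst] := Hc _ _ iv jv.
(* Labels are moved from indices to vertices, so that the induction can follow a path of [H]. *)
have iE k : (k < h)%N -> P k = P (index (nth u0 vs k) vs).
  by move=> kh; rewrite index_uniq ?vs_uniq.
rewrite (iE _ ih) (iE _ jh) -lst.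
elim: p (nth u0 vs i) iv pth {lst} => //= y p IH x xv /andP[xy pth].
have yv : y \in vertices H by apply: (adj_vertices (x := y) (y := x)); rewrite adj_sym.
rewrite -(IH _ yv pth); apply: aP; rewrite ?index_mem//.
by rewrite /index_adj !nth_index.
Qed.

Variables (T : choiceType) (x0 : T) (e : rel T) (G : graph T).
Hypothesis h_gt0 : (0 < h)%N.
Hypothesis GE : forall x y, adj G x y = [&& x \in vertices G, y \in vertices G, x != y & e x y].

Lemma has_packing_packs k :
  has_packing H G k -> exists2 L, packs h index_adj e (enum_fset (vertices G)) L & size L = k.
Proof.
move=> [F [sF dF]].
have /choice[f fP] : forall i, exists f : U -> T, [/\ {in vertices H &, injective f},
    [fset f x | x in vertices H]%fset = vertices (F i) &
    {in vertices H &, forall x y, adj (F i) (f x) (f y) = adj H x y}].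
  by move=> i; have [_ [f fP]] := sF i; exists f.
exists [seq [seq f i u | u <- vs] | i <- enum 'I_k]; last by rewrite size_map size_enum_ord.
have fF i u : u \in vertices H -> f i u \in vertices (F i).
  by move=> uH; have [_ <- _] := fP i; apply/imfsetP; exists u.
split.
  move=> _ /mapP[i _ ->]; have [fi fim fa] := fP i; split; first by rewrite size_map.
  move=> y0 a b ah bh; rewrite /index_adj !(nth_map u0)// => ab.
  have [_ sa] := (sF i).1.
  have := sa (f i (nth u0 vs a)) (f i (nth u0 vs b)).
  rewrite fa ?mem_nth// => /(_ ab).
  by rewrite GE => /and4P[].
set fl := flatten _.
have fl_uniq : uniq fl.
  rewrite /fl; apply: allpairs_uniq; [exact: enum_uniq|exact: fset_uniq|].
  move=> [i u] [j v] /allpairsP[[i' u'] [_ /= u'v [-> ->]]] /allpairsP[[j' v'] [_ /= v'v [-> ->]]] E.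
  have [ij|ij] := eqVneq i' j'.
    by subst j'; congr (_, _); have [fi _ _] := fP i'; apply: fi.
  have /fdisjointP/(_ _ (fF i' u' u'v)) := dF _ _ ij.
  by rewrite E fF.
have fl_sub x : x \in fl -> x \in vertices G.
  move=> /allpairsP[[i u] [_ /= uv ->]]; have [sv _] := (sF i).1.
  by apply: (fsubsetP sv); apply: fF.
exists (seq.filter (fun x => x \notin fl) (enum_fset (vertices G))).
apply: uniq_perm; last 2 first.
- exact: fset_uniq.
- by move=> x; rewrite mem_cat mem_filter; have [/fl_sub//|] := boolP (x \in fl).
rewrite cat_uniq fl_uniq filter_uniq ?fset_uniq//= andbT.
by apply/hasPn => x; rewrite mem_filter => /andP[].
Qed.

Lemma uniq_flatten_disjoint (L : seq (seq T)) i j x : uniq (flatten L) -> i != j ->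
  (i < size L)%N -> (j < size L)%N -> x \in nth [::] L i -> x \notin nth [::] L j.
Proof.
elim: L i j => // l L IH [|i] [|j] //=; rewrite cat_uniq => /and3P[ul /hasPn nl uL].
- move=> _ _; rewrite ltnS => jL xl; apply/negP => xj; have /nl : x \in flatten L.
    by apply/flattenP; exists (nth [::] L j) => //; exact: mem_nth.
  by rewrite /= xl.
- move=> _; rewrite ltnS => iL _ xi; apply/negP => xl; have /nl : x \in flatten L.
    by apply/flattenP; exists (nth [::] L i) => //; exact: mem_nth.
  by rewrite /= xl.
- by rewrite eqSS !ltnS; exact: IH.
Qed.

(** Each list of the packing carries the edges of [H] transported along positions. The lists have no
    repetitions, so this is an isomorphic copy; irreflexivity of [H] excludes the loops that [e] may
    have. *)
Lemma packs_has_packing L :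
  packs h index_adj e (enum_fset (vertices G)) L -> has_packing H G (size L).
Proof.
move=> [cL [u pu]].
have uL : uniq (flatten L).
  have : uniq (flatten L ++ u) by rewrite (perm_uniq pu) fset_uniq.
  by rewrite cat_uniq => /and3P[].
have LG l x : l \in L -> x \in l -> x \in vertices G.
  move=> lL xl; rewrite -[_ \in _](perm_mem pu) mem_cat; apply/orP; left.
  by apply/flattenP; exists l.
have ul l : l \in L -> uniq l.
  by elim: (L) uL => //= l' L' IH; rewrite cat_uniq inE => /and3P[? _ /IH H'] /predU1P[->|/H'].
have K (l : seq T) : exists K : graph T, vertices K = [fset x in l]%fset /\
    forall x y, adj K x y = [&& x \in l, y \in l & index_adj (index x l) (index y l)].
  unshelve eexists (@Graph T [fset x in l]%fset
    (fun x y => [&& x \in l, y \in l & index_adj (index x l) (index y l)]) _ _ _) => //.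
  - by move=> x y; rewrite /index_adj andbCA adj_sym.
  - by move=> x; rewrite /index_adj adj_irr !andbF.
  - by move=> x y /and3P[xl _ _]; rewrite inE.
have {K}/choice[K /all_and2[KV KE]] := K.
exists (fun i => K (nth [::] L i)); split; last first.
  move=> i j ij; apply/fdisjointP => x; rewrite !KV !inE.
  by apply: uniq_flatten_disjoint.
move=> i; set l := nth _ _ _; have lL : l \in L by apply: mem_nth.
have [sl el] := cL l lL.
split.
  split; first by apply/fsubsetP => x; rewrite KV inE; apply: LG.
  move=> x y; rewrite KE => /and3P[xl yl xy]; rewrite GE.
  rewrite !(LG l)//=; apply/andP; split.
    by apply: contraTneq xy => ->; rewrite /index_adj adj_irr.
  rewrite -[x](nth_index x0 xl) -[y](nth_index x0 yl); apply: el => //.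
  - by rewrite -sl index_mem.
  - by rewrite -sl index_mem.
exists (fun v => nth x0 l (index v vs)).
have ih v : v \in vertices H -> (index v vs < size l)%N by rewrite sl -index_mem.
have ui := ul _ lL.
split.
- move=> v w vH wH /eqP; rewrite nth_uniq ?ih// => /eqP E.
  by rewrite -[v](nth_index u0 (s := vs))// E nth_index.
- apply/fsetP => x; rewrite KV inE; apply/imfsetP/idP => [[v /= vH ->]|xl].
    by rewrite mem_nth// ih.
  have xh : (index x l < h)%N by rewrite -sl index_mem.
  exists (nth u0 vs (index x l)); first exact: mem_nth.
  by rewrite index_uniq ?vs_uniq// nth_index.
- move=> v w vH wH; rewrite KE !mem_nth ?ih//=.
  by rewrite /index_adj !index_uniq ?ih// !nth_index.
Qed.

Lemma packing_numberE :
  packing_number H G = pk h index_adj e (enum_fset (vertices G)).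
Proof.
rewrite /packing_number /pk; apply: eq_bigl => k; apply: asbool_equiv_eq; split.
  exact: has_packing_packs.
by move=> [L pL <-]; exact: packs_has_packing.
Qed.

End graph_packings.

Lemma psiE (R : realType) (d : nat) (U : choiceType) (H : graph U) (u0 : U)
    (X : {fset d.-tuple R}) : (0 < #|` vertices H|)%N ->
  psi H X = pk #|` vertices H| (index_adj H u0) (fun x y => edist x y <= 1) (enum_fset X).
Proof.
move=> h0; rewrite /psi.
by rewrite (@packing_numberE _ H u0 _ [tuple 0 | i < d] (fun x y => edist x y <= 1)).
Qed.

(** * Finitely supported laws *)

Section means.
Context {R : realType}.

(** A law is a weighted finite family of outcomes, possibly repeated, and is used through its
    expectation functional. Independent draws live on products of index types, and exchanging
    expectations is exchanging finite sums. *)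
Record mean (C : Type) := Mean {
  msupp : finType;
  mwt : msupp -> R;
  mpt : msupp -> C;
  mwt_ge0 : forall i, 0 <= mwt i;
  mwt_sum : \sum_i mwt i = 1 }.

Definition mapp C (M : mean C) (f : C -> R) : R := \sum_i mwt i * f (mpt (m := M) i).
Local Coercion mapp : mean >-> Funclass.

Section one_mean.
Variables (C : Type) (M : mean C).
Implicit Types (f g : C -> R) (c : R).

Lemma meanD f g : M (fun x => f x + g x) = M f + M g.
Proof. by rewrite /mapp -big_split/=; apply: eq_bigr => i _; rewrite mulrDr. Qed.

Lemma meanZ c f : M (fun x => c * f x) = c * M f.
Proof. by rewrite /mapp mulr_sumr; apply: eq_bigr => i _; rewrite mulrCA. Qed.

Lemma meanZr c f : M (fun x => f x * c) = M f * c.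
Proof. by rewrite /mapp mulr_suml; apply: eq_bigr => i _; rewrite mulrA. Qed.

Lemma meanN f : M (fun x => - f x) = - M f.
Proof. by rewrite /mapp -sumrN; apply: eq_bigr => i _; rewrite mulrN. Qed.

Lemma meanB f g : M (fun x => f x - g x) = M f - M g.
Proof. by rewrite -meanN -meanD. Qed.

Lemma mean_cst c : M (fun=> c) = c.
Proof. by rewrite /mapp -mulr_suml mwt_sum mul1r. Qed.

Lemma mean_sum (I : Type) (r : seq I) (P : pred I) (f : I -> C -> R) :
  M (fun x => \sum_(i <- r | P i) f i x) = \sum_(i <- r | P i) M (f i).
Proof.
by rewrite exchange_big/=; apply: eq_bigr => i _; rewrite mulr_sumr.
Qed.

Lemma mean_le f g : (forall x, f x <= g x) -> M f <= M g.
Proof. by move=> fg; apply: ler_sum => i _; apply: ler_wpM2l => //; exact: mwt_ge0. Qed.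

Lemma mean_ge0 f : (forall x, 0 <= f x) -> 0 <= M f.
Proof. by move=> f0; apply: sumr_ge0 => i _; rewrite mulr_ge0// mwt_ge0. Qed.

Lemma mean_norm f : `|M f| <= M (fun x => `|f x|).
Proof.
apply: le_trans (ler_norm_sum _ _ _) _; apply: ler_sum => i _.
by rewrite normrM ger0_norm// mwt_ge0.
Qed.

Lemma mean_between c c' f : (forall x, c <= f x <= c') -> c <= M f <= c'.
Proof.
move=> fc; apply/andP; split.
  by rewrite -[leLHS](mean_cst c); apply: mean_le => x; case/andP: (fc x).
by rewrite -[leRHS](mean_cst c'); apply: mean_le => x; case/andP: (fc x).
Qed.

End one_mean.

Lemma eq_mean C (M : mean C) f g : (forall x, f x = g x) -> M f = M g.
Proof. by move=> fg; congr mapp; apply/funext. Qed.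

Lemma mean_exchange C D (M : mean C) (N : mean D) (f : C -> D -> R) :
  M (fun x => N (f x)) = N (fun y => M (fun x => f x y)).
Proof.
rewrite /mapp; under eq_bigr do rewrite mulr_sumr.
rewrite exchange_big/=; apply: eq_bigr => j _; rewrite mulr_sumr.
by apply: eq_bigr => i _; rewrite mulrCA.
Qed.

Definition mean_map C D (g : C -> D) (M : mean C) : mean D :=
  Mean (g \o mpt (m := M)) (@mwt_ge0 _ M) (mwt_sum M).

Lemma mean_mapE C D (g : C -> D) (M : mean C) f : mean_map g M f = M (f \o g).
Proof. by []. Qed.

Section weighted_list.
Variables (C : Type) (V : seq C) (w : C -> R).
Hypotheses (w_ge0 : forall v, 0 <= w v) (w_sum : \sum_(v <- V) w v = 1).

Fact seq_mean_sum : \sum_(i < size V) w (tnth (in_tuple V) i) = 1.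
Proof. by rewrite -(big_tnth _ _ _ xpredT). Qed.

Definition seq_mean : mean C :=
  Mean (tnth (in_tuple V)) (fun i => w_ge0 (tnth (in_tuple V) i)) seq_mean_sum.

Lemma seq_meanE f : seq_mean f = \sum_(v <- V) w v * f v.
Proof. by rewrite /mapp/= -(big_tnth _ _ _ xpredT (fun v => w v * f v)). Qed.

End weighted_list.

Section powers.
Variable C : Type.

Fact mean_nil_ge0 (i : unit) : 0 <= (1 : R).
Proof. exact: ler01. Qed.

Fact mean_nil_sum : \sum_(i : unit) (1 : R) = 1.
Proof. by rewrite sumr_const card_unit. Qed.

Definition mean_nil : mean (seq C) := Mean (fun=> [::]) mean_nil_ge0 mean_nil_sum.

Section cons.
Variables (M : mean C) (N : mean (seq C)).

Fact mean_cons_ge0 (p : msupp M * msupp N) : 0 <= mwt p.1 * mwt p.2.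
Proof. by rewrite mulr_ge0// mwt_ge0. Qed.

Fact mean_cons_sum : \sum_(p : msupp M * msupp N) mwt p.1 * mwt p.2 = 1.
Proof.
rewrite -(pair_bigA _ (fun i j => mwt i * mwt j))/=.
by under eq_bigr do rewrite -mulr_sumr mwt_sum mulr1; exact: mwt_sum.
Qed.

Definition mean_cons : mean (seq C) :=
  Mean (fun p => mpt p.1 :: mpt p.2) mean_cons_ge0 mean_cons_sum.

Lemma mean_consE F : mean_cons F = M (fun x => N (fun s => F (x :: s))).
Proof.
rewrite /mapp/= -(pair_bigA _ (fun i j => mwt i * mwt j * F (mpt i :: mpt j)))/=.
by apply: eq_bigr => i _; rewrite mulr_sumr; apply: eq_bigr => j _; rewrite mulrA.
Qed.

End cons.

Fixpoint iid (M : mean C) n : mean (seq C) :=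
  if n is n'.+1 then mean_cons M (iid M n') else mean_nil.

Lemma iid0 M F : iid M 0 F = F [::].
Proof. by rewrite /mapp/= big_const card_unit/= addr0 mul1r. Qed.

Lemma iidS M n F : iid M n.+1 F = M (fun x => iid M n (fun s => F (x :: s))).
Proof. exact: mean_consE. Qed.

Lemma iid_le_supp (M : mean C) (S : pred C) n (F G : seq C -> R) :
  (forall i, S (mpt (m := M) i)) ->
  (forall s, size s = n -> all S s -> F s <= G s) -> iid M n F <= iid M n G.
Proof.
move=> MS; elim: n F G => [|n IH] F G FG; first by rewrite !iid0 FG.
rewrite !iidS; apply: ler_sum => i _; apply: ler_wpM2l; first exact: mwt_ge0.
by apply: IH => s sn sS; apply: FG; rewrite /= ?sn// MS.
Qed.

Lemma iid_le M n (F G : seq C -> R) :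
  (forall s, size s = n -> F s <= G s) -> iid M n F <= iid M n G.
Proof. by move=> FG; apply: (@iid_le_supp M xpredT) => // s /FG. Qed.

(** Insertion anywhere, not just at the head, makes the property stable under fixing the first
    entry, as the inductions over [iid] require. *)
Definition unit_increments (F : seq C -> R) :=
  forall s x t, F (s ++ t) <= F (s ++ x :: t) <= F (s ++ t) + 1.

Lemma unit_increments_cons F x : unit_increments F -> unit_increments (fun s => F (x :: s)).
Proof. by move=> FI s y t; apply: (FI (x :: s)). Qed.

Lemma iid_cons_between M n F x : unit_increments F ->
  iid M n F <= iid M n (fun s => F (x :: s)) <= iid M n F + 1.
Proof.
move=> FI; rewrite -[X in _ + X](mean_cst (iid M n) 1) -meanD.
by rewrite !mean_le// => s; have /andP[] := FI [::] x s.
Qed.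

Lemma iidS_between M n F : unit_increments F -> iid M n F <= iid M n.+1 F <= iid M n F + 1.
Proof. by move=> FI; rewrite iidS; apply: mean_between => x; exact: iid_cons_between. Qed.

(** The entries are replaced one at a time. With the others averaged out, [F] varies by at most one
    with the replaced entry, so each replacement costs at most the total variation distance
    [tau]. *)
Lemma iid_total_variation (M N : mean C) tau n F :
  (forall f, (forall x, 0 <= f x <= 1) -> `|M f - N f| <= tau) ->
  unit_increments F -> `|iid M n F - iid N n F| <= n%:R * tau.
Proof.
move=> MN; elim: n F => [|n IH] F FI; first by rewrite !iid0 subrr normr0 mul0r.
rewrite !iidS -natr1 mulrDl mul1r.
set g := fun x => iid N n (fun s => F (x :: s)).
rewrite (_ : _ - _ = M (fun x => iid M n (fun s => F (x :: s)) - g x) + (M g - N g)); last first.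
  by rewrite meanB/g; ring.
apply: le_trans (ler_normD _ _) _; apply: lerD.
  apply: le_trans (mean_norm _ _) _; rewrite -[leRHS](mean_cst M).
  by apply: mean_le => x; apply: IH; exact: unit_increments_cons.
(* Both means preserve constants, so subtracting one brings the integrand into the unit interval
   without changing the difference. *)
have -> : M g - N g = M (fun x => g x - iid N n F) - N (fun x => g x - iid N n F).
  by rewrite !meanB !mean_cst; ring.
apply: MN => x; have /andP[] := iid_cons_between N n x FI.
by rewrite subr_ge0 lerBlDl => -> ->.
Qed.

(** From [expR (- y) >= 1 - y] one gets [expR y <= 1 / (1 - y)], and [(1 - y) * (1 + y + 2 * y ^+ 2)
    = 1 + y ^+ 2 * (1 - 2 * y)]. *)
Lemma expR_le_quad (y : R) : y <= 1 / 2 -> expR y <= 1 + y + 2 * y ^+ 2.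
Proof.
move=> y2; have := expR_ge1Dx (- y); rewrite expRN => H.
have y0 := expR_gt0 y.
have {}H : (1 - y) * expR y <= 1 by rewrite -ler_pdivlMr// div1r.
have y1 : 0 < 1 - y by lra.
have -> : expR y = (1 - y) * expR y / (1 - y) by field; lra.
rewrite ler_pdivrMr//; apply: le_trans H _.
by nra.
Qed.

(** The exponential martingale bound: as the first entry varies, the conditional mean of [F] stays
    in an interval of length one, so each entry contributes a factor of at most [1 + 2 * b ^+ 2]. *)
Lemma iid_exp_le (M : mean C) n F b : unit_increments F -> `|b| <= 1 / 2 ->
  iid M n (fun s => expR (b * F s)) <= expR (b * iid M n F + n%:R * (2 * b ^+ 2)).
Proof.
move=> FI b2; elim: n F FI => [|n IH] F FI; first by rewrite !iid0 mul0r addr0.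
rewrite !iidS; set g := fun x => iid M n (fun s => F (x :: s)); rewrite -/(g _).
have gb x : iid M n F <= g x <= iid M n F + 1 by apply: iid_cons_between.
have mb : iid M n F <= M g <= iid M n F + 1 by apply: mean_between.
apply: (@le_trans _ _ (M (fun x => expR (b * M g + n%:R * (2 * b ^+ 2)) *
    (1 + b * (g x - M g) + 2 * b ^+ 2)))).
  apply: mean_le => x; apply: le_trans (IH _ (unit_increments_cons x FI)) _.
  rewrite -/(g x) (_ : b * g x + _ = b * M g + n%:R * (2 * b ^+ 2) + b * (g x - M g)); last by ring.
  rewrite expRD ler_pM2l ?expR_gt0//.
  have gM : `|g x - M g| <= 1.
    by rewrite ler_norml; have /andP[? ?] := gb x; have /andP[? ?] := mb; apply/andP; split; lra.
  apply: le_trans (expR_le_quad _) _.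
    apply: le_trans (ler_norm _) _; rewrite normrM.
    by apply: le_trans (_ : _ <= 1 / 2 * 1) _; [apply: ler_pM|lra].
  rewrite lerD2l ler_pM2l// exprMn ler_piMr ?sqr_ge0//.
  by rewrite -real_normK ?num_real// expr_le1.
(* The linear term has mean zero; the remaining factor is absorbed into the exponential. *)
rewrite meanZ !meanD !meanZ meanB !mean_cst subrr mulr0 addr0.
rewrite (_ : _ + n.+1%:R * _ = b * M g + n%:R * (2 * b ^+ 2) + 2 * b ^+ 2); last first.
  by rewrite -natr1; ring.
by rewrite [leRHS]expRD ler_pM2l ?expR_gt0// expR_ge1Dx.
Qed.

Definition ind (D : pred C) (x : C) : R := (D x)%:R.

(** The hypothesis says that [N] is [M] conditioned on [D]: given how many entries fall in [D],
    these entries are independent with law [N]. *)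
Lemma iid_filter (M N : mean C) (D : pred C) n F :
  (forall f, M (fun x => ind D x * f x) = M (ind D) * N f) ->
  iid M n (fun s => F (seq.filter D s)) = iid M n (fun s => iid N (count D s) F).
Proof.
move=> MN; elim: n F => [|n IH] F; first by rewrite !iid0.
rewrite !iidS.
transitivity (M (fun x => ind D x * iid M n (fun s => F (x :: seq.filter D s))) +
              M (fun x => (1 - ind D x) * iid M n (fun s => F (seq.filter D s)))).
  rewrite -meanD; apply: eq_mean => x; rewrite /ind /=.
  by case: (D x); rewrite ?(mul1r, mul0r, subrr, subr0, addr0, add0r).
transitivity (M (fun x => ind D x * iid M n (fun s => iid N (count D s).+1 F)) +
              M (fun x => (1 - ind D x) * iid M n (fun s => iid N (count D s) F))); last first.
  rewrite -meanD; apply: eq_mean => x; rewrite /ind /=.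
  by case: (D x); rewrite ?(mul1r, mul0r, subrr, subr0, addr0, add0r).
rewrite IH; congr (_ + _).
under eq_mean do rewrite (IH (fun s => F (_ :: s))).
rewrite MN meanZr; congr (_ * _); rewrite mean_exchange; apply: eq_mean => s.
by rewrite iidS.
Qed.

(** Variance plus squared bias of a binomial variable. With [c] free, the induction absorbs an entry
    in [D] by passing from [c] to [c - 1]. *)
Lemma iid_count_sqr (M : mean C) (D : pred C) n c : let q := M (ind D) in
  iid M n (fun s => ((count D s)%:R - c) ^+ 2) = n%:R * q * (1 - q) + (n%:R * q - c) ^+ 2.
Proof.
move=> q; elim: n c => [|n IH] c; first by rewrite iid0 /= !mulr0n !mul0r !add0r.
rewrite iidS (@eq_mean _ _ _ (fun x => ind D x * (n%:R * q * (1 - q) + (n%:R * q - (c - 1)) ^+ 2) +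
   (1 - ind D x) * (n%:R * q * (1 - q) + (n%:R * q - c) ^+ 2))); last first.
  move=> x; rewrite -!IH /ind /=; case: (D x); rewrite ?(mul1r, mul0r, subrr, subr0, addr0, add0r)//.
  by apply: eq_mean => s; rewrite natrD ?mulr1n ?mulr0n; congr (_ ^+ 2); ring.
by rewrite meanD !meanZr meanB mean_cst -/q -natr1; ring.
Qed.

Lemma mean_ind_ge0 (M : mean C) D : 0 <= M (ind D).
Proof. by apply: mean_ge0 => x; rewrite /ind ler0n. Qed.

Lemma iid_count (M : mean C) D n : iid M n (fun s => (count D s)%:R) = n%:R * M (ind D).
Proof.
elim: n => [|n IH]; first by rewrite iid0 mul0r.
rewrite iidS (@eq_mean _ _ _ (fun x => ind D x + n%:R * M (ind D))).
  by rewrite meanD mean_cst -natr1; ring.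
by move=> x; rewrite -IH /ind -[X in X + _](mean_cst (iid M n) (D x)%:R) -meanD; apply: eq_mean => s; rewrite natrD.
Qed.

End powers.

Lemma unit_steps_lipschitz (u : nat -> R) : (forall n, u n <= u n.+1 <= u n + 1) ->
  forall m n, `|u m - u n| <= `|m%:R - n%:R|.
Proof.
move=> uS.
have H m k : 0 <= u (m + k)%N - u m <= k%:R.
  elim: k => [|k IH]; first by rewrite addn0 subrr lexx.
  have /andP[] := uS (m + k)%N; rewrite addnS -natr1; case/andP: IH; lra.
move=> m n; wlog mn : m n / (m <= n)%N.
  by move=> W; case: (leqP m n) => [|/ltnW] /W; rewrite // distrC [in leRHS]distrC.
have := H m (n - m)%N; rewrite subnKC// natrB// => /andP[? ?].
by rewrite distrC [leRHS]distrC !ger0_norm// (le_trans _ (_ : u n - u m <= _)).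
Qed.

Lemma norm_le_quad (u delta : R) : 0 < delta -> `|u| <= delta + u ^+ 2 / delta.
Proof.
move=> d0; rewrite -real_normK ?num_real//; have := normr_ge0 u; move: (`|u|) => v v0.
rewrite -(ler_pM2r d0) mulrDl divfK ?gt_eqF//.
by have := sqr_ge0 (v - delta); nra.
Qed.

(* Chebyshev in the weak form [|u| <= delta + u^2 / delta], which avoids square roots. *)
Lemma iid_count_approx C (M : mean C) (D : pred C) n (u : nat -> R) k delta : 0 < delta ->
  (forall n, u n <= u n.+1 <= u n + 1) ->
  `|iid M n (fun s => u (count D s)) - u k| <=
    delta + (n%:R * M (ind D) + (n%:R * M (ind D) - k%:R) ^+ 2) / delta.
Proof.
move=> d0 uS; rewrite -[X in _ - X](mean_cst (iid M n)) -meanB.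
apply: le_trans (mean_norm _ _) _.
apply: (@le_trans _ _ (iid M n (fun s => delta + ((count D s)%:R - k%:R) ^+ 2 / delta))).
  apply: mean_le => s; apply: le_trans (unit_steps_lipschitz uS _ _) _.
  exact: norm_le_quad.
rewrite meanD mean_cst meanZr iid_count_sqr lerD2l ler_pM2r ?invr_gt0// lerD2r.
have q0 := mean_ind_ge0 M D.
by rewrite ler_piMr ?mulr_ge0//; lra.
Qed.

Lemma iid_map C D (g : C -> D) (M : mean C) n F :
  iid (mean_map g M) n F = iid M n (fun s => F (map g s)).
Proof.
elim: n F => [|n IH] F; first by rewrite !iid0.
by rewrite !iidS mean_mapE; apply: eq_mean => x; rewrite /= IH.
Qed.

Lemma eq_iid_mean C (M N : mean C) n F : (forall f, M f = N f) -> iid M n F = iid N n F.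
Proof.
move=> MN; elim: n F => [|n IH] F; first by rewrite !iid0.
by rewrite !iidS MN; apply: eq_mean => x; exact: IH.
Qed.

End means.
Arguments mean : clear implicits.
Coercion mapp : mean >-> Funclass.

(** * Uniform points on a grid *)

Section cells.
Context {R : realType} (d : nat).

(** Coordinates are natural numbers, not elements of ['I_n], so that grids of all sizes share one
    type. *)
Definition cell := {ffun 'I_d -> nat}.
HB.instance Definition _ := Choice.on cell.

(** One of the truncated differences vanishes, so the sum is the distance of [m] and [n]; the
    predecessor counts the cells strictly between, and is 0 for equal or adjacent cells. *)
Definition gap (m n : nat) : nat := ((m - n) + (n - m)).-1.

(* [delta * gap] bounds from below the distance between points of two cells of
   side [delta], so that [near_cells] holds as soon as the cells contain points at
   distance at most 1. *)
Definition near_cells (delta : R) : rel cell :=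
  fun b c => \sum_i (delta * (gap (b i) (c i))%:R) ^+ 2 <= 1.

Definition cell_of n (c : {ffun 'I_d -> 'I_n}) : cell := [ffun i => nat_of_ord (c i)].

Lemma cell_of_inj n : injective (@cell_of n).
Proof.
move=> b c /ffunP bc; apply/ffunP => i; apply/val_inj.
by have := bc i; rewrite !ffunE.
Qed.

Definition cells n : seq cell := [seq cell_of c | c <- enum {: {ffun 'I_d -> 'I_n}}].

Lemma cells_uniq n : uniq (cells n).
Proof. by rewrite map_inj_uniq ?enum_uniq//; exact: cell_of_inj. Qed.

Lemma size_cells n : size (cells n) = (n ^ d)%N.
Proof. by rewrite size_map -cardE card_ffun !card_ord. Qed.

Lemma mem_cells n (c : cell) : (c \in cells n) = [forall i, c i < n]%N.
Proof.
apply/mapP/forallP => [[b _ -> i]|cn]; first by rewrite ffunE.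
exists [ffun i => Ordinal (cn i)]; first by rewrite mem_enum.
by apply/ffunP => i; rewrite !ffunE.
Qed.

Fact unif_ge0 n (c : {ffun 'I_d -> 'I_n.-1.+1}) : 0 <= ((n.-1.+1 ^ d)%:R^-1 : R).
Proof. by rewrite invr_ge0 ler0n. Qed.

Fact unif_sum n : \sum_(c : {ffun 'I_d -> 'I_n.-1.+1}) ((n.-1.+1 ^ d)%:R^-1 : R) = 1.
Proof.
rewrite sumr_const card_ffun !card_ord -[LHS]mulr_natl mulfV//.
Qed.

(* At [n = 0] this is the law for [n = 1]. *)
Definition unif n : mean R cell := Mean (@cell_of n.-1.+1) (@unif_ge0 n) (@unif_sum n).

Lemma unifE n (f : cell -> R) : (0 < n)%N ->
  unif n f = (n ^ d)%:R^-1 * \sum_(c <- cells n) f c.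
Proof.
case: n => // n _; rewrite /mapp/= mulr_sumr big_map big_enum/=.
by [].
Qed.

(** With [comb], this is Euclidean division in each coordinate: a fine cell is given by its block of
    side [k] and its place in the block. *)
Definition cdiv k (c : cell) : cell := [ffun i => (c i %/ k)%N].
Definition comb k (b c : cell) : cell := [ffun i => (b i * k + c i)%N].

Lemma cdiv_comb k b c : c \in cells k -> cdiv k (comb k b c) = b.
Proof.
rewrite mem_cells => /forallP ck; apply/ffunP => i; rewrite !ffunE divnMDl.
  by rewrite divn_small ?addn0.
exact: leq_ltn_trans (ck i).
Qed.

Lemma cells_comb n k : (0 < k)%N ->
  perm_eq (cells (n * k)) [seq comb k b c | b <- cells n, c <- cells k].
Proof.
move=> k0; apply: uniq_perm; first exact: cells_uniq.
  apply: allpairs_uniq; rewrite ?cells_uniq//.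
  move=> [b c] [b' c'] /allpairsP[[b1 c1] [/= b1n c1n [-> ->]]].
  move=> /allpairsP[[b2 c2] [/= b2n c2n [-> ->]]] E.
  have E1 : b1 = b2 by rewrite -(cdiv_comb b1 c1n) -(cdiv_comb b2 c2n) E.
  subst b2; congr (_, _); apply/ffunP => i.
  by move/ffunP/(_ i): E; rewrite !ffunE => /addnI.
move=> c; rewrite mem_cells; apply/forallP/allpairsP => [ck|[[b b'] [/= + + ->]] i].
  exists (cdiv k c, [ffun i => c i %% k]%N); split => /=.
  - by rewrite mem_cells; apply/forallP => i; rewrite ffunE ltn_divLR.
  - by rewrite mem_cells; apply/forallP => i; rewrite ffunE ltn_mod.
  - by apply/ffunP => i; rewrite !ffunE -divn_eq.
rewrite !mem_cells => /forallP/(_ i) bn /forallP/(_ i) ck; rewrite ffunE.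
by apply: leq_trans (_ : (b i).+1 * k <= _)%N; rewrite ?leq_mul2r ?bn ?orbT// mulSn addnC ltn_add2r.
Qed.

Lemma unif_comb n k (f : cell -> R) : (0 < n)%N -> (0 < k)%N ->
  unif (n * k) f = unif n (fun b => unif k (fun c => f (comb k b c))).
Proof.
move=> n0 k0; rewrite !unifE ?muln_gt0 ?n0//.
rewrite (perm_big _ (cells_comb n k0))/= big_allpairs_dep/=.
rewrite mulr_sumr mulr_sumr; apply: eq_bigr => b _.
by rewrite unifE// expnMn natrM invfM -mulrA.
Qed.

Lemma eq_unif n (f g : cell -> R) : (0 < n)%N -> {in cells n, forall c, f c = g c} ->
  unif n f = unif n g.
Proof. by move=> n0 fg; rewrite !unifE//; congr (_ * _); apply: eq_big_seq. Qed.

Lemma unif_cdiv n k (f : cell -> R) : (0 < n)%N -> (0 < k)%N ->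
  unif (n * k) (fun c => f (cdiv k c)) = unif n f.
Proof.
move=> n0 k0; rewrite unif_comb//; apply: eq_mean => b.
rewrite -[RHS](mean_cst (unif k)); apply: eq_unif => // c ck.
by rewrite cdiv_comb.
Qed.

Lemma unif_single n (b : cell) (f : cell -> R) : (0 < n)%N -> b \in cells n ->
  (forall c, c != b -> f c = 0) -> unif n f = (n ^ d)%:R^-1 * f b.
Proof.
move=> n0 bn f0; rewrite unifE// (bigD1_seq b)//= ?cells_uniq//.
by rewrite big1 ?addr0// => c /f0.
Qed.

Lemma unif_block m n (b : cell) (f : cell -> R) : (0 < m)%N -> (0 < n)%N -> b \in cells m ->
  unif (m * n) (fun c => ind (fun c => cdiv n c == b) c * f c) =
  (m ^ d)%:R^-1 * unif n (fun c => f (comb n b c)).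
Proof.
move=> m0 n0 bm; rewrite unif_comb// (@unif_single _ b)//.
  by congr (_ * _); apply: eq_unif => // c cn; rewrite /ind cdiv_comb// eqxx mul1r.
move=> b' bb; rewrite -[RHS](mean_cst (unif n)); apply: eq_unif => // c cn.
by rewrite /ind cdiv_comb// (negPf bb) mul0r.
Qed.

Lemma unif_block_ind m n (b : cell) : (0 < m)%N -> (0 < n)%N -> b \in cells m ->
  unif (m * n) (ind (fun c => cdiv n c == b)) = (m ^ d)%:R^-1.
Proof.
move=> m0 n0 bm; have := unif_block (fun=> 1) m0 n0 bm.
by rewrite mean_cst mulr1 => <-; apply: eq_mean => c; rewrite mulr1.
Qed.

Lemma gapC m n : gap m n = gap n m. Proof. by rewrite /gap addnC. Qed.

Lemma near_cellsC delta b c : near_cells delta b c = near_cells delta c b.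
Proof. by rewrite /near_cells; congr (_ <= _); apply: eq_bigr => i _; rewrite gapC. Qed.

(** If [g] whole blocks separate two blocks, at least [g * k] fine cells separate any cells inside
    them. *)
Lemma gap_div k m n : (0 < k)%N -> (gap (m %/ k) (n %/ k) * k <= gap m n)%N.
Proof.
move=> k0; wlog mn : m n / (n <= m)%N.
  by move=> W; case: (leqP n m) => [|/ltnW] /W//; rewrite gapC [in leqRHS]gapC.
rewrite /gap; have := divn_eq m k; have := divn_eq n k.
have := ltn_pmod n k0; have := ltn_pmod m k0.
have := leq_div2r k mn.
move: (m %/ k)%N (n %/ k)%N (m %% k)%N (n %% k)%N => M N r s NM rk sk E1 E2.
subst m n; move: mn; nia.
Qed.

Lemma near_cdiv k delta b c : (0 < k)%N -> 0 <= delta -> near_cells delta b c ->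
  near_cells (delta * k%:R) (cdiv k b) (cdiv k c).
Proof.
move=> k0 d0; apply: le_trans; apply: ler_sum => i _; rewrite !ffunE.
rewrite lerXn2r ?nnegrE ?mulr_ge0//; rewrite -mulrA ler_wpM2l// mulrC -natrM ler_nat.
exact: gap_div.
Qed.

Lemma near_antitone delta delta' b c : 0 <= delta <= delta' ->
  near_cells delta' b c -> near_cells delta b c.
Proof.
move=> /andP[d0 dd]; apply: le_trans; apply: ler_sum => i _.
have d'0 : 0 <= delta' := le_trans d0 dd.
by apply: lerXn2r; rewrite ?nnegrE ?mulr_ge0//; exact: ler_wpM2r.
Qed.

Lemma near_comb k delta b c c' :
  near_cells delta (comb k b c) (comb k b c') = near_cells delta c c'.
Proof.
rewrite /near_cells; congr (_ <= _); apply: eq_bigr => i _; rewrite !ffunE.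
by rewrite /gap !subnDl.
Qed.

End cells.

(** * Mean packing numbers of uniform points *)

Section uniform_packing.
Context {R : realType} (d h : nat) (a : rel nat).
Hypothesis h_gt0 : (0 < h)%N.

Definition npk (C : eqType) (e : rel C) (s : seq C) : R := (pk h a e s)%:R.

Lemma npk_unit_increments (C : eqType) (e : rel C) : unit_increments (npk e).
Proof.
move=> s x t; rewrite /npk !(pk_perm a h_gt0 e (_ : perm_eq (s ++ x :: t) (x :: (s ++ t)))).
  by rewrite ler_nat pk_cons_ge//= natr1 ler_nat pk_cons_le.
by rewrite -cat1s perm_catCA.
Qed.

Lemma npk_nil (C : eqType) (e : rel C) : npk e [::] = 0.
Proof. by rewrite /npk pk_nil. Qed.

Lemma npk_ge0 (C : eqType) (e : rel C) s : 0 <= npk e s.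
Proof. exact: ler0n. Qed.

Lemma npk_size (C : eqType) (e : rel C) s : h%:R * npk e s <= (size s)%:R.
Proof. by rewrite /npk -natrM ler_nat pk_size. Qed.

(* The cube of side [s] is cut into [n ^ d] cells, of side [s / n]. *)
Definition psi_grid n k (s : R) : R := iid (unif d n) k (npk (near_cells (s / n%:R))).

Lemma psi_grid_steps n k s : psi_grid n k s <= psi_grid n k.+1 s <= psi_grid n k s + 1.
Proof. exact/iidS_between/npk_unit_increments. Qed.

Lemma psi_grid_ge0 n k s : 0 <= psi_grid n k s.
Proof. by apply: mean_ge0 => l; exact: npk_ge0. Qed.

Lemma psi_grid_le n k s : h%:R * psi_grid n k s <= k%:R.
Proof.
rewrite -meanZ -[leRHS](mean_cst (iid (unif d n) k)).
by apply: iid_le => l <-; exact: npk_size.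
Qed.

(** Merging fine cells into coarse ones turns the uniform law into the uniform law and can only
    create near pairs. *)
Lemma psi_grid_refine n m k s : (0 < n)%N -> (0 < m)%N -> 0 <= s ->
  psi_grid (n * m) k s <= psi_grid n k s.
Proof.
move=> n0 m0 s0.
rewrite {2}/psi_grid (@eq_iid_mean _ _ _ (mean_map (cdiv m) (unif d (n * m)))); last first.
  by move=> f; rewrite mean_mapE -(unif_cdiv f n0 m0).
rewrite iid_map; apply: mean_le => l; rewrite ler_nat.
apply: pk_map_ge => // x y _ _ xy.
rewrite (_ : s / n%:R = s / (n * m)%:R * m%:R); last first.
  by rewrite natrM; field; rewrite !pnatr_eq0 -!lt0n n0 m0.
by apply: near_cdiv => //; rewrite divr_ge0.
Qed.

Lemma psi_grid_antitone n k s s' : 0 <= s <= s' -> psi_grid n k s' <= psi_grid n k s.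
Proof.
move=> /andP[s0 ss']; apply: mean_le => l; rewrite ler_nat; apply: pk_sub => // x y _ _.
by apply: near_antitone; rewrite divr_ge0//= ler_wpM2r.
Qed.

(** Packings of the [m ^ d] subcubes unite to one of the whole cube. A subcube receives a binomial
    number of the [k] points, uniform in it given their number, and replacing that number by [k0]
    costs the error of [iid_count_approx]. *)
Lemma psi_grid_superadditive m n k s k0 delta : (0 < m)%N -> (0 < n)%N -> 0 < delta ->
  (m ^ d)%:R * (psi_grid n k0 s -
     (delta + (k%:R / (m ^ d)%:R + (k%:R / (m ^ d)%:R - k0%:R) ^+ 2) / delta))
    <= psi_grid (m * n) k (m%:R * s).
Proof.
move=> m0 n0 d0; set q := (m ^ d)%:R^-1.
have E : m%:R * s / (m * n)%:R = s / n%:R.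
  by rewrite natrM; field; rewrite !pnatr_eq0 -!lt0n n0 m0.
rewrite /psi_grid E; set F := npk _.
apply: (@le_trans _ _ (iid (unif d (m * n)) k (fun l => \sum_(b <- cells d m)
    F (seq.filter (fun c => cdiv n c == b) l)))); last first.
  apply: mean_le => l; rewrite /F /npk -natr_sum ler_nat.
  by apply: pk_key_ge => //; exact: cells_uniq.
rewrite mean_sum -(size_cells d m) -sum1_size natr_sum mulr_suml.
rewrite big_seq [leRHS]big_seq; apply: ler_sum => b bm; rewrite mul1r.
rewrite (@iid_filter _ _ _ (mean_map (comb n b) (unif d n))); last first.
  by move=> f; rewrite mean_mapE unif_block// unif_block_ind.
set u := fun j => psi_grid n j s.
have uE j : iid (mean_map (comb n b) (unif d n)) j F = u j.
  rewrite iid_map; apply: eq_mean => l; rewrite /F /npk; congr (_%:R).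
  by apply: pk_map => // x y _ _; rewrite near_comb.
under [leRHS]eq_mean do rewrite uE.
have := @iid_count_approx _ _ (unif d (m * n)) (fun c => cdiv n c == b) k u k0 delta d0
  (fun j => psi_grid_steps n j s).
rewrite unif_block_ind// ler_norml => /andP[+ _].
by rewrite lerBrDl.
Qed.

(* Refining a grid leaves fewer pairs of points near each other, so the infimum
   is the mean packing number of [k] independent uniform points of the cube. *)
Definition psi_unif k s : R := inf [set psi_grid n.+1 k s | n in [set: nat]].

Let psi_unif_has_inf k s : has_inf [set psi_grid n.+1 k s | n in [set: nat]].
Proof.
split; first by exists (psi_grid 1 k s); exists 0%N.
by exists 0 => _ [n _ <-]; exact: psi_grid_ge0.
Qed.

Lemma psi_unif_le n k s : (0 < n)%N -> psi_unif k s <= psi_grid n k s.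
Proof.
case: n => // n _; apply: ge_inf; last by exists n.
by have [] := psi_unif_has_inf k s.
Qed.

Lemma psi_unif_ge k s c : (forall n, (0 < n)%N -> c <= psi_grid n k s) -> c <= psi_unif k s.
Proof.
move=> H; apply: lb_le_inf; first by have [] := psi_unif_has_inf k s.
by move=> _ [n _ <-]; exact: H.
Qed.

Lemma psi_unif_approx k s eps : 0 <= s -> 0 < eps -> exists2 n0, (0 < n0)%N &
  forall n, (0 < n)%N -> (n0 %| n)%N -> psi_grid n k s <= psi_unif k s + eps.
Proof.
move=> s0 e0; have [_ [n _ <-] H] := inf_adherent e0 (psi_unif_has_inf k s).
exists n.+1 => // m m0 /dvdnP[j E]; apply: le_trans (ltW H).
rewrite E mulnC; apply: psi_grid_refine => //.
by move: m0; rewrite E muln_gt0 => /andP[].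
Qed.

Lemma psi_unif_steps k s : 0 <= s -> psi_unif k s <= psi_unif k.+1 s <= psi_unif k s + 1.
Proof.
move=> s0; apply/andP; split.
  apply: psi_unif_ge => n n0; apply: le_trans (psi_unif_le _ _ n0) _.
  by have /andP[] := psi_grid_steps n k s.
rewrite -lerBlDr; apply: psi_unif_ge => n n0; rewrite lerBlDr.
apply: le_trans (psi_unif_le _ _ n0) _.
by have /andP[] := psi_grid_steps n k s.
Qed.

Lemma psi_unif_lipschitz j k s : 0 <= s -> `|psi_unif j s - psi_unif k s| <= `|j%:R - k%:R|.
Proof. by move=> s0; apply: (@unit_steps_lipschitz _ (psi_unif^~ s)) => n; exact: psi_unif_steps. Qed.

Lemma psi_unif_ge0 k s : 0 <= psi_unif k s.
Proof. by apply: psi_unif_ge => n _; exact: psi_grid_ge0. Qed.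

Lemma psi_unif_le_size k s : h%:R * psi_unif k s <= k%:R.
Proof.
apply: le_trans (psi_grid_le 1 k s).
by rewrite ler_wpM2l// psi_unif_le.
Qed.

Lemma psi_unif_antitone k s s' : 0 <= s <= s' -> psi_unif k s' <= psi_unif k s.
Proof.
move=> ss; apply: psi_unif_ge => n n0; apply: le_trans (psi_unif_le _ _ n0) _.
exact: psi_grid_antitone.
Qed.

Lemma psi_unif_superadditive m k s k0 delta : (0 < m)%N -> 0 < delta -> 0 <= s ->
  (m ^ d)%:R * (psi_unif k0 s -
     (delta + (k%:R / (m ^ d)%:R + (k%:R / (m ^ d)%:R - k0%:R) ^+ 2) / delta))
    <= psi_unif k (m%:R * s).
Proof.
move=> m0 d0 s0; apply: psi_unif_ge => n n0.
have ms0 : 0 <= m%:R * s by rewrite mulr_ge0.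
(* A grid adapted to the subcubes is obtained by refining the given one, which only lowers the
   mean. *)
apply: le_trans (psi_grid_refine k n0 m0 ms0); rewrite mulnC.
apply: le_trans (psi_grid_superadditive k s k0 m0 n0 d0).
by rewrite ler_wpM2l// lerB// psi_unif_le.
Qed.

End uniform_packing.

(** * The limit at a given density *)

Section density_limit.
Context {R : realType} (d h : nat) (a : rel nat).
Hypotheses (d_gt0 : (0 < d)%N) (h_gt0 : (0 < h)%N).

(** The limit is the lower limit, the supremum of the eventual lower bounds; the second hypothesis
    keeps every late value below it up to [eps]. *)
Lemma almost_increasing_cvg (A : R -> R) K : (forall s, `|A s| <= K) ->
  (forall eps, 0 < eps -> exists S, forall s0, S <= s0 ->
     exists S', forall s, S' <= s -> A s0 - eps <= A s) ->
  exists L, forall eps, 0 < eps -> exists S, forall s, S <= s -> `|A s - L| <= eps.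
Proof.
move=> AK Ainc; pose E := [set x | exists S, forall s, S <= s -> x <= A s].
have E0 : E (- K) by exists 0 => s _; have := AK s; rewrite ler_norml => /andP[].
have EK : ubound E K.
  move=> x [S xS]; apply: le_trans (xS S (lexx _)) _.
  by have := AK S; rewrite ler_norml => /andP[].
have sE : has_sup E by split; [exists (- K)|exists K].
exists (sup E) => eps e0; have [S H] := Ainc eps e0.
have [x [S' xS'] xE] := sup_adherent e0 sE.
exists (Num.max S S') => s; rewrite ge_max => /andP[Ss S's].
rewrite ler_distl; apply/andP; split; first exact: le_trans (ltW xE) (xS' _ S's).
by rewrite -lerBlDr; apply: ub_le_sup; [exists K|exact: H].
Qed.

Lemma bernoulli_exprn (y : R) n : 0 <= y <= 1 -> 1 - n%:R * y <= (1 - y) ^+ n.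
Proof.
move=> /andP[y0 y1]; elim: n => [|n IH]; first by rewrite mul0r subr0 expr0.
rewrite exprS; apply: le_trans (_ : (1 - y) * (1 - n%:R * y) <= _).
  rewrite -natr1 -subr_ge0 (_ : _ - _ = n%:R * y ^+ 2); last by ring.
  by rewrite mulr_ge0// sqr_ge0.
by rewrite ler_wpM2l// subr_ge0.
Qed.

Let psiu := @psi_unif R d h a.

Lemma psi_unif_almost_increasing (lambda eps : R) : 0 <= lambda -> 0 < eps ->
  exists S, forall s0, S <= s0 -> exists S', forall s, S' <= s ->
  psiu (Num.truncn (lambda * s0 ^+ d)) s0 / s0 ^+ d - eps <=
    psiu (Num.truncn (lambda * s ^+ d)) s / s ^+ d.
Proof.
(* With [del = eps / 2 * s0 ^+ d], the fluctuation term is at most [del] once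
   [(lambda + 4) * s0 ^+ d <= del ^+ 2], where 4 bounds the squared bias of the count; this gives
   the second threshold. *)
move=> l0 e0; exists (Num.max 1 (4 * (lambda + 4) / eps ^+ 2)) => s0.
rewrite ge_max => /andP[s01 s0l].
have s0p : 0 < s0 := lt_le_trans ltr01 s01.
have s0dp : 0 < s0 ^+ d by rewrite exprn_gt0.
have s0d1 : s0 <= s0 ^+ d by rewrite -[leLHS]expr1 ler_weXn2l.
(* Beyond [bnd], Bernoulli's inequality shows that rounding up the number of small cubes per side
   lowers the expected number of points in each by at most one. *)
pose bnd := lambda * s0 ^+ d * d%:R * s0.
exists (Num.max s0 bnd) => s; rewrite ge_max => /andP[ss0 sbnd].
have sp : 0 < s := lt_le_trans s0p ss0.
have sdp : 0 < s ^+ d by rewrite exprn_gt0.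
set k0 := Num.truncn (lambda * s0 ^+ d); set k := Num.truncn (lambda * s ^+ d).
have k0E : k0%:R <= lambda * s0 ^+ d < k0%:R + 1.
  by rewrite natr1 Num.Theory.truncn_itv// mulr_ge0// ltW.
have kE : k%:R <= lambda * s ^+ d < k%:R + 1.
  by rewrite natr1 Num.Theory.truncn_itv// mulr_ge0// ltW.
(* Rounding up makes [m * s0] at least [s], so the mean for the side [m * s0] is a lower bound for
   the one for [s]. *)
pose m := (Num.truncn (s / s0)).+1.
have mE : s / s0 < m%:R <= s / s0 + 1.
  have /andP[H1 H2] := Num.Theory.truncn_itv (ltW (divr_gt0 sp s0p)).
  by rewrite H2/= -natr1 lerD2r.
have [ms1 ms2] : s <= m%:R * s0 /\ m%:R * s0 <= s + s0.
  have /andP[H1 H2] := mE; split.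
    by rewrite -ler_pdivrMr// ltW.
  by rewrite -ler_pdivlMr// mulrDl divff ?gt_eqF.
have m0 : (0 < m)%N by [].
have mR0 : 0 < m%:R :> R by rewrite ltr0n.
pose del := eps / 2 * s0 ^+ d.
have del0 : 0 < del by rewrite /del mulr_gt0// divr_gt0.
have H := psi_unif_superadditive d a h_gt0 k k0 m0 del0 (ltW s0p).
have Han : psiu k (m%:R * s0) <= psiu k s.
  by apply: psi_unif_antitone => //; rewrite // (ltW sp).
move: (le_trans H Han) => {Han} {}H; move: H.
rewrite -/psiu natrX; set x := k%:R / m%:R ^+ d => H.
have ssp : 0 < s + s0 by rewrite addr_gt0.
have mdp : 0 < (m%:R : R) ^+ d by rewrite exprn_gt0.
have xle : x <= lambda * s0 ^+ d.
  rewrite /x ler_pdivrMr// -mulrA -exprMn; case/andP: kE => /le_trans + _; apply.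
  rewrite ler_wpM2l//; apply: lerXn2r; rewrite ?nnegrE ?mulr_ge0 ?(ltW sp) ?(ltW s0p)//.
  by rewrite mulrC.
have xge : lambda * s0 ^+ d - 2 <= x.
  have y01 : 0 <= s0 / (s + s0) <= 1.
    by rewrite divr_ge0 ?(ltW s0p) ?(ltW ssp)//= ler_pdivrMr// mul1r lerDr ltW.
  have B := bernoulli_exprn d y01.
  have B2 : lambda * s0 ^+ d - 1 <= lambda * (s / m%:R) ^+ d.
    apply: (@le_trans _ _ (lambda * s0 ^+ d * (1 - s0 / (s + s0)) ^+ d)).
      apply: (@le_trans _ _ (lambda * s0 ^+ d * (1 - d%:R * (s0 / (s + s0))))).
        rewrite mulrBr mulr1 lerB// [leLHS](_ : _ = bnd / (s + s0)); last by rewrite /bnd; ring.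
        by rewrite ler_pdivrMr ?addr_gt0// mul1r (le_trans sbnd)// lerDl ltW.
      by rewrite ler_wpM2l// mulr_ge0// ltW.
    rewrite -mulrA ler_wpM2l// -exprMn; apply: lerXn2r; rewrite ?nnegrE//.
    - by rewrite mulr_ge0 ?(ltW s0p)// subr_ge0; case/andP: y01.
    - by rewrite divr_ge0 ?(ltW sp)// ltW.
    rewrite ler_pdivlMr// [leLHS](_ : _ = s * (m%:R * s0 / (s + s0))); last first.
      by field; rewrite gt_eqF// addr_gt0.
    by rewrite ler_piMr ?(ltW sp)// ler_pdivrMr ?addr_gt0// mul1r.
  have : lambda * (s / m%:R) ^+ d - 1 <= x.
    rewrite /x ler_pdivlMr// mulrBl mul1r -mulrA -exprMn divfK ?gt_eqF//.
    have : 1 <= (m%:R : R) ^+ d by rewrite exprn_ege1// ler1n.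
    by case/andP: kE; lra.
  by lra.
set T := psiu k0 s0 - _ in H.
have TE : psiu k0 s0 / s0 ^+ d - eps <= T / s0 ^+ d.
  rewrite /T mulrBl lerB// ler_pdivrMr//.
  have -> : eps * s0 ^+ d = del + del by rewrite /del; field.
  rewrite lerD2l ler_pdivrMr//.
  have sq : (x - k0%:R) ^+ 2 <= 4.
    have : `|x - k0%:R| <= 2 by rewrite ler_norml; case/andP: k0E; lra.
    rewrite -(real_normK (num_real (x - k0%:R))); have := normr_ge0 (x - k0%:R); nra.
  apply: (@le_trans _ _ (lambda * s0 ^+ d + 4 * s0 ^+ d)).
    by rewrite lerD// (le_trans sq)// ler_peMr// (le_trans s01).
  rewrite /del -mulrDl [leRHS](_ : _ = eps ^+ 2 / 4 * s0 ^+ d * s0 ^+ d); last by field.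
  rewrite ler_pM2r// (le_trans _ (_ : eps ^+ 2 / 4 * s0 <= _))//; last first.
    by rewrite ler_wpM2l// divr_ge0// sqr_ge0.
  by move: s0l; rewrite ler_pdivrMr ?exprn_gt0//; lra.
(* For positive [T] the inequality [s ^+ d <= (m * s0) ^+ d] goes the right way; otherwise the claim
   follows from the sign of [psiu]. *)
apply: le_trans TE _; have [T0|T0] := leP T 0.
  apply: (@le_trans _ _ 0); last by rewrite divr_ge0 ?psi_unif_ge0// ltW.
  by rewrite pmulr_lle0 ?invr_gt0.
rewrite ler_pdivrMr// mulrAC ler_pdivlMr//.
apply: (@le_trans _ _ (m%:R ^+ d * T * s0 ^+ d)); last by rewrite ler_wpM2r// ltW.
rewrite mulrAC [leRHS]mulrC ler_pM2l// -exprMn; apply: lerXn2r; rewrite ?nnegrE ?mulr_ge0 ?(ltW sp) ?(ltW s0p)//.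
Qed.

Lemma psi_unif_le_nat k s : psiu k s <= k%:R.
Proof.
apply: le_trans (psi_unif_le_size d h a k s).
by rewrite ler_peMl ?psi_unif_ge0// ler1n.
Qed.

Lemma psi_unif_cvg (lambda : R) : 0 <= lambda ->
  exists L, forall eps, 0 < eps -> exists S, forall s, S <= s ->
    `|psiu (Num.truncn (lambda * s ^+ d)) s / s ^+ d - L| <= eps.
Proof.
move=> l0.
apply: (@almost_increasing_cvg
    (fun s => psiu (Num.truncn (lambda * s ^+ d)) s / s ^+ d) lambda).
  move=> s; rewrite normrM normfV ger0_norm ?psi_unif_ge0//.
  have [->|sd0] := eqVneq (s ^+ d) 0; first by rewrite normr0 invr0 mulr0.
  rewrite ler_pdivrMr ?normr_gt0//; apply: le_trans (psi_unif_le_nat _ _) _.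
  (* The side [s] ranges over all reals here; where [lambda * s ^+ d] is negative its truncation is
     0. *)
  rewrite -{2}(ger0_norm l0) -normrM; have [x0|x0] := leP 0 (lambda * s ^+ d).
    by rewrite ger0_norm//; case/andP: (Num.Theory.truncn_itv x0).
  rewrite (_ : Num.truncn _ = 0%N) ?normr_ge0//; apply/eqP.
  by rewrite -leqn0 leqNgt Num.Theory.truncn_gt0 -ltNge (lt_trans x0).
by move=> eps e0; exact: psi_unif_almost_increasing.
Qed.

(* [packing_limit lambda] is the paper's [lambda * rho lambda]. *)
Definition packing_limit (lambda : R) : R :=
  xget 0 [set L | forall eps, 0 < eps -> exists S, forall s, S <= s ->
    `|psiu (Num.truncn (lambda * s ^+ d)) s / s ^+ d - L| <= eps].

Lemma packing_limitP (lambda eps : R) : 0 <= lambda -> 0 < eps ->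
  exists2 S, 0 < S & forall s k, S <= s -> `|k%:R - lambda * s ^+ d| <= eps * s ^+ d ->
    `|psiu k s / s ^+ d - packing_limit lambda| <= 3 * eps.
Proof.
move=> l0 e0; have [S HS] : exists S, forall s, S <= s ->
    `|psiu (Num.truncn (lambda * s ^+ d)) s / s ^+ d - packing_limit lambda| <= eps.
  have [L PL] := psi_unif_cvg l0.
  by apply: (@xgetPex _ 0 [set L | forall eps, 0 < eps -> exists S, forall s, S <= s ->
    `|psiu (Num.truncn (lambda * s ^+ d)) s / s ^+ d - L| <= eps]) e0; exists L.
exists (Num.max S (Num.max 1 eps^-1)); first by rewrite !lt_max ltr01 orbT.
move=> s k; rewrite !ge_max => /and3P[Ss s1 se] kE.
have sp : 0 < s := lt_le_trans ltr01 s1.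
have sdp : 0 < s ^+ d by rewrite exprn_gt0.
have := HS s Ss; set k0 := Num.truncn _ => H.
have k0E : k0%:R <= lambda * s ^+ d < k0%:R + 1.
  by rewrite natr1 Num.Theory.truncn_itv// mulr_ge0// ltW.
rewrite (_ : _ - _ = (psiu k s - psiu k0 s) / s ^+ d +
   (psiu k0 s / s ^+ d - packing_limit lambda)); last by ring.
apply: le_trans (ler_normD _ _) _.
rewrite (_ : 3 * eps = 2 * eps + eps); last by ring.
apply: lerD => //; rewrite normrM normfV (gtr0_norm sdp) ler_pdivrMr//.
apply: le_trans (psi_unif_lipschitz d a h_gt0 _ _ (ltW sp)) _.
have e1 : 1 <= eps * s ^+ d.
  have : 1 <= eps * s by rewrite -ler_pdivrMl// mulr1.
  move/le_trans; apply; rewrite ler_pM2l//.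
  by rewrite -[leLHS]expr1 ler_weXn2l.
by move: kE; rewrite !ler_norml => /andP[? ?]; case/andP: k0E => ? ?; apply/andP; split; lra.
Qed.

(** One cube that is good for both densities, so that inequalities between values of [psi_unif] pass
    to the limits. *)
Let near_witness (lambda lambda' eps : R) : 0 <= lambda -> 0 <= lambda' -> 0 < eps ->
  exists s k k', [/\ 0 < s,
    `|k%:R - k'%:R| <= (`|lambda - lambda'| + 2 * eps) * s ^+ d,
    k%:R <= lambda * s ^+ d,
    `|psiu k s / s ^+ d - packing_limit lambda| <= 3 * eps &
    `|psiu k' s / s ^+ d - packing_limit lambda'| <= 3 * eps].
Proof.
move=> l0 l'0 e0; have [S S0 HS] := packing_limitP l0 e0.
have [S' S'0 HS'] := packing_limitP l'0 e0.
pose s := Num.max (Num.max S S') (Num.max 1 eps^-1).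
have : s <= s by []; rewrite {1}/s !ge_max => /andP[/andP[Ss S's] /andP[s1 se]].
have sp : 0 < s := lt_le_trans ltr01 s1.
have sdp : 0 < s ^+ d by rewrite exprn_gt0.
have e1 : 1 <= eps * s ^+ d.
  have : 1 <= eps * s by rewrite -ler_pdivrMl// mulr1.
  move/le_trans; apply; rewrite ler_pM2l//.
  by rewrite -[leLHS]expr1 ler_weXn2l.
have tr l : 0 <= l -> (Num.truncn (l * s ^+ d))%:R <= l * s ^+ d <
    (Num.truncn (l * s ^+ d))%:R + 1.
  by move=> l1; rewrite natr1 Num.Theory.truncn_itv// mulr_ge0// ltW.
have /andP[k1 k2] := tr _ l0; have /andP[k'1 k'2] := tr _ l'0.
exists s, (Num.truncn (lambda * s ^+ d)), (Num.truncn (lambda' * s ^+ d)).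
split => //; last 2 first.
- by apply: HS => //; rewrite ler_norml; apply/andP; split; lra.
- by apply: HS' => //; rewrite ler_norml; apply/andP; split; lra.
have nE : `|lambda - lambda'| * s ^+ d = `|(lambda - lambda') * s ^+ d|.
  by rewrite normrM (gtr0_norm sdp).
rewrite mulrDl nE.
have := ler_norm ((lambda - lambda') * s ^+ d).
have := ler_norm (- ((lambda - lambda') * s ^+ d)); rewrite normrN mulrBl => ? ?.
by rewrite ler_norml; apply/andP; split; lra.
Qed.

Lemma packing_limit_lipschitz lambda lambda' : 0 <= lambda -> 0 <= lambda' ->
  `|packing_limit lambda - packing_limit lambda'| <= `|lambda - lambda'|.
Proof.
move=> l0 l'0; apply/ler_addgt0Pr => eps e0.
have e8 : 0 < eps / 8 by rewrite divr_gt0.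
have [s [k [k' [sp kk _ H H']]]] := near_witness l0 l'0 e8.
have sdp : 0 < s ^+ d by rewrite exprn_gt0.
have P : `|psiu k s / s ^+ d - psiu k' s / s ^+ d| <= `|lambda - lambda'| + 2 * (eps / 8).
  rewrite -mulrBl normrM normfV (gtr0_norm sdp) ler_pdivrMr//.
  exact: le_trans (psi_unif_lipschitz d a h_gt0 _ _ (ltW sp)) kk.
move: H H' P; rewrite !ler_norml => /andP[? ?] /andP[? ?] /andP[? ?].
by apply/andP; split; lra.
Qed.

Lemma packing_limit_ge0 lambda : 0 <= lambda -> 0 <= packing_limit lambda.
Proof.
move=> l0; apply/ler_addgt0Pr => eps e0.
have e3 : 0 < eps / 3 by rewrite divr_gt0.
have [s [k [k' [sp kk _ H _]]]] := near_witness l0 l0 e3.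
have : 0 <= psiu k s / s ^+ d by rewrite divr_ge0 ?psi_unif_ge0// exprn_ge0// ltW.
by move: H; rewrite ler_norml => /andP[]; lra.
Qed.

Lemma packing_limit_le lambda : 0 <= lambda -> packing_limit lambda <= lambda.
Proof.
move=> l0; apply/ler_addgt0Pr => eps e0.
have e3 : 0 < eps / 3 by rewrite divr_gt0.
have [s [k [k' [sp _ kl H _]]]] := near_witness l0 l0 e3.
have sdp : 0 < s ^+ d by rewrite exprn_gt0.
have : psiu k s / s ^+ d <= lambda.
  by rewrite ler_pdivrMr// (le_trans (psi_unif_le_nat _ _)).
by move: H; rewrite ler_norml => /andP[]; lra.
Qed.

Lemma packing_limit0 : packing_limit 0 = 0.
Proof. by apply/eqP; rewrite eq_le packing_limit_le// packing_limit_ge0. Qed.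

End density_limit.

(** * Bounded random variables *)

Section bounded_random_variables.
Context {R : realType} {dO : measure_display} {Omega : measurableType dO}.
Variable P : probability Omega R.

Definition bounded_rv (f : Omega -> R) := measurable_fun [set: Omega] f /\
  exists K, forall w, `|f w| <= K.

Lemma bounded_rv_integrable f : bounded_rv f -> P.-integrable [set: Omega] (EFin \o f).
Proof.
move=> [mf [K fK]]; apply: measurable_bounded_integrable => //.
  by rewrite [X in (X < _)%E]probability_setT ltry.
exists K; split; first exact: num_real.
by move=> x Kx w _; exact: le_trans (fK w) (ltW Kx).
Qed.

Lemma bounded_rv_cst c : bounded_rv (fun=> c).
Proof. by split; [exact: measurable_cst|exists `|c|]. Qed.

Lemma bounded_rvD f g : bounded_rv f -> bounded_rv g -> bounded_rv (fun w => f w + g w).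
Proof.
move=> [mf [K fK]] [mg [L gL]]; split; first exact: measurable_funD.
by exists (K + L) => w; apply: le_trans (ler_normD _ _) (lerD _ _).
Qed.

Lemma bounded_rvM f g : bounded_rv f -> bounded_rv g -> bounded_rv (fun w => f w * g w).
Proof.
move=> [mf [K fK]] [mg [L gL]]; split; first exact: measurable_funM.
by exists (K * L) => w; rewrite normrM ler_pM.
Qed.

Lemma bounded_rvZ c f : bounded_rv f -> bounded_rv (fun w => c * f w).
Proof. by move=> bf; apply: bounded_rvM => //; exact: bounded_rv_cst. Qed.

Lemma bounded_rvB f g : bounded_rv f -> bounded_rv g -> bounded_rv (fun w => f w - g w).
Proof.
move=> bf bg; rewrite (_ : (fun w => _) = (fun w => f w + -1 * g w)).
  by apply: bounded_rvD => //; exact: bounded_rvZ.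
by apply/funext => w; rewrite mulN1r.
Qed.

Lemma bounded_rv_sum (I : Type) (r : seq I) (f : I -> Omega -> R) :
  (forall i, bounded_rv (f i)) -> bounded_rv (fun w => \sum_(i <- r) f i w).
Proof.
move=> bf; elim: r => [|i r IH].
  by under eq_fun do rewrite big_nil; exact: bounded_rv_cst.
by under eq_fun do rewrite big_cons; exact: bounded_rvD.
Qed.

Lemma bounded_rv_indic A : measurable A -> bounded_rv (\1_A).
Proof.
move=> mA; split; first exact: measurable_indic.
by exists 1 => w; rewrite indicE; case: (_ \in _); rewrite ?normr1 ?normr0.
Qed.

Definition mean_rv (f : Omega -> R) : R := \int[P]_w f w.

Lemma mean_rvE f : bounded_rv f -> ('E_P[f] = (mean_rv f)%:E)%E.
Proof.
move=> bf; rewrite unlock /mean_rv /Rintegral fineK//.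
exact/integrable_fin_num/bounded_rv_integrable.
Qed.

Lemma mean_rv_cst c : mean_rv (fun=> c) = c.
Proof.
rewrite /mean_rv Rintegral_cst// -[RHS]mulr1; congr (_ * _).
exact: (congr1 fine (probability_setT P)).
Qed.

Lemma mean_rvD f g : bounded_rv f -> bounded_rv g ->
  mean_rv (fun w => f w + g w) = mean_rv f + mean_rv g.
Proof. by move=> bf bg; rewrite /mean_rv RintegralD//; exact: bounded_rv_integrable. Qed.

Lemma mean_rvZ c f : bounded_rv f -> mean_rv (fun w => c * f w) = c * mean_rv f.
Proof. by move=> bf; rewrite /mean_rv RintegralZl//; exact: bounded_rv_integrable. Qed.

Lemma mean_rvB f g : bounded_rv f -> bounded_rv g ->
  mean_rv (fun w => f w - g w) = mean_rv f - mean_rv g.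
Proof. by move=> bf bg; rewrite /mean_rv RintegralB//; exact: bounded_rv_integrable. Qed.

Lemma mean_rv_sum (I : Type) (r : seq I) (f : I -> Omega -> R) :
  (forall i, bounded_rv (f i)) ->
  mean_rv (fun w => \sum_(i <- r) f i w) = \sum_(i <- r) mean_rv (f i).
Proof.
move=> bf; elim: r => [|i r IH].
  by under eq_fun do rewrite big_nil; rewrite big_nil mean_rv_cst.
under eq_fun do rewrite big_cons; rewrite big_cons mean_rvD ?IH//.
exact: bounded_rv_sum.
Qed.

Lemma mean_rv_le f g : bounded_rv f -> bounded_rv g -> (forall w, f w <= g w) ->
  mean_rv f <= mean_rv g.
Proof. by move=> bf bg fg; apply: le_Rintegral => //; exact: bounded_rv_integrable. Qed.

Lemma mean_rv_indic A : measurable A -> mean_rv (\1_A) = fine (P A).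
Proof. by move=> mA; rewrite /mean_rv /Rintegral integral_indic// setIT. Qed.

Lemma mean_rv_ae f g : bounded_rv f -> bounded_rv g -> {ae P, forall w, f w = g w} ->
  mean_rv f = mean_rv g.
Proof.
move=> bf bg fg; rewrite /mean_rv /Rintegral; congr fine; apply: ae_eq_integral => //.
- by apply/measurable_EFinP; case: bf.
- by apply/measurable_EFinP; case: bg.
- by apply: filterS fg => w /= -> _.
Qed.

Lemma mean_rv_le_ae f g : bounded_rv f -> bounded_rv g -> {ae P, forall w, f w <= g w} ->
  mean_rv f <= mean_rv g.
Proof.
(* The minimum is a version of [f] that lies below [g] everywhere. *)
move=> bf bg fg; have bm : bounded_rv (fun w => Num.min (f w) (g w)).
  have [[mf [K fK]] [mg [L gL]]] := (bf, bg); split; first exact: measurable_minr.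
  exists (K + L) => w; have := fK w; have := gL w.
  rewrite minEle; case: ifP => _; rewrite !ler_norml => /andP[? ?] /andP[? ?];
    by apply/andP; split; lra.
rewrite (@mean_rv_ae f _ bf bm).
  by apply: mean_rv_le => // w; rewrite ge_min lexx orbT.
by apply: filterS fg => w fg; rewrite min_l.
Qed.

(** Besides the convergence of means this supplies the measurability of the limit, which is how
    packing numbers of samples are shown to be random variables. *)
Lemma bounded_cvg (f_ : nat -> Omega -> R) f K :
  (forall j, measurable_fun [set: Omega] (f_ j)) -> (forall j w, `|f_ j w| <= K) ->
  (forall w, f_ j w @[j --> \oo] --> f w) ->
  bounded_rv f /\ mean_rv (f_ j) @[j --> \oo] --> mean_rv f.
Proof.
move=> mf fK ff.
have mlim : measurable_fun [set: Omega] f.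
  by apply: (measurable_fun_cvg mf) => w _; exact: ff.
have K0 w : `|f w| <= K.
  have /cvg_lim <- // : `|f_ j w| @[j --> \oo] --> `|f w| by exact: cvg_norm.
  apply: limr_le; first by apply/cvg_ex; exists `|f w|; exact: cvg_norm.
  exact: nearW.
have bf : bounded_rv f by split => //; exists K.
split => //.
have bfj j : bounded_rv (f_ j) by split => //; exists K.
have E g : bounded_rv g -> (\int[P]_x (EFin \o g) x)%E = (mean_rv g)%:E.
  move=> bg; rewrite /mean_rv /Rintegral fineK//.
  exact/integrable_fin_num/bounded_rv_integrable.
have m1 j : measurable_fun setT (EFin \o f_ j) by apply/measurable_EFinP.
have m2 : measurable_fun setT (EFin \o f) by apply/measurable_EFinP.
have c1 : {ae P, forall w, setT w -> (EFin \o f_ j) w @[j --> \oo] --> (EFin \o f) w}.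
  by apply: aeW => w _; apply: cvg_EFin; [exact: nearW|exact: ff].
have i1 : P.-integrable setT (fun=> K%:E) := bounded_rv_integrable (bounded_rv_cst K).
have d1 : {ae P, forall w j, setT w -> (`|(EFin \o f_ j) w| <= K%:E)%E}.
  by apply: aeW => w j _ /=; rewrite lee_fin.
have [_ _ H] := dominated_convergence measurableT m1 m2 c1 i1 d1.
have {}H : ((mean_rv (f_ j))%:E @[j --> \oo] --> (mean_rv f)%:E)%E.
  by rewrite -E//; apply: cvg_trans H; apply: near_eq_cvg; apply: nearW => j; rewrite /= E.
by have /fine_cvgP[] := H.
Qed.

End bounded_random_variables.

(** * Samples seen through a finite-valued map *)

Section finite_valued_samples.
Context {R : realType} {dT : measure_display} {T : measurableType dT}.
Variables (mu : probability T R) (C : choiceType) (kappa : T -> C) (V : seq C).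
Hypotheses (V_uniq : uniq V) (kappa_V : forall x, kappa x \in V).
Hypothesis kappa_meas : forall v, measurable (kappa @^-1` [set v]).

Let p (v : C) : R := fine (mu (kappa @^-1` [set v])).

Let p_ge0 v : 0 <= p v.
Proof. exact/fine_ge0/measure_ge0. Qed.

Lemma finite_valuedE (f : C -> R) x :
  f (kappa x) = \sum_(v <- V) f v * \1_(kappa @^-1` [set v]) x.
Proof.
rewrite (bigD1_seq (kappa x))//= indicE mem_set// mulr1 big1 ?addr0// => v vx.
by rewrite indicE memNset ?mulr0//= => E; rewrite E eqxx in vx.
Qed.

Lemma bounded_rv_finite_valued (f : C -> R) : bounded_rv (f \o kappa).
Proof.
rewrite (_ : _ \o _ = fun x => \sum_(v <- V) f v * \1_(kappa @^-1` [set v]) x); last first.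
  by apply/funext => x /=; rewrite finite_valuedE.
by apply: bounded_rv_sum => v; apply: bounded_rvZ; exact: bounded_rv_indic.
Qed.

Lemma mean_rv_finite_valued (f : C -> R) : mean_rv mu (f \o kappa) = \sum_(v <- V) p v * f v.
Proof.
rewrite (_ : _ \o _ = fun x => \sum_(v <- V) f v * \1_(kappa @^-1` [set v]) x); last first.
  by apply/funext => x /=; rewrite finite_valuedE.
rewrite mean_rv_sum => [|v]; last by apply: bounded_rvZ; exact: bounded_rv_indic.
apply: eq_bigr => v _; rewrite mean_rvZ; last exact: bounded_rv_indic.
by rewrite mean_rv_indic// mulrC.
Qed.

Fact law_sum : \sum_(v <- V) p v = 1.
Proof.
rewrite -[RHS](mean_rv_cst mu) [RHS](mean_rv_finite_valued (fun=> 1)).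
by under [RHS]eq_bigr do rewrite mulr1.
Qed.

Definition law : mean R C := seq_mean p_ge0 law_sum.

Lemma law_sumE (f : C -> R) : law f = \sum_(v <- V) p v * f v.
Proof. exact: seq_meanE. Qed.

Lemma lawE (f : C -> R) : law f = mean_rv mu (f \o kappa).
Proof. by rewrite mean_rv_finite_valued law_sumE. Qed.

Fixpoint words n : seq (seq C) :=
  if n is n'.+1 then [seq v :: w | v <- V, w <- words n'] else [:: [::]].

Lemma mem_words n w : (w \in words n) = (size w == n) && all (mem V) w.
Proof.
elim: n w => [|n IH] [|v w] //=.
  by apply/allpairsP => -[[? ?] []].
rewrite eqSS andbCA -IH; apply/allpairsP/andP => [[[v' w'] [/= vV ww [-> ->]]]//|[vV ww]].
by exists (v, w).
Qed.

Lemma words_uniq n : uniq (words n).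
Proof.
elim: n => //= n IH; apply: allpairs_uniq => //.
by move=> [v w] [v' w'] _ _ [-> ->].
Qed.

Lemma iid_law_words n (F : seq C -> R) :
  iid law n F = \sum_(w <- words n) (\prod_(v <- w) p v) * F w.
Proof.
elim: n F => [|n IH] F; first by rewrite iid0/= big_seq1 big_nil mul1r.
rewrite iidS law_sumE/= big_allpairs_dep; apply: eq_bigr => v _.
rewrite IH mulr_sumr; apply: eq_bigr => w _.
by rewrite big_cons mulrA.
Qed.

Context {dO : measure_display} {Omega : measurableType dO}.
Variables (P : probability Omega R) (X : nat -> {RV P >-> T}).
Hypotheses (X_law : forall i A, measurable A -> distribution P (X i) A = mu A)
  (X_indep : mutually_independent P X).

Let sample n w := [seq kappa (X i w) | i <- iota 0 n].

Lemma measurable_sample n v : measurable [set w | sample n w = v].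
Proof.
have [sv|sv] := eqVneq (size v) n; last first.
  rewrite (_ : [set _ | _] = set0)//; apply/seteqP; split => // w /= E.
  by move: sv; rewrite -E size_map size_iota eqxx.
case: v sv => [|c0 v'] sv.
  rewrite -sv (_ : [set _ | _] = setT); first exact: measurableT.
  by apply/seteqP.
set v := c0 :: v' in sv *.
rewrite (_ : [set _ | _] = \bigcap_(i < n) (X i @^-1` (kappa @^-1` [set nth c0 v i]))).
  apply: bigcap_measurableType => i _; rewrite -[X in measurable X]setTI.
  exact: measurable_funPT.
apply/seteqP; split => w; [move=> E i /= ni|move=> H].
  by rewrite -E (nth_map 0%N) ?size_iota// nth_iota.
apply: (@eq_from_nth _ c0) => [|i]; first by rewrite size_map size_iota.
rewrite size_map size_iota => ni; rewrite (nth_map 0%N) ?size_iota// nth_iota// add0n.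
exact: (H i).
Qed.

Lemma sample_word_prob n v : size v = n ->
  fine (P [set w | sample n w = v]) = \prod_(c <- v) p c.
Proof.
(* Only a nonempty word provides a default entry for [nth]. *)
move=> sv; case: n sv => [|n] sv.
  rewrite (size0nil sv) big_nil (_ : [set _ | _] = setT) ?probability_setT//.
  by apply/seteqP.
case: v sv => // c0 v' sv; set v := c0 :: v'.
have iJ i : (i \in [fset i in iota 0 n.+1]%fset) = (i < n.+1)%N.
  by rewrite !inE mem_iota; lia.
have := X_indep [fset i in iota 0 n.+1]%fset (B := fun i => kappa @^-1` [set nth c0 v i])
  (fun i => kappa_meas _).
rewrite (_ : \bigcap_(i in _) _ = [set w | sample n.+1 w = v]); last first.
  apply/seteqP; split => w H.
    apply: (@eq_from_nth _ c0) => [|i]; first by rewrite size_map size_iota.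
    rewrite size_map size_iota => ni; rewrite (nth_map 0%N) ?size_iota// nth_iota// add0n.
    by apply: (H i); rewrite /= iJ.
  move=> i /=; rewrite iJ => ni.
  by rewrite -H (nth_map 0%N) ?size_iota// nth_iota.
move=> ->.
rewrite (perm_big (iota 0 n.+1)); last first.
  apply: uniq_perm; [exact: fset_uniq|exact: iota_uniq|].
  by move=> i; rewrite !inE.
rewrite (eq_bigr (fun i => (p (nth c0 v i))%:E)) => [|i _].
  by rewrite prodEFin/= [RHS](big_nth c0) sv /index_iota subn0.
rewrite /p fineK; last by rewrite ge0_fin_numE// (le_lt_trans (probability_le1 _ _))// ltry.
by rewrite -(X_law i).
Qed.

Lemma sample_indicE n (F : seq C -> R) w :
  F (sample n w) = \sum_(v <- words n) F v * \1_[set w | sample n w = v] w.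
Proof.
have sV : sample n w \in words n.
  rewrite mem_words size_map size_iota eqxx/=.
  by apply/allP => _ /mapP[i _ ->]; exact: kappa_V.
rewrite (bigD1_seq (sample n w))//= ?words_uniq// indicE mem_set// mulr1 big1 ?addr0// => v vx.
by rewrite indicE memNset ?mulr0//= => E; rewrite E eqxx in vx.
Qed.

Lemma bounded_rv_sample n (F : seq C -> R) : bounded_rv (fun w => F (sample n w)).
Proof.
under eq_fun do rewrite sample_indicE.
by apply: bounded_rv_sum => v; apply/bounded_rvZ/bounded_rv_indic/measurable_sample.
Qed.

(** The bridge from expectations under [P] to finite sums; independence enters through the
    probability of each word. *)
Lemma mean_rv_sample n (F : seq C -> R) :
  mean_rv P (fun w => F (sample n w)) = iid law n F.
Proof.
under eq_fun do rewrite sample_indicE.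
rewrite mean_rv_sum => [|v]; last by apply/bounded_rvZ/bounded_rv_indic/measurable_sample.
rewrite iid_law_words big_seq [RHS]big_seq; apply: eq_bigr => v.
rewrite mem_words => /andP[/eqP sv _].
rewrite mean_rvZ; last exact/bounded_rv_indic/measurable_sample.
by rewrite mean_rv_indic ?sample_word_prob 1?mulrC//; exact: measurable_sample.
Qed.

End finite_valued_samples.

(** * Cells of a cube *)

Section grid.
Context {R : realType} {d : nat}.
Local Notation pt := (d.-tuple R).

Definition incube (s : R) (x : pt) : bool := [forall i, - (s / 2) <= tnth x i < s / 2].

Lemma incubeP s x : reflect (cube s x) (incube s x).
Proof. exact: forallP. Qed.

(** Outside the cube the value is meaningless, and [ocell] discards it. *)
Definition cell_at (s : R) (n : nat) (x : pt) : cell d :=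
  [ffun i => Num.truncn ((tnth x i + s / 2) * (n%:R / s))].

Definition ocell s n (x : pt) : option (cell d) :=
  if incube s x then Some (cell_at s n x) else None.

Definition ocells n : seq (option (cell d)) := None :: [seq Some c | c <- cells d n].

Lemma ocells_uniq n : uniq (ocells n).
Proof.
rewrite /= map_inj_uniq ?cells_uniq ?andbT; last by move=> ? ? [].
by apply/mapP => -[].
Qed.

Section cell_bounds.
Variables (s : R) (n : nat).
Hypotheses (s0 : 0 < s) (n0 : (0 < n)%N).
Let nR : 0 < n%:R :> R. Proof. by rewrite ltr0n. Qed.

Lemma cell_at_itv x i : incube s x ->
  - (s / 2) + (cell_at s n x i)%:R * (s / n%:R) <= tnth x i <
  - (s / 2) + ((cell_at s n x i)%:R + 1) * (s / n%:R).
Proof.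
move=> /forallP/(_ i)/andP[x1 x2]; rewrite ffunE; set y := (tnth x i + s / 2) * _.
have y0 : 0 <= y by rewrite mulr_ge0 ?divr_ge0 ?(ltW s0)//; move: x1; lra.
have /andP[t1 t2] := Num.Theory.truncn_itv y0.
have E : tnth x i = - (s / 2) + y * (s / n%:R).
  by rewrite /y; field; rewrite !gt_eqF.
by rewrite E lerD2l ltrD2l ler_pM2r ?divr_gt0// ltr_pM2r ?divr_gt0// t1 natr1.
Qed.

Lemma cell_at_cells x : incube s x -> cell_at s n x \in cells d n.
Proof.
move=> xs; rewrite mem_cells; apply/forallP => i; have /andP[+ _] := cell_at_itv i xs.
move: xs => /forallP/(_ i)/andP[_ x2] x1.
rewrite -(ltr_nat R) -(ltr_pM2r (divr_gt0 s0 nR)) [ltRHS](_ : _ = s); last by field; rewrite gt_eqF.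
by move: x1 x2; lra.
Qed.

Lemma ocell_ocells x : ocell s n x \in ocells n.
Proof.
rewrite /ocell; case: ifPn => xs; last exact: mem_head.
by rewrite inE/= map_f// cell_at_cells.
Qed.

Definition cell_set (c : cell d) : set pt :=
  [set x | forall i, `[- (s / 2) + (c i)%:R * (s / n%:R),
                       - (s / 2) + ((c i)%:R + 1) * (s / n%:R)[%classic (tnth x i)].

Lemma ocell_Some c : c \in cells d n -> ocell s n @^-1` [set Some c] = cell_set c.
Proof.
rewrite mem_cells => /forallP cn; apply/seteqP; split => x /=.
  rewrite /ocell; case: ifPn => // xs [<-] i /=.
  by rewrite in_itv/=; exact: cell_at_itv.
move=> H; have xs : incube s x.
  apply/forallP => i; have := H i; rewrite /= in_itv/= => /andP[x1 x2]; apply/andP; split.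
    by apply: le_trans x1; rewrite lerDl mulr_ge0// divr_ge0// ltW.
  apply: lt_le_trans x2 _; rewrite natr1 [leRHS](_ : _ = - (s / 2) + s); last by field.
  rewrite lerD2l [leRHS](_ : _ = n%:R * (s / n%:R)); last by field; rewrite gt_eqF.
  by rewrite ler_pM2r ?divr_gt0// ler_nat.
rewrite /ocell xs; congr Some; apply/ffunP => i; rewrite ffunE.
apply: Num.Theory.truncn_def; have := H i; rewrite /= in_itv/= => /andP[x1 x2].
have c0 : 0 < n%:R / s by rewrite divr_gt0.
have E z : z = z * (s / n%:R) * (n%:R / s) by field; rewrite !gt_eqF.
rewrite [X in X <= _]E [X in _ < X]E ler_pM2r// ltr_pM2r// -[(c i).+1%:R]natr1.
by apply/andP; split; move: x1 x2; lra.
Qed.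

Lemma ocell_Some0 c : c \notin cells d n -> ocell s n @^-1` [set Some c] = set0.
Proof.
move=> cn; apply/seteqP; split => // x /=; rewrite /ocell; case: ifPn => // xs [E].
by move: cn; rewrite -E cell_at_cells.
Qed.

Lemma measurable_cell_set c : measurable (cell_set c).
Proof.
rewrite (_ : cell_set c = \bigcap_(i in [set: 'I_d])
   ((fun x : pt => tnth x i) @^-1` `[- (s / 2) + (c i)%:R * (s / n%:R),
                       - (s / 2) + ((c i)%:R + 1) * (s / n%:R)[%classic)).
  apply: fin_bigcap_measurable => // i _; rewrite -[X in measurable X]setTI.
  exact: measurable_tnth.
by apply/seteqP; split => x /= H i => [_|]; exact: H.
Qed.

Lemma lebesgue_cell_set c : lebesgue_tuple d (cell_set c) = ((s / n%:R) ^+ d)%:E.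
Proof.
rewrite /cell_set (@lebesgue_tuple_box R d (fun i => `[- (s / 2) + (c i)%:R * (s / n%:R),
  - (s / 2) + ((c i)%:R + 1) * (s / n%:R)[%classic)) => [|i]; last exact: measurable_itv.
rewrite (eq_bigr (fun=> (s / n%:R)%:E)) => [|i _]; last first.
  rewrite lebesgue_measure_itv/= lte_fin ltrD2l ltr_pM2r ?divr_gt0// ltrDl ltr01.
  by rewrite -EFinD; congr EFin; ring.
by rewrite prodEFin prodr_const card_ord.
Qed.

End cell_bounds.

Lemma measurable_cube s : measurable (cube s : set pt).
Proof.
rewrite (_ : cube s = \bigcap_(i in [set: 'I_d])
   ((fun x : pt => tnth x i) @^-1` `[- (s / 2), s / 2[%classic)).
  apply: fin_bigcap_measurable => // i _; rewrite -[X in measurable X]setTI.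
  exact: measurable_tnth.
by apply/seteqP; split => x /= H i => [_|]; have := H i; rewrite /= in_itv//= => /(_ I).
Qed.

Lemma ocell_None s n : ocell s n @^-1` [set None] = ~` cube s.
Proof.
apply/seteqP; split => x /=; rewrite /ocell; case: incubeP => //.
Qed.

Lemma measurable_ocell s n v : 0 < s -> (0 < n)%N -> measurable (ocell s n @^-1` [set v]).
Proof.
move=> s0 n0; case: v => [c|]; last first.
  by rewrite ocell_None; apply: measurableC; exact: measurable_cube.
have [cn|cn] := boolP (c \in cells d n); last by rewrite ocell_Some0.
by rewrite ocell_Some//; exact: measurable_cell_set.
Qed.

Definition close (r : R) : rel pt := fun x y => edist x y <= r.

Lemma close_sum r x y : 0 <= r ->
  close r x y = (\sum_(i < d) (tnth x i - tnth y i) ^+ 2 <= r ^+ 2).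
Proof.
move=> r0; rewrite /close /edist -{1}(ger0_norm r0) -sqrtr_sqr ler_sqrt//.
exact: sqr_ge0.
Qed.

Section gap_bounds.
Variables (s : R) (n : nat).
Hypotheses (s0 : 0 < s) (n0 : (0 < n)%N).
Let nR : 0 < n%:R :> R. Proof. by rewrite ltr0n. Qed.

(** Each point is free within its cell, so the true difference is within one cell side of the
    difference of the indices; [gap] has already subtracted one. *)
Lemma gap_bounds x y i : incube s x -> incube s y ->
  let g := s / n%:R * (gap (cell_at s n x i) (cell_at s n y i))%:R in
  g <= `|tnth x i - tnth y i| /\ `|tnth x i - tnth y i| <= g + 2 * (s / n%:R).
Proof.
move=> xs ys /=.
wlog xy : x y xs ys / (cell_at s n y i <= cell_at s n x i)%N.
  move=> W; case: (leqP (cell_at s n y i) (cell_at s n x i)) => [|/ltnW] /W; first exact.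
  by rewrite gapC distrC; apply.
have /andP[x1 x2] := cell_at_itv s0 n0 i xs.
have /andP[y1 y2] := cell_at_itv s0 n0 i ys.
move: x1 x2 y1 y2 xy; set c := cell_at s n x i; set b := cell_at s n y i.
set del := s / n%:R => x1 x2 y1 y2 bc.
have del0 : 0 < del by rewrite divr_gt0.
rewrite /gap (eqP (_ : b - c == 0)%N) ?subn_eq0// addn0.
have [cb|cb] := leqP c b.
  have E : c = b by apply/eqP; rewrite eqn_leq cb bc.
  rewrite E subnn/= mulr0 add0r; split => //.
  by rewrite ler_norml; move: x1 x2 y1 y2; rewrite E => *; apply/andP; split; lra.
have E : (c - b).-1%:R = c%:R - b%:R - 1 :> R.
  by rewrite -subn1 !natrB// subn_gt0.
have P : 0 <= (c%:R - b%:R - 1) * del.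
  by rewrite -E mulr_ge0// ltW.
rewrite E; split; last by rewrite ler_norml; apply/andP; split; lra.
by apply: le_trans (ler_norm _); lra.
Qed.

End gap_bounds.

(** Lengths are measured in units of [r], so the cell side [s / n] becomes [s / r / n]. *)
Lemma near_cell_at s n r x y : 0 < s -> (0 < n)%N -> 0 < r -> incube s x -> incube s y ->
  close r x y -> near_cells (s / r / n%:R) (cell_at s n x) (cell_at s n y).
Proof.
move=> s0 n0 r0 xs ys; rewrite close_sum ?(ltW r0)// => xy.
have nR : 0 < n%:R :> R by rewrite ltr0n.
have r20 : 0 < r ^+ 2 by rewrite exprn_gt0.
rewrite /near_cells -(ler_pM2l r20) mulr1; apply: le_trans xy.
rewrite mulr_sumr; apply: ler_sum => i _.
have [+ _] := gap_bounds s0 n0 i xs ys; set g := gap _ _ => H.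
rewrite (_ : r ^+ 2 * _ = (s / n%:R * g%:R) ^+ 2); last by field; rewrite !gt_eqF.
rewrite -[leRHS](real_normK (num_real _)) lerXn2r ?nnegrE//.
by rewrite mulr_ge0// divr_ge0// ltW.
Qed.

Lemma eventually_not_near r x y : 0 < r -> ~~ close r x y -> exists2 eta, 0 < eta &
  forall s n, 0 < s -> (0 < n)%N -> s / n%:R < eta -> incube s x -> incube s y ->
    ~~ near_cells (s / r / n%:R) (cell_at s n x) (cell_at s n y).
Proof.
move=> r0; rewrite close_sum ?(ltW r0)// -ltNge.
set D := \sum_(i < d) _ => rD.
pose A := \sum_(i < d) `|tnth x i - tnth y i|.
have A0 : 0 <= A by apply: sumr_ge0.
(* For a coordinate difference [u] and cell side [del], the squared gap is at least
   [u ^+ 2 - 4 * del * u]. Summing loses [4 * del * A], less than the margin [D - r ^+ 2]; the added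
   one keeps the denominator positive. *)
exists ((D - r ^+ 2) / (4 * (A + 1))).
  by rewrite divr_gt0 ?subr_gt0// mulr_gt0// ltr_wpDl.
move=> s n s0 n0; set del := s / n%:R => deta xs ys.
have nR : 0 < n%:R :> R by rewrite ltr0n.
have del0 : 0 < del by rewrite divr_gt0.
have r20 : 0 < r ^+ 2 by rewrite exprn_gt0.
rewrite /near_cells -ltNge -(ltr_pM2l r20) mulr1.
apply: (@lt_le_trans _ _ (D - 4 * del * A)).
  have A1 : 0 < 4 * (A + 1) by rewrite mulr_gt0// ltr_wpDl.
  by move: deta; rewrite ltr_pdivlMr//; lra.
rewrite /D /A !mulr_sumr -sumrB; apply: ler_sum => i _.
have [] := gap_bounds s0 n0 i xs ys; rewrite -/del; set g := gap _ _ => H1 H2.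
rewrite (_ : r ^+ 2 * _ = (del * g%:R) ^+ 2); last by rewrite /del; field; rewrite !gt_eqF.
rewrite -[X in X - _](real_normK (num_real _)).
have : 0 <= del * g%:R by rewrite mulr_ge0// ltW.
move: H1 H2 (normr_ge0 (tnth x i - tnth y i)).
move: (`|_|) (del * g%:R) => u v H1 H2 u0 v0.
have [ud|ud] := leP u (2 * del); first by nra.
nra.
Qed.

Lemma eventually_separated (x y : pt) : x != y -> exists2 eta, 0 < eta &
  forall s n, 0 < s -> (0 < n)%N -> s / n%:R < eta -> incube s x -> incube s y ->
    cell_at s n x != cell_at s n y.
Proof.
move=> xy; have [i xyi] : exists i, tnth x i != tnth y i.
  apply/existsP; apply: contraNT xy; rewrite negb_exists => /forallP H.
  by apply/eqP/eq_from_tnth => i; apply/eqP; have := H i; rewrite negbK.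
exists (`|tnth x i - tnth y i| / 2) => [|s n s0 n0 del xs ys].
  by rewrite divr_gt0// normr_gt0 subr_eq0.
apply: contraTneq del => E; rewrite -leNgt ler_pdivrMr//.
have [_] := gap_bounds s0 n0 i xs ys; rewrite E /gap subnn/= mulr0 add0r mulrC.
by [].
Qed.

Lemma seq_eventually (Q : pt -> pt -> R -> nat -> Prop) (l : seq pt) :
  (forall x y, exists2 eta, 0 < eta & forall s n, 0 < s -> (0 < n)%N -> s / n%:R < eta -> Q x y s n) ->
  exists2 eta, 0 < eta & forall s n, 0 < s -> (0 < n)%N -> s / n%:R < eta ->
    {in l &, forall x y, Q x y s n}.
Proof.
move=> H; have H1 x : exists2 eta, 0 < eta & forall s n, 0 < s -> (0 < n)%N -> s / n%:R < eta ->
    {in l, forall y, Q x y s n}.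
  elim: l => [|y l [eta e0 IH]]; first by exists 1.
  have [eta' e'0 Q'] := H x y.
  exists (Num.min eta eta') => [|s n s0 n0]; first by rewrite lt_min e0.
  rewrite lt_min => /andP[d1 d2] z; rewrite inE => /predU1P[->|]; first exact: Q'.
  exact: IH.
suff : forall k : seq pt, exists2 eta, 0 < eta & forall s n, 0 < s -> (0 < n)%N -> s / n%:R < eta ->
    {in k & l, forall x y, Q x y s n} by move/(_ l).
elim=> [|y k [eta e0 IH]]; first by exists 1.
have [eta' e'0 Q'] := H1 y.
exists (Num.min eta eta') => [|s n s0 n0]; first by rewrite lt_min e0.
rewrite lt_min => /andP[d1 d2] z w; rewrite inE => /predU1P[->|zk] wl; first exact: Q'.
exact: IH.
Qed.

(** Close points are near on every grid, a pair that is not close has a positive margin, and one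
    threshold serves the finitely many pairs. *)
Lemma eventually_near_close r (l : seq pt) : 0 < r -> exists2 eta, 0 < eta &
  forall s n, 0 < s -> (0 < n)%N -> s / n%:R < eta ->
  {in l &, forall x y, incube s x -> incube s y ->
     near_cells (s / r / n%:R) (cell_at s n x) (cell_at s n y) = close r x y}.
Proof.
move=> r0; apply: (seq_eventually (Q := fun x y s n => incube s x -> incube s y -> _ = _)).
move=> x y; have [xy|xy] := boolP (close r x y).
  by exists 1 => // s n s0 n0 _ xs ys; rewrite near_cell_at.
have [eta e0 H] := eventually_not_near r0 xy.
by exists eta => // s n s0 n0 sn xs ys; apply/negbTE/H.
Qed.

Lemma eventually_injective (l : seq pt) : exists2 eta, 0 < eta &
  forall s n, 0 < s -> (0 < n)%N -> s / n%:R < eta ->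
  {in l &, forall x y, incube s x -> incube s y ->
     cell_at s n x = cell_at s n y -> x = y}.
Proof.
apply: (seq_eventually (Q := fun x y s n => incube s x -> incube s y -> _ = _ -> x = y)).
move=> x y; have [->|xy] := eqVneq x y; first by exists 1.
have [eta e0 H] := eventually_separated xy.
exists eta => // s n s0 n0 sn xs ys /eqP E.
by move: (H s n s0 n0 sn xs ys); rewrite E.
Qed.

End grid.

Section ties.
Context {R : realType} {d : nat}.
Local Notation pt := (d.-tuple R).
Variable mu : probability pt R.
Hypothesis mu_diffuse : forall x, mu [set x] = 0%E.
Context {dO : measure_display} {Omega : measurableType dO}.
Variables (P : probability Omega R) (X : nat -> {RV P >-> pt}).
Hypotheses (X_law : forall i A, measurable A -> distribution P (X i) A = mu A)
  (X_indep : mutually_independent P X).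

(** Independence identifies the law of the pair with the product measure, under which the diagonal
    is null because its sections are points. *)
Lemma ties_negligible i j : i != j -> P [set w | X i w = X j w] = 0%E.
Proof.
move=> ij; pose Y (w : Omega) := (X i w, X j w).
have mY : measurable_fun setT Y by apply: measurable_fun_pair; exact: measurable_funPT.
pose D : set (pt * pt) := [set z | z.1 = z.2].
have mD : measurable D.
  rewrite (_ : D = \bigcap_(k in [set: 'I_d])
      ((fun z : pt * pt => tnth z.1 k - tnth z.2 k) @^-1` [set 0])).
    apply: fin_bigcap_measurable => // k _; rewrite -[X in measurable X]setTI.
    apply: measurable_funB => //.
      exact: (measurableT_comp (measurable_tnth k) measurable_fst).
    exact: (measurableT_comp (measurable_tnth k) measurable_snd).
  apply/seteqP; split => z /=; first by move=> E k _ /=; rewrite E subrr.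
  by move=> H; apply: eq_from_tnth => k; apply/eqP; rewrite -subr_eq0; apply/eqP/H.
have E A B : measurable A -> measurable B ->
    pushforward P Y (A `*` B) = (mu A * mu B)%E.
  move=> mA mB; rewrite -(X_law i mA) -(X_law j mB).
  have := X_indep [fset i; j]%fset (B := fun k => if k == i then A else B) _.
  rewrite big_fsetU1 ?inE//= big_seq_fset1 eqxx eq_sym (negPf ij) => <-.
    rewrite /pushforward; congr (P _); apply/seteqP; split => w /=.
      move=> [wA wB] k /=; rewrite !inE => /orP[/eqP ->|/eqP ->]; rewrite ?eqxx//.
      by rewrite eq_sym (negPf ij).
    move=> H; split.
      by have := H i; rewrite /= !inE !eqxx; apply.
    by have := H j; rewrite /= !inE !eqxx orbT eq_sym (negPf ij); apply.
  by move=> k; case: ifP.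
have H := product_measure_unique (m1 := mu) (m2 := mu) E mD.
have -> : P [set w | X i w = X j w] = (mu \x mu)%E D by rewrite H.
rewrite /product_measure1; apply: integral0_eq => x _ /=.
rewrite (_ : xsection D x = [set x])//.
by apply/seteqP; split => y; rewrite /xsection /= inE /D/= => ->.
Qed.

End ties.

Lemma unit_increments_norm (R : realType) (C : Type) (F : seq C -> R) :
  unit_increments F -> F [::] = 0 -> forall l, 0 <= F l <= (size l)%:R.
Proof.
move=> FI F0; elim=> [|x l /andP[l0 ln]]; first by rewrite F0 lexx.
have /andP[] := FI [::] x l; rewrite /= -natr1 => ? ?.
by apply/andP; split; lra.
Qed.

(** * Packing numbers of samples as limits over grids *)

Section grid_samples.
Context {R : realType} {d h : nat} (a : rel nat).
Local Notation pt := (d.-tuple R).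
Hypothesis h_gt0 : (0 < h)%N.
Local Notation npk := (@npk R h a _).

(* [None] stands for the points outside the grid. *)
Definition grid_pk (delta : R) (l : seq (option (cell d))) : R :=
  npk (near_cells delta) (pmap idfun l).
(** Removing repetitions makes the value agree, on fine grids, with the packing number of the set of
    sampled points on every outcome, ties included. *)
Definition grid_pk_undup (delta : R) (l : seq (option (cell d))) : R :=
  npk (near_cells delta) (undup (pmap idfun l)).

Lemma grid_pk_unit_increments delta : unit_increments (grid_pk delta).
Proof.
move=> s [x|] t; rewrite /grid_pk !pmap_cat/=; first exact: npk_unit_increments.
by rewrite lexx lerDl ler01.
Qed.

Lemma npk_undup_unit_increments (C : eqType) (e : rel C) :
  unit_increments (fun l => npk e (undup l)).
Proof.
move=> s x t; rewrite /npk (pk_perm a h_gt0 e (_ : perm_eq (undup (s ++ x :: t)) (undup (x :: (s ++ t))))).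
  rewrite /=; case: ifP => _; first by rewrite lexx lerDl ler01.
  by have := npk_unit_increments a h_gt0 e [::] x (undup (s ++ t)).
apply: uniq_perm; rewrite ?undup_uniq// => y.
by rewrite !mem_undup !(mem_cat, inE) orbCA.
Qed.

Lemma grid_pk_undup_unit_increments delta : unit_increments (grid_pk_undup delta).
Proof.
move=> s [x|] t; rewrite /grid_pk_undup !pmap_cat/=; first exact: npk_undup_unit_increments.
by rewrite lexx lerDl ler01.
Qed.

Lemma pmap_ocell s n (l : seq pt) :
  pmap idfun (map (ocell s n) l) = map (cell_at s n) (seq.filter (incube s) l).
Proof. by elim: l => //= x l IH; rewrite /ocell; case: ifP => _ /=; rewrite IH. Qed.

Lemma grid_pk_eventually r (l : seq pt) : 0 < r -> exists2 eta, 0 < eta &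
  forall s n, 0 < s -> (0 < n)%N -> s / n%:R < eta ->
    grid_pk (s / r / n%:R) (map (ocell s n) l) = npk (close r) (seq.filter (incube s) l).
Proof.
move=> r0; have [eta e0 H] := eventually_near_close l r0.
exists eta => // s n s0 n0 sn; rewrite /grid_pk pmap_ocell /npk; congr (_%:R).
apply: pk_map => // x y; rewrite !mem_filter => /andP[xs xl] /andP[ys yl].
exact: H.
Qed.

Lemma grid_pk_undup_eventually r (l : seq pt) : 0 < r -> exists2 eta, 0 < eta &
  forall s n, 0 < s -> (0 < n)%N -> s / n%:R < eta ->
    grid_pk_undup (s / r / n%:R) (map (ocell s n) l) =
    npk (close r) (undup (seq.filter (incube s) l)).
Proof.
move=> r0; have [eta e0 H] := eventually_near_close l r0.
have [eta' e'0 H'] := eventually_injective l.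
exists (Num.min eta eta') => [|s n s0 n0]; first by rewrite lt_min e0.
rewrite lt_min => /andP[sn sn'].
rewrite /grid_pk_undup pmap_ocell.
set k := seq.filter _ l.
have kP x : x \in k -> incube s x /\ x \in l by rewrite mem_filter => /andP[].
have -> : undup (map (cell_at s n) k) = map (cell_at s n) (undup k).
  elim: (k) kP => //= x m IH mP.
  have {}IH := IH (fun y ym => mP y (mem_behead (s := _ :: _) ym)).
  rewrite (_ : (_ \in map _ m) = (x \in m)); first by rewrite IH; case: ifP.
  apply/mapP/idP => [[y ym E]|xm]; last by exists x.
  have [xs xl] := mP x (mem_head _ _); have [ys yl] := mP y (mem_behead (s := _ :: _) ym).
  by rewrite (H' s n s0 n0 sn' x y).
rewrite /npk; congr (_%:R); apply: pk_map => // x y.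
by rewrite !mem_undup => /kP[xs xl] /kP[ys yl]; exact: H.
Qed.

Variable mu : probability pt R.
Context {dO : measure_display} {Omega : measurableType dO}.
Variables (P : probability Omega R) (X : nat -> {RV P >-> pt}).
Hypotheses (X_law : forall i A, measurable A -> distribution P (X i) A = mu A)
  (X_indep : mutually_independent P X).

Let sample n w := [seq X i w | i <- iota 0 n].

Definition grid_law s n (s0 : 0 < s) (n0 : (0 < n)%N) : mean R (option (cell d)) :=
  @law R _ _ mu _ (ocell s n) (ocells n) (ocells_uniq n) (ocell_ocells s0 n0)
    (fun v => measurable_ocell v s0 n0).

Lemma bounded_rv_grid s k n (F : seq (option (cell d)) -> R) : 0 < s -> (0 < k)%N ->
  bounded_rv (fun w => F (map (ocell s k) (sample n w))).
Proof.
move=> s0 k0; under eq_fun do rewrite /sample -map_comp.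
exact: (bounded_rv_sample (ocells_uniq k) (ocell_ocells s0 k0)
  (fun v => measurable_ocell v s0 k0)).
Qed.

Lemma mean_rv_grid s k n (F : seq (option (cell d)) -> R) (s0 : 0 < s) (k0 : (0 < k)%N) :
  mean_rv P (fun w => F (map (ocell s k) (sample n w))) = iid (grid_law s0 k0) n F.
Proof.
under eq_fun do rewrite /sample -map_comp.
exact: (mean_rv_sample (mu := mu)).
Qed.

Section limits.
Variables (n : nat) (r : R).
Hypothesis r0 : 0 < r.

(** On each outcome the grid value is eventually the true one, and all values are bounded by [n].
    The conclusion quantifies over positivity proofs because [grid_law] takes them as arguments. *)
Lemma npk_box_cvg (s : R) (k_ : nat -> nat) : 0 < s -> (forall j, (0 < k_ j)%N) ->
  (forall m, exists j0, forall j, (j0 <= j)%N -> (m <= k_ j)%N) ->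
  bounded_rv (fun w => npk (close r) (seq.filter (incube s) (sample n w))) /\
  forall (s0' : 0 < s) (k0' : forall j, (0 < k_ j)%N),
  iid (grid_law s0' (k0' j)) n (grid_pk (s / r / (k_ j)%:R)) @[j --> \oo] -->
  mean_rv P (fun w => npk (close r) (seq.filter (incube s) (sample n w))).
Proof.
move=> s0 k0 koo.
have [||w|bf lim] := @bounded_cvg R _ _ P
  (fun j w => grid_pk (s / r / (k_ j)%:R) (map (ocell s (k_ j)) (sample n w)))
  (fun w => npk (close r) (seq.filter (incube s) (sample n w))) n%:R.
- by move=> j; exact: (bounded_rv_grid n (grid_pk (s / r / (k_ j)%:R)) s0 (k0 j)).1.
- move=> j w; have /andP[f0 f1] := unit_increments_norm (@grid_pk_unit_increments
    (s / r / (k_ j)%:R)) (npk_nil a h_gt0 _) (map (ocell s (k_ j)) (sample n w)).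
  by rewrite ger0_norm// (le_trans f1)// !size_map size_iota.
- have [eta e0 H] := grid_pk_eventually (sample n w) r0.
  have [j0 Hj0] := koo (Num.truncn (s / eta)).+1.
  apply: cvg_near_cst; exists j0 => // j /= j0j; apply: H => //.
  rewrite ltr_pdivrMr ?ltr0n//; have := Hj0 j j0j; rewrite -(ler_nat R).
  move=> kj; rewrite -ltr_pdivrMl// mulrC.
  by apply: lt_le_trans kj; exact: Num.Theory.truncnS_gt.
split => // s0' k0'; apply: cvg_trans lim; apply: near_eq_cvg; apply: nearW => j.
by rewrite /= (mean_rv_grid _ _ s0' (k0' j)).
Qed.

Definition npk_sample (w : Omega) : R := npk (close r) (undup (sample n w)).

(** The side tends to infinity while the mesh [s_ j / k_ j] is [1 / (j + 1)], so every sample is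
    eventually inside the cube and resolved by the grid. *)
Let s_ (j : nat) : R := j.+1%:R.
Let k_ (j : nat) : nat := (j.+1 * j.+1)%N.
Let s_gt0 j : 0 < s_ j. Proof. by rewrite ltr0n. Qed.
Let k_gt0 j : (0 < k_ j)%N. Proof. by []. Qed.
Let f_ j w := grid_pk_undup (s_ j / r / (k_ j)%:R) (map (ocell (s_ j) (k_ j)) (sample n w)).

Let f_cvg w : f_ j w @[j --> \oo] --> npk_sample w.
Proof.
have [eta e0 H] := grid_pk_undup_eventually (sample n w) r0.
have [M HM] : exists M, forall x, x \in sample n w -> forall s, M <= s -> incube s x.
  elim: (sample n w) => [|x l [M HM]]; first by exists 0.
  pose A := \sum_(i < d) `|tnth x i|.
  exists (Num.max M (2 * A + 1)) => y; rewrite inE => /predU1P[->|yl] s; rewrite ge_max => /andP[sM sA].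
    apply/forallP => i; have : `|tnth x i| <= A.
      by rewrite /A (bigD1 i)//= lerDl sumr_ge0.
    by rewrite ler_norml => /andP[? ?]; apply/andP; split; lra.
  exact: HM.
apply: cvg_near_cst; exists (maxn (Num.truncn M).+1 (Num.truncn eta^-1).+1) => // j /=.
rewrite geq_max => /andP[jM je]; rewrite /f_ H//.
  rewrite /npk_sample (_ : seq.filter _ _ = sample n w)//.
  apply/all_filterP/allP => x xl; apply: HM xl _ _.
  apply: le_trans (ltW (Num.Theory.truncnS_gt M)) _.
  by rewrite ler_nat ltnW.
rewrite /s_ /k_ natrM invfM mulrA mulfV ?mul1r ?pnatr_eq0//.
rewrite invf_plt ?posrE ?ltr0n//.
by apply: lt_le_trans (Num.Theory.truncnS_gt _) _; rewrite ler_nat ltnW.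
Qed.

Let f_bound j w : `|f_ j w| <= n%:R.
Proof.
have /andP[f0 f1] := unit_increments_norm (@grid_pk_undup_unit_increments
    (s_ j / r / (k_ j)%:R)) (npk_nil a h_gt0 _) (map (ocell (s_ j) (k_ j)) (sample n w)).
by rewrite ger0_norm// (le_trans f1)// !size_map size_iota.
Qed.

Let f_meas j : measurable_fun [set: Omega] (f_ j).
Proof.
exact: (bounded_rv_grid n (grid_pk_undup (s_ j / r / (k_ j)%:R)) (s_gt0 j) (k_gt0 j)).1.
Qed.

Lemma bounded_rv_npk_sample : bounded_rv npk_sample.
Proof. by have [] := bounded_cvg P f_meas f_bound f_cvg. Qed.

Lemma npk_sample_le w : 0 <= h%:R * npk_sample w <= n%:R.
Proof.
rewrite mulr_ge0 ?npk_ge0//=; apply: le_trans (npk_size _ _ _ _) _.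
by rewrite ler_nat (leq_trans (size_undup _))// size_map size_iota.
Qed.

(** The error term of [iid_exp_le] depends on the number of points but not on the grid, so the bound
    survives the limit along grids. *)
Lemma bounded_rv_exp b : bounded_rv (fun w => expR (b * npk_sample w)) /\
  (`|b| <= 1 / 2 ->
  mean_rv P (fun w => expR (b * npk_sample w)) <=
    expR (b * mean_rv P npk_sample + n%:R * (2 * b ^+ 2))).
Proof.
have [_ lim1] := bounded_cvg P f_meas f_bound f_cvg.
have m2 j : measurable_fun [set: Omega] (fun w => expR (b * f_ j w)).
  by apply: measurableT_comp => //; exact: measurable_funM.
have b2 j w : `|expR (b * f_ j w)| <= expR (`|b| * n%:R).
  rewrite ger0_norm ?expR_ge0// ler_expR (le_trans (ler_norm _))// normrM.
  by rewrite ler_wpM2l.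
have c2 w : expR (b * f_ j w) @[j --> \oo] --> expR (b * npk_sample w).
  apply: continuous_cvg; first exact: continuous_expR.
  by apply: cvgM; [exact: cvg_cst|exact: f_cvg].
have [B lim2] := bounded_cvg P m2 b2 c2; split => // bb.
have c3 : expR (b * mean_rv P (f_ j) + n%:R * (2 * b ^+ 2)) @[j --> \oo] -->
    expR (b * mean_rv P npk_sample + n%:R * (2 * b ^+ 2)).
  apply: continuous_cvg; first exact: continuous_expR.
  apply: cvgD; last exact: cvg_cst.
  by apply: cvgM lim1; exact: cvg_cst.
apply: (ler_cvg_to lim2 c3); apply: nearW => j.
rewrite /f_ (mean_rv_grid n (fun l => expR (b * grid_pk_undup (s_ j / r / (k_ j)%:R) l))
  (s_gt0 j) (k_gt0 j)) (mean_rv_grid n _ (s_gt0 j) (k_gt0 j)).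
by apply: iid_exp_le => //; exact: grid_pk_undup_unit_increments.
Qed.

Hypothesis mu_diffuse : forall x, mu [set x] = 0%E.

Lemma ae_uniq_sample : {ae P, forall w, uniq (sample n w)}.
Proof.
pose A := \bigcup_(i in [set: nat]) \bigcup_(j in [set k | k != i]) [set w | X i w = X j w].
have nA : P.-negligible A.
  apply: negligible_bigcup => i; rewrite bigcup_mkcond; apply: negligible_bigcup => j.
  case: ifPn => [|_]; last exact: negligible_set0.
  rewrite inE /= eq_sym => ij; apply/negligibleP.
    rewrite (_ : [set w | _] = \bigcap_(k in [set: 'I_d])
       ((fun w => tnth (X i w) k - tnth (X j w) k) @^-1` [set 0])).
      apply: fin_bigcap_measurable => // k _; rewrite -[X in measurable X]setTI.
      apply: measurable_funB => //; apply: (measurableT_comp (measurable_tnth k)) => //.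
    apply/seteqP; split => w /=; first by move=> E k _ /=; rewrite E subrr.
    by move=> H; apply: eq_from_tnth => k; apply/eqP; rewrite -subr_eq0; apply/eqP/H.
  exact: (ties_negligible mu_diffuse X_law X_indep).
apply: negligibleS nA => w /= nu; apply: contrapT => nAw; apply: nu.
rewrite map_inj_in_uniq ?iota_uniq// => i j _ _ E; apply/eqP; apply: contrapT => /negP ij.
by apply: nAw; exists i => //; exists j => //=; rewrite eq_sym.
Qed.

(** Almost surely there are no ties, and then the points outside the cube change the packing number
    by at most their number. *)
Lemma npk_sample_box s : 0 < s ->
  `|mean_rv P npk_sample -
    mean_rv P (fun w => npk (close r) (seq.filter (incube s) (sample n w)))| <=
  n%:R * fine (mu (~` cube s)).
Proof.
move=> s0; have [bb _] := npk_box_cvg s0 (fun j => ltn0Sn j) (fun m => ex_intro _ m (fun j mj => leqW mj)).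
pose cnt w : R := (count (predC (incube s)) (sample n w))%:R.
(* A grid with a single cell is enough to count the points outside. *)
have E w : cnt w = (fun l => (count (pred1 None) l)%:R) (map (ocell s 1) (sample n w)) :> R.
  rewrite /cnt [in RHS]count_map; congr (_%:R); apply: seq.eq_count => x /=.
  by rewrite /ocell; case: ifP.
have bc : bounded_rv cnt.
  rewrite (funext E).
  exact: (bounded_rv_grid n (fun l => (count (pred1 None) l)%:R) s0 (isT : (0 < 1)%N)).
have mc : mean_rv P cnt = n%:R * fine (mu (~` cube s)).
  rewrite (funext E).
  rewrite (mean_rv_grid n (fun l => (count (pred1 None) l)%:R) s0 (isT : (0 < 1)%N)) iid_count.
  rewrite lawE (_ : _ \o _ = \1_(~` cube s)).
    by rewrite mean_rv_indic//; exact: measurableC (measurable_cube s).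
  apply/funext => x; rewrite /= /ind /= indicE in_setC /ocell.
  by case: incubeP => xs; rewrite ?(mem_set xs) ?(memNset xs).
have b1 := bounded_rv_npk_sample.
have key : {ae P, forall w,
    `|npk_sample w - npk (close r) (seq.filter (incube s) (sample n w))| <= cnt w}.
  apply: filterS ae_uniq_sample => w uw; rewrite /npk_sample (undup_id uw).
  rewrite distrC ler_distlC /cnt /npk -natrD.
  rewrite lerBlDr -natrD !ler_nat pk_filter_count// andbT.
  by rewrite (leq_trans (pk_filter_le _ _ _ _ _))// leq_addr.
rewrite -mc ler_norml -mean_rvB//; apply/andP; split.
  rewrite -subr_ge0 opprK -mean_rvD//; last exact: bounded_rvB.
  rewrite -(mean_rv_cst P 0); apply: mean_rv_le_ae.
  - exact: bounded_rv_cst.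
  - by apply: bounded_rvD => //; exact: bounded_rvB.
  - by apply: filterS key => w; rewrite ler_norml => /andP[]; lra.
apply: mean_rv_le_ae => //; first exact: bounded_rvB.
by apply: filterS key => w; rewrite ler_norml => /andP[].
Qed.

End limits.
End grid_samples.

(** * Approximation by unions of cells *)

Section grid_approximation.
Context {R : realType} {d : nat}.
Local Notation pt := (d.-tuple R).
Variable s : R.
Hypothesis s0 : 0 < s.

Lemma cell_at_cdiv n k (x : pt) : (0 < n)%N -> (0 < k)%N -> incube s x ->
  cdiv k (cell_at s (n * k) x) = cell_at s n x.
Proof.
move=> n0 k0 xs; apply/ffunP => i; rewrite ffunE [in RHS]ffunE; apply/esym.
have nR : 0 < n%:R :> R by rewrite ltr0n.
have kR : 0 < k%:R :> R by rewrite ltr0n.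
have nk0 : (0 < n * k)%N by rewrite muln_gt0 n0.
have := cell_at_itv s0 nk0 i xs.
set c := cell_at _ _ _ i; set x' := tnth x i => /andP[x1 x2].
have del0 : 0 < s / (n * k)%:R by rewrite divr_gt0// ltr0n.
have E : (x' + s / 2) * (n%:R / s) = (x' + s / 2) / (s / (n * k)%:R) / k%:R.
  by rewrite natrM; field; rewrite !gt_eqF.
have y1 : c%:R <= (x' + s / 2) / (s / (n * k)%:R) by rewrite ler_pdivlMr//; lra.
have y2 : (x' + s / 2) / (s / (n * k)%:R) < c%:R + 1 by rewrite ltr_pdivrMr//; lra.
apply: Num.Theory.truncn_def; rewrite E ler_pdivlMr// ltr_pdivrMr//; apply/andP; split.
  by apply: le_trans y1; rewrite -natrM ler_nat leq_trunc_div.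
by apply: lt_le_trans y2 _; rewrite natr1 -natrM ler_nat -ltn_divLR.
Qed.

Lemma measurable_ocell_pred n (Q : pred (option (cell d))) : (0 < n)%N ->
  measurable [set x : pt | Q (ocell s n x)].
Proof.
move=> n0; rewrite (_ : [set _ | _] =
  \bigcup_(v in [set` seq.filter Q (ocells n)]) (ocell s n @^-1` [set v])).
  by apply: fin_bigcup_measurable => // v _; exact: measurable_ocell.
apply/seteqP; split => x.
  move=> Qx; have xv : ocell s n x \in seq.filter Q (ocells n).
    by rewrite mem_filter ocell_ocells// andbT.
  by exists (ocell s n x).
move=> [v vQ E]; have : v \in seq.filter Q (ocells n) := vQ.
by rewrite mem_filter -E => /andP[].
Qed.

(** The symmetric difference, inside the cube, of [A] and the union of the cells in [B]. *)
Definition grid_diff n (B : pred (cell d)) (A : set pt) : set pt :=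
  [set x | incube s x /\ ~ (A x <-> B (cell_at s n x))].

Lemma measurable_grid_diff n B A : (0 < n)%N -> measurable A -> measurable (grid_diff n B A).
Proof.
move=> n0 mA.
pose Q (b : bool) v := if v is Some c then B c == b else false.
have mQ b : measurable [set x | Q b (ocell s n x)] by exact: measurable_ocell_pred.
rewrite (_ : grid_diff n B A = (A `&` [set x | Q false (ocell s n x)])
   `|` ([set x | Q true (ocell s n x)] `\` A)).
  by apply: measurableU; [apply: measurableI => //; exact: mQ|apply: measurableD => //; exact: mQ].
apply/seteqP; split => x; rewrite /grid_diff /ocell /Q /=.
  case: ifPn => xs [] // _ H.
  have [Ax|nAx] := pselect (A x); have [Bx|nBx] := boolP (B (cell_at s n x)).
  - by case: H.
  - by left.
  - by right.
  - by case: H; split => // Bx; rewrite Bx in nBx.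
case: ifPn => xs; last by move=> [[]|[]].
by move=> [[Ax /eqP nB]|[/eqP Bx nA]]; split => // -[H1 H2]; [move: (H1 Ax); rewrite nB|apply: nA; apply: H2].
Qed.

Variable nu : {measure set pt -> \bar R}.
Hypothesis nu_fin : (nu (cube s) < +oo)%E.

Definition grid_approximable (A : set pt) := measurable A /\ forall eps, 0 < eps ->
  exists n, (0 < n)%N /\ exists B, (nu (grid_diff n B A) <= eps%:E)%E.

Lemma grid_approximable0 : grid_approximable set0.
Proof.
split; first exact: measurable0.
move=> eps e0; exists 1%N; split=> //; exists xpred0.
rewrite (_ : grid_diff _ _ _ = set0) ?measure0 ?lee_fin ?ltW//.
by apply/seteqP; split => // x [_ []].
Qed.

Lemma grid_approximableC A : grid_approximable A -> grid_approximable (~` A).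
Proof.
move=> [mA HA]; split; first exact: measurableC.
move=> eps e0; have [n [n0 [B HB]]] := HA eps e0.
exists n; split => //; exists (predC B).
rewrite (_ : grid_diff _ _ _ = grid_diff n B A)//.
apply/seteqP; split => x [xs H]; split => //= H'; apply: H.
  split => /= [nA|/negP nB Ax]; last by apply: nB; apply/H'.
  by apply/negP => Bx; apply: nA; apply/H'.
split => [Ax|Bx]; last by apply: contrapT => nA; move/H'/negP: nA.
by apply: contrapT => /negP nB; have := H'.2 nB.
Qed.

Lemma grid_approximableU A1 A2 :
  grid_approximable A1 -> grid_approximable A2 -> grid_approximable (A1 `|` A2).
Proof.
move=> [mA1 H1] [mA2 H2]; split; first exact: measurableU.
move=> eps e0; have e2 : 0 < eps / 2 by rewrite divr_gt0.
have [n1 [n10 [B1 HB1]]] := H1 _ e2; have [n2 [n20 [B2 HB2]]] := H2 _ e2.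
have n0 : (0 < n1 * n2)%N by rewrite muln_gt0 n10.
exists (n1 * n2)%N; split => //.
exists (fun c => B1 (cdiv n2 c) || B2 (cdiv n1 c)).
apply: (@le_trans _ _ (nu (grid_diff n1 B1 A1 `|` grid_diff n2 B2 A2))); last first.
  rewrite [leRHS](_ : _ = (eps / 2)%:E + (eps / 2)%:E)%E; last by rewrite -EFinD; congr EFin; field.
  apply: le_trans (leeD HB1 HB2); apply: measureU2; exact: measurable_grid_diff.
apply: le_measure; rewrite ?inE//.
- by apply: measurable_grid_diff => //; exact: measurableU.
- by apply: measurableU; exact: measurable_grid_diff.
move=> x [xs]; rewrite cell_at_cdiv// [(n1 * n2)%N]mulnC cell_at_cdiv// => H.
have [HA1|HA1] := pselect (A1 x <-> B1 (cell_at s n1 x)); last by left.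
right; split => // HA2; apply: H; split => [[/HA1 ->//|/HA2 ->]|/orP[/HA1|/HA2]].
- by rewrite orbT.
- by left.
- by right.
Qed.

Lemma grid_approximable_bigU (A : nat -> set pt) m : (forall k, grid_approximable (A k)) ->
  grid_approximable (\bigcup_(k < m) A k).
Proof.
move=> HA; elim: m => [|m IH]; first by rewrite bigcup_mkord big_ord0; exact: grid_approximable0.
by rewrite bigcup_mkord big_ord_recr/= -bigcup_mkord; exact: grid_approximableU.
Qed.

Lemma nonincreasing_small (F : nat -> set pt) eps : 0 < eps ->
  (forall k, measurable (F k)) -> (forall k, F k `<=` cube s) -> nonincreasing_seq F ->
  \bigcap_k F k = set0 -> exists k, (nu (F k) <= eps%:E)%E.
Proof.
move=> e0 mF Fs ndF F0.
have fin k : (nu (F k) < +oo)%E.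
  by apply: le_lt_trans nu_fin; apply: le_measure; rewrite ?inE//; exact: measurable_cube.
have := nonincreasing_cvg_mu (fin 0%N) mF; rewrite F0 measure0 => /(_ measurable0 ndF).
move=> /fine_cvgP[_ /cvgrPdist_le /(_ _ e0)[k _ /(_ k (leqnn k))]] /=.
rewrite sub0r normrN ger0_norm ?fine_ge0 ?measure_ge0// => H; exists k.
by rewrite -(fineK (_ : nu (F k) \is a fin_num)) ?lee_fin// ge0_fin_numE.
Qed.

Lemma grid_approximable_bigcup (A : nat -> set pt) : (forall k, grid_approximable (A k)) ->
  grid_approximable (\bigcup_k A k).
Proof.
move=> HA; have mA k : measurable (A k) by case: (HA k).
have mU : measurable (\bigcup_k A k) by exact: bigcupT_measurable.
split => // eps e0; have e2 : 0 < eps / 2 by rewrite divr_gt0.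
(* What the first [m] sets miss decreases to the empty set, so a finite union suffices up to
   [eps / 2]. *)
pose F m := cube s `&` (\bigcup_k A k `\` \bigcup_(k < m) A k).
have mF m : measurable (F m).
  apply: measurableI; first exact: measurable_cube.
  by apply: measurableD => //; apply: bigcup_measurable.
have [m Fm] : exists m, (nu (F m) <= (eps / 2)%:E)%E.
  apply: nonincreasing_small => //; first by move=> k x [].
    move=> k m km; apply/subsetPset => x [xs [xA xn]]; split => //; split => // -[j /= jk Aj].
    by apply: xn; exists j => //=; exact: leq_trans km.
  apply/seteqP; split => // x Fx; have [_ [[k _ Ak] _]] := Fx 0%N I.
  by have [_ [_ []]] := Fx k.+1 I; exists k => /=.
have [mUm /(_ _ e2)[n [n0 [B HB]]]] := grid_approximable_bigU m HA.
exists n; split => //; exists B.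
apply: (@le_trans _ _ (nu (F m `|` grid_diff n B (\bigcup_(k < m) A k)))); last first.
  rewrite [leRHS](_ : _ = (eps / 2)%:E + (eps / 2)%:E)%E; last by rewrite -EFinD; congr EFin; field.
  by apply: le_trans (leeD Fm HB); apply: measureU2 => //; exact: measurable_grid_diff.
apply: le_measure; rewrite ?inE//.
- exact: measurable_grid_diff.
- by apply: measurableU => //; exact: measurable_grid_diff.
move=> x [xs H]; have [xm|xm] := pselect ((\bigcup_(k < m) A k) x).
  right; split => // E; apply: H; split => [_|_]; first exact/E.
  by have [k _ Ak] := xm; exists k.
have [xA|xA] := pselect ((\bigcup_k A k) x).
  by left; split => //; apply/incubeP.
right; split => // E; apply: H; split => [//|Bx].
by have [k _ Ak] := E.2 Bx; exists k.
Qed.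

Lemma grid_approximable_half i (b : R) : grid_approximable [set x : pt | tnth x i < b].
Proof.
have mH (c : R) : measurable [set x : pt | tnth x i < c].
  rewrite (_ : [set _ | _] = (fun x : pt => tnth x i) @^-1` `]-oo, c[%classic).
    by rewrite -[X in measurable X]setTI; exact: measurable_tnth.
  by apply/seteqP; split => x /=; rewrite in_itv.
split => // eps e0.
(* The cells lying below the hyperplane miss at most a slab as thick as one cell side; these slabs
   decrease to the empty set. *)
pose F m := cube s `&` ([set x : pt | tnth x i < b] `\` [set x | tnth x i < b - s / m.+1%:R]).
have [m Fm] : exists m, (nu (F m) <= eps%:E)%E.
  apply: nonincreasing_small => //.
  - by move=> k; apply: measurableI; [exact: measurable_cube|exact: measurableD].
  - by move=> k x [].
  - move=> k m km; apply/subsetPset => x [xs [xb /= nx]]; split => //; split => //=.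
    move=> xk; apply: nx; apply: lt_le_trans xk _; rewrite lerD2l lerN2 ler_pM2l//.
    by rewrite lef_pV2 ?posrE ?ltr0n// ler_nat.
  - apply/seteqP; split => // x Fx; have [_ [/= xb _]] := Fx 0%N I.
    pose k := Num.truncn (s / (b - tnth x i)).
    have [_ [_ /=]] := Fx k I; apply.
    rewrite ltrBrDr -ltrBrDl ltr_pdivrMr ?ltr0n// mulrC -ltr_pdivrMr ?subr_gt0//.
    exact: Num.Theory.truncnS_gt.
exists m.+1; split => //.
exists (fun c : cell d => - (s / 2) + ((c i)%:R + 1) * (s / m.+1%:R) <= b).
apply: le_trans Fm; apply: le_measure; rewrite ?inE//.
- exact: measurable_grid_diff.
- by apply: measurableI; [exact: measurable_cube|exact: measurableD].
move=> x [xs H]; have /andP[x1 x2] := cell_at_itv s0 (ltn0Sn m) i xs.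
set u := - (s / 2) + _ in H; have xu : tnth x i < u by [].
have [xb bu] : tnth x i < b /\ b < u.
  have [ub|bu] := leP u b.
    by case: H; split => // _; exact: lt_le_trans ub.
  split => //; apply: contrapT => nxb; apply: H; split => //.
  by rewrite leNgt bu.
split; first exact/incubeP.
split => //=; apply/negP; rewrite -leNgt; move: x1 bu; rewrite /u.
by move: (s / m.+1%:R) => del; clear; lra.
Qed.

(** Approximable sets form a sigma-algebra that contains the half-spaces, hence everything generated
    by the coordinates. *)
Lemma measurable_grid_approximable A : measurable A -> grid_approximable A.
Proof.
have sa : sigma_algebra setT grid_approximable.
  split; [exact: grid_approximable0|by move=> B; rewrite setTD; exact: grid_approximableC|].
  exact: grid_approximable_bigcup.
move: A; apply: smallest_sub => //.
have coord i B : measurable B -> grid_approximable ((fun x : pt => tnth x i) @^-1` B).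
  move=> mB; have {mB} : (@RGenInftyO.G R).-sigma.-measurable B.
    by rewrite -RGenInftyO.measurableE; exact: mB.
  move: B; apply: smallest_sub.
    split; first by rewrite preimage_set0; exact: grid_approximable0.
      by move=> B HB; rewrite setTD preimage_setC; exact: grid_approximableC.
    by move=> B HB; rewrite preimage_bigcup; exact: grid_approximable_bigcup.
  move=> _ [c ->]; rewrite (_ : _ @^-1` _ = [set x : pt | tnth x i < c]).
    exact: grid_approximable_half.
  by apply/seteqP; split => x /=; rewrite in_itv.
elim/big_ind: _ => [//|X Y HX HY A [/HX|/HY]//|i _ A [B mB <-]].
by rewrite setTI; exact: coord.
Qed.

End grid_approximation.

Import HBSimple.

Section step_approximation.
Context {R : realType} {d : nat}.
Local Notation pt := (d.-tuple R).
Local Notation lam := (@lebesgue_tuple R d).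
Variable s : R.
Hypothesis s0 : 0 < s.

Lemma lebesgue_cube : lam (cube s) = (s ^+ d)%:E.
Proof.
rewrite (_ : cube s = [set x | forall i, `[- (s / 2), s / 2[%classic (tnth x i)]); last first.
  by apply/seteqP; split => x H i; have := H i; rewrite /= in_itv.
rewrite (@lebesgue_tuple_box R d (fun=> `[- (s / 2), s / 2[%classic)) => [|i]; last exact: measurable_itv.
rewrite (eq_bigr (fun=> s%:E)) => [|i _]; first by rewrite prodEFin prodr_const card_ord.
have ss : - (s / 2) < s / 2 by move: s0; lra.
rewrite lebesgue_measure_itv/= lte_fin ss.
by rewrite -EFinD; congr EFin; field.
Qed.

Definition step n (b : cell d -> R) (x : pt) : R :=
  if ocell s n x is Some c then b c else 0.

Lemma step_cell n b x : incube s x -> step n b x = b (cell_at s n x).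
Proof. by move=> xs; rewrite /step /ocell xs. Qed.

Lemma bounded_rv_step n b : (0 < n)%N -> bounded_rv (step n b).
Proof.
move=> n0.
exact: (bounded_rv_finite_valued (ocells_uniq n) (ocell_ocells s0 n0)
  (fun v => measurable_ocell v s0 n0) (fun v => if v is Some c then b c else 0)).
Qed.

Lemma measurable_step n b : (0 < n)%N -> measurable_fun setT (step n b).
Proof. by move=> n0; case: (bounded_rv_step b n0). Qed.

Let dist1 (f g : pt -> R) : \bar R := (\int[lam]_(x in cube s) (`|f x - g x|)%:E)%E.

Let measurable_dist1 (f g : pt -> R) : measurable_fun setT f -> measurable_fun setT g ->
  measurable_fun (cube s) (fun x => (`|f x - g x|)%:E).
Proof.
move=> mf mg; apply/measurable_EFinP/measurable_funTS/measurableT_comp => //.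
exact: measurable_funB.
Qed.

Let dist1_le (f1 f2 g1 g2 : pt -> R) :
  measurable_fun setT f1 -> measurable_fun setT f2 ->
  measurable_fun setT g1 -> measurable_fun setT g2 ->
  (dist1 (fun x => f1 x + f2 x)%R (fun x => g1 x + g2 x)%R <= dist1 f1 g1 + dist1 f2 g2)%E.
Proof.
move=> mf1 mf2 mg1 mg2; have mC := measurable_cube (d := d) s.
have m1 := measurable_dist1 mf1 mg1; have m2 := measurable_dist1 mf2 mg2.
have m3 := measurable_dist1 (measurable_funD mf1 mf2) (measurable_funD mg1 mg2).
rewrite /dist1 -ge0_integralD//=.
apply: ge0_le_integral => //=.
  by apply: emeasurable_funD.
move=> x _; rewrite -EFinD lee_fin; apply: le_trans (ler_normD _ _).
by rewrite le_eqVlt; apply/orP; left; apply/eqP; congr Num.norm; ring.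
Qed.

Let eq_dist1 f g f' g' : (forall x, incube s x -> f x - g x = f' x - g' x) -> dist1 f g = dist1 f' g'.
Proof.
by move=> E; apply: eq_integral => x; rewrite inE => /incubeP xs; rewrite E.
Qed.

Let approx (g : pt -> R) := measurable_fun setT g /\ forall eps, 0 < eps ->
  exists n, (0 < n)%N /\ exists b, (dist1 g (step n b) <= eps%:E)%E.

Let approx_indic A : measurable A -> approx (\1_A).
Proof.
move=> mA; split; first exact: measurable_indic.
move=> eps e0; have fin : (lam (cube s) < +oo)%E by rewrite lebesgue_cube ltry.
have [_ /(_ eps e0)[n [n0 [B HB]]]] := measurable_grid_approximable s0 fin mA.
exists n; split => //; exists (fun c => (B c)%:R).
rewrite /dist1 (eq_integral (fun x => (\1_(grid_diff s n B A) x)%:E)).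
  rewrite integral_indic//; last 2 first.
  - exact: measurable_cube.
  - exact: measurable_grid_diff.
  apply: le_trans HB; apply: le_measure; rewrite ?inE//.
  - by apply: measurableI; [exact: measurable_grid_diff|exact: measurable_cube].
  - exact: measurable_grid_diff.
move=> x; rewrite inE => /incubeP xs; congr EFin; rewrite step_cell// !indicE.
have [/set_mem Ax|/negP nAx] := boolP (x \in A).
  have [Bx|nBx] := boolP (B (cell_at s n x)).
    by rewrite memNset ?subrr ?normr0// => -[_]; apply.
  by rewrite mem_set ?subr0 ?normr1//; split => // -[/(_ Ax)]; rewrite (negPf nBx).
have {}nAx : ~ A x by move=> Ax; apply: nAx; rewrite inE.
have [Bx|nBx] := boolP (B (cell_at s n x)).
  by rewrite mem_set ?sub0r ?normrN ?normr1//; split => // -[_ /(_ Bx)].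
rewrite memNset ?subrr ?normr0// => -[_]; apply; split => // Bx.
by rewrite Bx in nBx.
Qed.

Let approxZ c g : approx g -> approx (fun x => c * g x).
Proof.
move=> [mg Hg]; split; first exact: measurable_funM.
move=> eps e0; have c0 : 0 < `|c| + 1 by rewrite ltr_wpDl.
have [n [n0 [b Hb]]] := Hg (eps / (`|c| + 1)) (divr_gt0 e0 c0).
exists n; split => //; exists (fun v => c * b v).
rewrite /dist1 (eq_integral (fun x => (`|c|)%:E * (`|g x - step n b x|)%:E)%E); last first.
  move=> x; rewrite inE => /incubeP xs.
  by rewrite -EFinM !step_cell// -normrM mulrBr.
have mC := measurable_cube (d := d) s.
have m1 := measurable_dist1 mg (measurable_step b n0).
rewrite ge0_integralZl//=.
apply: (@le_trans _ _ ((`|c|)%:E * (eps / (`|c| + 1))%:E)%E).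
  by apply: lee_wpmul2l => //; rewrite lee_fin.
rewrite -EFinM lee_fin mulrCA ger_pMr// ler_pdivrMr// mul1r.
by rewrite lerDl.
Qed.

Let approxD g1 g2 : approx g1 -> approx g2 -> approx (fun x => g1 x + g2 x).
Proof.
move=> [m1 H1] [m2 H2]; split; first exact: measurable_funD.
move=> eps e0; have e2 : 0 < eps / 2 by rewrite divr_gt0.
have [n1 [n10 [b1 Hb1]]] := H1 _ e2; have [n2 [n20 [b2 Hb2]]] := H2 _ e2.
exists (n1 * n2)%N; split; first by rewrite muln_gt0 n10.
exists (fun c => b1 (cdiv n2 c) + b2 (cdiv n1 c)).
rewrite [leRHS](_ : _ = (eps / 2)%:E + (eps / 2)%:E)%E; last by rewrite -EFinD; congr EFin; field.
apply: le_trans (leeD Hb1 Hb2).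
apply: le_trans (dist1_le m1 m2 (measurable_step b1 n10) (measurable_step b2 n20)).
rewrite le_eqVlt; apply/orP; left; apply/eqP; apply: eq_dist1 => x xs.
by rewrite !step_cell// cell_at_cdiv// [(n1 * n2)%N]mulnC cell_at_cdiv.
Qed.

Let approx_sum (I : Type) (r : seq I) (g : I -> pt -> R) : (forall i, approx (g i)) ->
  approx (fun x => \sum_(i <- r) g i x).
Proof.
move=> Hg; elim: r => [|i r IH].
  under eq_fun do rewrite big_nil.
  have := approxZ 0 (approx_indic measurable0).
  by congr approx; apply/funext => x; rewrite mul0r.
by under eq_fun do rewrite big_cons; exact: approxD.
Qed.

(** Simple functions are dense in L1, indicators are approximated by unions of cells, and sums are
    handled on a common refinement. *)
Lemma integrable_step_approx (f : pt -> R) eps : 0 < eps -> measurable_fun setT f ->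
  lam.-integrable (cube s) (EFin \o f) ->
  exists n, (0 < n)%N /\ exists b,
    (\int[lam]_(x in cube s) (`|f x - step n b x|)%:E <= eps%:E)%E.
Proof.
move=> e0 mf intf; have e2 : 0 < eps / 2 by rewrite divr_gt0.
have [g_ [intg _ gf]] := approximation_sfun_integrable (measurable_cube s) intf.
have [k Hk] : exists k, (dist1 f (g_ k) <= (eps / 2)%:E)%E.
  move: gf => /fine_cvgP[[k0 _ Hfin] /cvgrPdist_le /(_ _ e2)[k1 _ Hk1]].
  exists (maxn k0 k1); have := Hk1 (maxn k0 k1) (leq_maxr _ _).
  have := Hfin (maxn k0 k1) (leq_maxl _ _) => /= fin.
  rewrite sub0r normrN ger0_norm ?fine_ge0 ?integral_ge0//.
  by rewrite -lee_fin fineK.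
have [mg Hg] : approx (g_ k).
  rewrite (_ : (g_ k : pt -> R) = (fun x => \sum_(i < #|` fset_set (g_ k @` setT)|)
      (fset_set (g_ k @` setT))`_i * \1_(g_ k @^-1` [set (fset_set (g_ k @` setT))`_i]) x)).
    by apply: approx_sum => i; apply: approxZ; apply: approx_indic.
  by apply/funext => x; rewrite [LHS]fimfunEord.
have [n [n0 [b Hb]]] := Hg _ e2.
exists n; split => //; exists b.
rewrite [leRHS](_ : _ = (eps / 2)%:E + (eps / 2)%:E)%E; last by rewrite -EFinD; congr EFin; field.
apply: le_trans (leeD Hk Hb).
apply: le_trans (dist1_le mf mg mg (measurable_step b n0)).
rewrite le_eqVlt; apply/orP; left; apply/eqP; apply: eq_dist1 => x xs.
by ring.
Qed.

End step_approximation.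

(** * Grid laws that are uniform on coarse cells *)

Section boundary_fraction.
Context {R : realType} (d : nat).

Lemma card_cells_coord (K : nat) (i : 'I_d) (S : pred nat) :
  #|[pred c : {ffun 'I_d -> 'I_K} | S (c i)]| =
  (#|[pred j : 'I_K | S j]| * K ^ d.-1)%N.
Proof.
pose F (k : 'I_d) : pred 'I_K := if k == i then [pred j : 'I_K | S j] else predT.
rewrite (eq_card (B := mem (family F))); last first.
  move=> c; rewrite !inE; apply/idP/familyP => [Sc k|/(_ i)].
    by rewrite /F; case: eqP => [->|].
  by rewrite /F eqxx.
rewrite card_family foldrE big_map big_enum/= (bigD1 i)//= /F eqxx; congr muln.
rewrite (eq_bigr (fun=> K)); first by rewrite prod_nat_const cardC1 card_ord.
by move=> k /negPf ->; rewrite card_ord.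
Qed.

Lemma unif_coord (K : nat) (i : 'I_d) (S : pred nat) : (0 < K)%N ->
  unif d K (fun c => (S (c i))%:R) = #|[pred j : 'I_K | S j]|%:R / K%:R :> R.
Proof.
move=> K0; rewrite unifE// big_map big_enum/=.
rewrite (eq_bigr (fun c : {ffun 'I_d -> 'I_K} => (S (c i))%:R)); last first.
  by move=> c _; rewrite /cell_of ffunE.
rewrite -natr_sum -big_mkcond/= sum1_card card_cells_coord natrM.
have d0 : (0 < d)%N by apply: leq_ltn_trans (ltn_ord i).
rewrite -[in (K ^ d)%N](prednK d0) expnS natrM; field.
by rewrite !pnatr_eq0 -!lt0n K0 expn_gt0 K0.
Qed.

Definition boundary_cell (K w : nat) (c : cell d) : bool :=
  [exists i, (c i < w)%N || (K <= c i + w)%N].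

(** A union bound over the two layers of thickness [w] in each of the [d] directions. *)
Lemma unif_boundary_cell K w : (0 < K)%N ->
  unif d K (ind (boundary_cell K w)) <= d%:R * (2 * w%:R / K%:R) :> R.
Proof.
move=> K0; apply: (@le_trans _ _ (unif d K (fun c => \sum_(i < d)
    (((fun x => x < w)%N (c i))%:R + ((fun x => K <= x + w)%N (c i))%:R) : R))).
  apply: mean_le => c; rewrite /ind /boundary_cell; case: existsP => [[i]|_]; last first.
    by rewrite sumr_ge0// => i _; rewrite addr_ge0.
  rewrite (bigD1 i)//= => ci; apply: ler_wpDr; first by rewrite sumr_ge0// => j _; rewrite addr_ge0.
  by rewrite -natrD ler_nat; case/orP: ci => ->; rewrite ?leq_addr ?leq_addl.
rewrite mean_sum mulr_natl -[X in _ *+ X](card_ord d) -sumr_const.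
apply: ler_sum => i _.
rewrite meanD (unif_coord i (fun x => x < w)%N K0) (unif_coord i (fun x => K <= x + w)%N K0).
rewrite -mulrDl ler_pM2r ?invr_gt0 ?ltr0n//.
rewrite -natrD -natrM ler_nat mul2n -addnn; apply: leq_add.
  rewrite cardE -(size_map val) -[leqRHS](size_iota 0); apply: uniq_leq_size.
    by rewrite map_inj_uniq ?enum_uniq//; exact: val_inj.
  by move=> x /mapP[j + ->]; rewrite mem_enum inE mem_iota.
rewrite cardE -(size_map val) -[leqRHS](size_iota (K - w)); apply: uniq_leq_size.
  by rewrite map_inj_uniq ?enum_uniq//; exact: val_inj.
move=> x /mapP[j + ->]; rewrite mem_enum inE mem_iota => /= Kj.
by have := ltn_ord j; move: Kj; lia.
Qed.

End boundary_fraction.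

Section coarse_cells.
Context {R : realType} {d h : nat} (a : rel nat).
Hypotheses (d_gt0 : (0 < d)%N) (h_gt0 : (0 < h)%N) (a_conn : index_connected h a).
Local Notation npk := (@npk R h a _).
Variables (n0 K : nat) (B : pred (cell d)) (delta : R).
Hypotheses (n0_gt0 : (0 < n0)%N) (K_gt0 : (0 < K)%N) (delta_gt0 : 0 < delta).

Definition good_cells : seq (cell d) := seq.filter (predC B) (cells d n0).
Definition bad_cells : seq (cell d) := seq.filter B (cells d n0).
(* The cells in [B] are merged into the single class [None]. *)
Definition coarse (c : cell d) : option (cell d) :=
  if B (cdiv K c) then None else Some (cdiv K c).

(** Near cells have gap at most [delta^-1] in each coordinate; one more gives the difference of the
    indices, and another makes the bound strict. *)
Definition reach : nat := (Num.truncn delta^-1).+2.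

(** Only blocks outside [B] have exposed cells: near cells in two blocks of [B] are in the same
    class anyway, and any other near pair from different blocks includes an exposed cell. *)
Definition exposed (c : cell d) : bool :=
  ~~ B (cdiv K c) && boundary_cell K reach [ffun i => (c i %% K)%N].

Lemma near_reach (b c : cell d) i : near_cells delta b c ->
  ((b i - c i) + (c i - b i) < reach)%N.
Proof.
move=> bc; rewrite /reach.
suff : (gap (b i) (c i) <= Num.truncn delta^-1)%N by rewrite /gap; lia.
rewrite Num.Theory.truncn_ge_nat ?invr_ge0 ?(ltW delta_gt0)// -(ler_pM2l delta_gt0) mulfV ?gt_eqF//.
have H : (delta * (gap (b i) (c i))%:R) ^+ 2 <= 1.
  apply: le_trans bc; rewrite (bigD1 i)//= lerDl.
  by apply: sumr_ge0 => j _; exact: sqr_ge0.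
have P : 0 <= delta * (gap (b i) (c i))%:R by rewrite mulr_ge0// ltW.
by rewrite -(ler_pXn2r (n := 2))// ?nnegrE// expr1n.
Qed.

Lemma near_interior (b c : cell d) : ~~ boundary_cell K reach [ffun i => (b i %% K)%N] ->
  near_cells delta b c -> cdiv K b = cdiv K c.
Proof.
rewrite negb_exists => /forallP H bc; apply/ffunP => i; rewrite !ffunE.
have := H i; rewrite ffunE negb_or -!leqNgt -ltnNge => /andP[r1 r2].
have H2 := near_reach i bc; have E := divn_eq (b i) K; move: r1 r2 H2 E.
move: (b i %% K)%N (b i %/ K)%N => r q; move: (b i) => x r1 r2 H2 E.
suff /andP[y1 y2] : (q * K <= c i < q.+1 * K)%N.
  by apply/eqP; rewrite eqn_leq; apply/andP; split; [rewrite leq_divRL|rewrite -ltnS ltn_divLR].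
rewrite mulSn; move: r1 r2 H2 E; move: (q * K)%N (c i) reach => y z m; lia.
Qed.

Lemma coarse_near (b c : cell d) : ~~ exposed b -> ~~ exposed c ->
  near_cells delta b c -> coarse b = coarse c.
Proof.
have ex x : ~~ exposed x -> B (cdiv K x) || ~~ boundary_cell K reach [ffun i => (x i %% K)%N].
  by rewrite /exposed; case: (B _) => //=.
move=> /ex Hb /ex Hc bc; rewrite /coarse.
have [Bb|nBb] := boolP (B (cdiv K b)); have [Bc|nBc] := boolP (B (cdiv K c)) => //.
- case/orP: Hc => [Bc|Hc]; first by rewrite Bc in nBc.
  move: bc; rewrite near_cellsC => /(near_interior Hc) E.
  by move: nBc; rewrite E Bb.
- case/orP: Hb => [Bb|Hb]; first by rewrite Bb in nBb.
  by move: nBb; rewrite (near_interior Hb bc) Bc.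
- case/orP: Hb => [Bb|Hb]; first by rewrite Bb in nBb.
  by rewrite (near_interior Hb bc).
Qed.

Lemma coarse_keys_uniq : uniq (None :: [seq Some Q | Q <- good_cells]).
Proof.
rewrite /= map_inj_uniq; last by move=> ? ? [].
by rewrite filter_uniq ?cells_uniq// andbT; apply/mapP => -[].
Qed.

Lemma coarse_mem (c : cell d) : c \in cells d (n0 * K) ->
  coarse c \in (None :: [seq Some Q | Q <- good_cells]).
Proof.
rewrite mem_cells => /forallP cn; rewrite /coarse; case: ifPn => // nB.
rewrite inE/= map_f// mem_filter/= nB/= mem_cells; apply/forallP => i.
by rewrite ffunE ltn_divLR.
Qed.

Lemma npk_coarse_ge (l : seq (cell d)) :
  npk (near_cells delta) (seq.filter (fun c => coarse c == None) l) +
  \sum_(Q <- good_cells) npk (near_cells delta) (seq.filter (fun c => coarse c == Some Q) l) <=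
  npk (near_cells delta) l.
Proof.
rewrite /npk -natr_sum -natrD ler_nat.
by have := pk_key_ge a coarse (near_cells delta) h_gt0 l coarse_keys_uniq; rewrite big_cons big_map; apply.
Qed.

(** Deleting the exposed points costs at most one each, and no edges remain between different
    classes. *)
Lemma npk_coarse_le (l : seq (cell d)) : all (mem (cells d (n0 * K))) l ->
  npk (near_cells delta) l <=
  npk (near_cells delta) (seq.filter (fun c => coarse c == None) l) +
  \sum_(Q <- good_cells) npk (near_cells delta) (seq.filter (fun c => coarse c == Some Q) l) +
  (count exposed l)%:R.
Proof.
move=> /allP lc; rewrite /npk -natr_sum -!natrD ler_nat.
pose l' := seq.filter (predC exposed) l.
apply: leq_trans (_ : pk h a (near_cells delta) l' + count exposed l <= _)%N.
  have := pk_filter_count a h_gt0 (near_cells delta) (predC exposed) l.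
  by rewrite (@seq.eq_count _ (predC (predC exposed)) exposed)// => x /=; rewrite negbK.
rewrite leq_add2r.
have := pk_key_le (kappa := coarse) (e := near_cells delta) (s := l') h_gt0 a_conn coarse_keys_uniq _ _.
rewrite big_cons big_map => H; apply: leq_trans (H _ _) _.
- by move=> x; rewrite mem_filter => /andP[_ /lc]; exact: coarse_mem.
- move=> x y; rewrite !mem_filter => /andP[/= nx _] /andP[/= ny _]; exact: coarse_near.
have F (P : pred (cell d)) : (pk h a (near_cells delta) (seq.filter P l') <=
    pk h a (near_cells delta) (seq.filter P l))%N.
  rewrite /l' -filter_predI (eq_filter (a2 := predI (predC exposed) P)).
    by rewrite filter_predI pk_filter_le.
  by move=> x /=; rewrite andbC.
by apply: leq_add; [exact: F|apply: leq_sum => Q _; exact: F].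
Qed.

(* The points in a block of [K2 ^ d] cells form a clique, so a packing can use
   all but fewer than [h] of them. *)
Lemma npk_clump_ge (K1 K2 : nat) (l : seq (cell d)) : (0 < K1)%N -> (0 < K2)%N ->
  K = (K1 * K2)%N -> d%:R * (delta * K2%:R) <= 1 -> all (mem (cells d (n0 * K))) l ->
  (count (fun c => coarse c == None) l)%:R / h%:R - (size bad_cells * K1 ^ d)%:R <=
  npk (near_cells delta) (seq.filter (fun c => coarse c == None) l).
Proof.
move=> K10 K20 KE dK /allP lc.
have h0 : 0 < h%:R :> R by rewrite ltr0n.
rewrite lerBlDr ler_pdivrMr// mulrDl /npk -!natrM -natrD ler_nat -size_filter.
set l' := seq.filter _ l.
pose ks := [seq comb K1 Q c | Q <- bad_cells, c <- cells d K1].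
have -> : (size bad_cells * K1 ^ d)%N = size ks by rewrite size_allpairs size_cells.
rewrite mulnC [(size ks * h)%N]mulnC.
apply: (@pk_clique_key h a _ _ (cdiv K2)) => //.
- apply: allpairs_uniq; rewrite ?filter_uniq ?cells_uniq//.
  move=> [Q c] [Q' c'] /allpairsP[[Q1 c1] [/= Q1n c1n [-> ->]]].
  move=> /allpairsP[[Q2 c2] [/= Q2n c2n [-> ->]]] E.
  have E1 : Q1 = Q2 by rewrite -(cdiv_comb Q1 c1n) -(cdiv_comb Q2 c2n) E.
  subst Q2; congr (_, _); apply/ffunP => i.
  by move/ffunP/(_ i): E; rewrite !ffunE => /addnI.
- move=> c; rewrite mem_filter => /andP[+ /lc]; rewrite /coarse /=; case: ifPn => // Bc _.
  rewrite mem_cells => /forallP cn; apply/allpairsP.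
  exists (cdiv K c, [ffun i => (c i %/ K2) %% K1]%N); split => /=.
  + rewrite mem_filter Bc mem_cells; apply/forallP => i.
    by rewrite ffunE ltn_divLR// cn.
  + by rewrite mem_cells; apply/forallP => i; rewrite ffunE ltn_mod.
  + by apply/ffunP => i; rewrite !ffunE KE [(K1 * K2)%N]mulnC divnMA -divn_eq.
- move=> x y _ _ xy; rewrite /near_cells.
  have dK2 : 0 <= delta * K2%:R by rewrite mulr_ge0// ltW.
  have d0 : 1 <= d%:R :> R by rewrite ler1n.
  apply: (@le_trans _ _ (\sum_(i < d) (delta * K2%:R) ^+ 2)).
    apply: ler_sum => i _; rewrite lerXn2r ?nnegrE ?mulr_ge0 ?(ltW delta_gt0)//.
    rewrite ler_pM2l// ler_nat /gap; move/ffunP/(_ i): xy; rewrite !ffunE => E.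
    have := divn_eq (x i) K2; have := divn_eq (y i) K2; rewrite E.
    have := ltn_pmod (x i) K20; have := ltn_pmod (y i) K20.
    move: (x i %% K2)%N (y i %% K2)%N (y i %/ K2 * K2)%N => p q r.
    by move: (x i) (y i) => xi yi; lia.
  rewrite sumr_const card_ord -mulr_natl; nra.
Qed.

End coarse_cells.

(** * Sample means for laws uniform on coarse cells *)

Section block_means.
Context {R : realType} {d h : nat} (a : rel nat).
Hypotheses (d_gt0 : (0 < d)%N) (h_gt0 : (0 < h)%N) (a_conn : index_connected h a).
Local Notation npk := (@npk R h a _).
Variables (n0 K : nat) (B : pred (cell d)) (s : R).
Hypotheses (n0_gt0 : (0 < n0)%N) (K_gt0 : (0 < K)%N) (s_gt0 : 0 < s).
Variables (M : mean R (option (cell d))) (m : cell d -> R).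

Definition olift (P : pred (cell d)) : pred (option (cell d)) :=
  fun v => if v is Some c then P c else false.

Let inQ (Q : cell d) : pred (option (cell d)) := olift (fun c => coarse K B c == Some Q).
Let inB : pred (option (cell d)) := olift (fun c => coarse K B c == None).

Hypothesis M_supp : forall i, mpt (m := M) i \in ocells (d := d) (n0 * K).
Hypothesis M_block : forall Q, Q \in good_cells n0 B -> forall f : option (cell d) -> R,
  M (fun v => ind (inQ Q) v * f v) = m Q * unif d K (fun c => f (Some (comb K Q c))).

Let delta := s / K%:R.
Let delta_gt0 : 0 < delta. Proof. by rewrite divr_gt0// ltr0n. Qed.

Lemma filter_pmap (P : pred (cell d)) (l : seq (option (cell d))) :
  seq.filter P (pmap idfun l) = pmap idfun (seq.filter (olift P) l).
Proof. by elim: l => //= -[c|] l IH //=; case: (P c) => /=; rewrite IH. Qed.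

Lemma count_pmap (P : pred (cell d)) (l : seq (option (cell d))) :
  count P (pmap idfun l) = count (olift P) l.
Proof. by elim: l => //= -[c|] l IH //=; rewrite IH. Qed.

Lemma pmap_ocells (l : seq (option (cell d))) :
  all (mem (ocells (d := d) (n0 * K))) l -> all (mem (cells d (n0 * K))) (pmap idfun l).
Proof.
elim: l => //= -[c|] l IH /andP[cn /IH]//= ->; rewrite andbT.
by move: cn; rewrite /ocells inE/= mem_map// => ? ? [].
Qed.

Lemma block_mass Q : Q \in good_cells n0 B -> M (ind (inQ Q)) = m Q.
Proof.
move=> Qg; have := M_block Qg (fun=> 1); rewrite mean_cst mulr1 => <-.
by apply: eq_mean => v; rewrite mulr1.
Qed.

(** The error of [iid_count_approx] when a count of mean [n * q] is replaced by [k]; [del] is the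
    free parameter there. *)
Definition count_err (n : nat) (q del : R) (k : nat) : R :=
  del + (n%:R * q + (n%:R * q - k%:R) ^+ 2) / del.

(** By [M_block] the points in block [Q] are uniform given their number; in units of the radius the
    block is a cube of side [s] cut into [K ^ d] cells. *)
Lemma block_packing n Q k del : 0 < del -> Q \in good_cells n0 B ->
  `|iid M n (fun l => npk (near_cells delta) (seq.filter (fun c => coarse K B c == Some Q)
      (pmap idfun l))) - psi_grid d h a K k s| <= count_err n (m Q) del k.
Proof.
move=> del0 Qg.
rewrite (@eq_mean _ _ _ _ (fun l => grid_pk a (h := h) delta (seq.filter (inQ Q) l))); last first.
  by move=> l; rewrite filter_pmap.
rewrite (@iid_filter _ _ M (mean_map (Some \o comb K Q) (unif d K))); last first.
  by move=> f; rewrite mean_mapE block_mass// M_block.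
rewrite (@eq_mean _ _ _ _ (fun l => psi_grid d h a K (count (inQ Q) l) s)); last first.
  move=> l; rewrite iid_map; apply: eq_mean => w; rewrite /grid_pk /npk; congr (_%:R).
  rewrite map_comp (_ : pmap idfun _ = map (comb K Q) w); last first.
    by elim: (w) => //= x w' ->.
  by apply: pk_map => // x y _ _; rewrite near_comb.
rewrite /count_err -(block_mass Qg).
by apply: (@iid_count_approx _ _ M (inQ Q) n (fun j => psi_grid d h a K j s)) => // j; exact: psi_grid_steps.
Qed.

Lemma sum_block_mass : \sum_(Q <- good_cells n0 B) m Q <= 1.
Proof.
rewrite big_seq (eq_bigr (fun Q => M (ind (inQ Q)))) => [|Q Qg]; last by rewrite block_mass.
rewrite -big_seq -mean_sum -(mean_cst M 1); apply: mean_le => v.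
rewrite /ind /inQ; case: v => [c|]; last by rewrite big1 ?ler01.
rewrite /olift; case: (coarse K B c) => [Q|]; last by rewrite big1 ?ler01.
have [Qg|Qg] := boolP (Q \in good_cells n0 B); last first.
  rewrite big_seq big1 ?ler01// => Q' Q'g; case: eqP => // -[E].
  by rewrite E Q'g in Qg.
rewrite (bigD1_seq Q)//= ?filter_uniq ?cells_uniq// eqxx big1 ?addr0// => Q' QQ'.
by case: eqP => // -[E]; rewrite E eqxx in QQ'.
Qed.

(** In each good block a fraction of at most [2 * d * reach / K] is exposed, while
    [reach <= delta^-1 + 2] and [delta * K = s]. *)
Lemma exposed_mass :
  M (ind (olift (exposed K B delta))) <= 2 * d%:R * (s^-1 + 2 / K%:R).
Proof.
set w := reach delta; set b := fun v : option (cell d) => ind (olift (fun c =>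
  boundary_cell K w [ffun i => (c i %% K)%N])) v : R.
apply: (@le_trans _ _ (M (fun v => \sum_(Q <- good_cells n0 B) ind (inQ Q) v * b v))).
  apply: ler_sum => i _; apply: ler_wpM2l; first exact: mwt_ge0.
  have := M_supp i; case: (mpt i) => [c|_]; last first.
    by rewrite /ind/=; apply: sumr_ge0 => Q _; rewrite mulr_ge0 ?ler0n.
  rewrite /ocells inE/= mem_map; last by move=> ? ? [].
  move=> cn; rewrite /ind /= /exposed; have [Bc|nBc] := boolP (B (cdiv K c)).
    by apply: sumr_ge0 => Q _; rewrite mulr_ge0 ?ler0n.
  have cg : cdiv K c \in good_cells n0 B.
    rewrite mem_filter /= nBc mem_cells; apply/forallP => j.
    by rewrite ffunE ltn_divLR//; move: cn; rewrite mem_cells => /forallP.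
  rewrite (bigD1_seq (cdiv K c))//= ?filter_uniq ?cells_uniq//.
  rewrite /coarse (negPf nBc) eqxx mul1r lerDl.
  by apply: sumr_ge0 => Q _; rewrite mulr_ge0 ?ler0n.
rewrite mean_sum big_seq.
have K0 : 0 < K%:R :> R by rewrite ltr0n.
have bnd0 : 0 <= 2 * d%:R * (s^-1 + 2 / K%:R).
  by rewrite mulr_ge0// addr_ge0 ?invr_ge0 ?divr_ge0// ltW.
apply: (@le_trans _ _ (\sum_(Q <- good_cells n0 B | Q \in good_cells n0 B)
    m Q * (2 * d%:R * (s^-1 + 2 / K%:R)))); last first.
  by rewrite -big_seq -mulr_suml ler_piMl// sum_block_mass.
apply: ler_sum => Q Qg; rewrite M_block//.
have mQ : 0 <= m Q by rewrite -block_mass// mean_ge0// => v; rewrite /ind.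
apply: ler_wpM2l => //.
rewrite (@eq_unif _ _ _ _ (ind (boundary_cell K w))) => //; last first.
  move=> c; rewrite mem_cells => /forallP cK; rewrite /b /ind /=; congr ((nat_of_bool (boundary_cell _ _ _))%:R).
  by apply/ffunP => i; rewrite !ffunE modnMDl modn_small.
apply: le_trans (unif_boundary_cell _ _ _) _ => //.
rewrite [leRHS](_ : _ = d%:R * (2 * (s^-1 + 2 / K%:R))); last by ring.
rewrite ler_wpM2l// -mulrA ler_pM2l// ler_pdivrMr//.
have -> : (s^-1 + 2 / K%:R) * K%:R = delta^-1 + 2 by rewrite /delta; field; rewrite !gt_eqF.
rewrite /w /reach -addn2 natrD lerD2r.
have d'0 : 0 <= delta^-1 by rewrite invr_ge0 ltW.
by have /andP[] := Num.Theory.truncn_itv d'0.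
Qed.

(** The merged class contributes at most its number of points over [h], each good block its uniform
    mean, and the exposed points at most one each. *)
Lemma iid_grid_pk_le n (k : cell d -> nat) del : 0 < del ->
  iid M n (grid_pk a (h := h) delta) <=
  \sum_(Q <- good_cells n0 B) (psi_grid d h a K (k Q) s + count_err n (m Q) del (k Q)) +
  n%:R * M (ind inB) / h%:R + n%:R * (2 * d%:R * (s^-1 + 2 / K%:R)).
Proof.
move=> del0; have h0 : 0 < h%:R :> R by rewrite ltr0n.
apply: (@le_trans _ _ (iid M n (fun l =>
  \sum_(Q <- good_cells n0 B) npk (near_cells delta) (seq.filter (fun c => coarse K B c == Some Q)
      (pmap idfun l)) + (count inB l)%:R / h%:R + (count (olift (exposed K B delta)) l)%:R))).
  apply: (iid_le_supp (S := mem (ocells (d := d) (n0 * K)))) => // l sl lS.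
  apply: le_trans (npk_coarse_le d_gt0 h_gt0 a_conn B n0_gt0 K_gt0 delta_gt0 (pmap_ocells lS)) _.
  rewrite count_pmap lerD2r [leLHS]addrC lerD2l ler_pdivlMr// mulrC.
  apply: le_trans (npk_size _ _ _ _) _.
  by rewrite size_filter count_pmap.
rewrite !meanD meanZr !iid_count; apply: lerD; last first.
  by rewrite ler_wpM2l// exposed_mass.
rewrite lerD2r mean_sum big_seq [leRHS]big_seq; apply: ler_sum => Q Qg.
have := block_packing n (k Q) del0 Qg; rewrite ler_norml => /andP[_].
by rewrite lerBlDl.
Qed.

(** As [d * s <= K1], the [K1 ^ d] parts of a bad block are cliques, each of which wastes at most
    [h] points, the worth of one member of the packing. *)
Lemma iid_grid_pk_ge n (k : cell d -> nat) del (K1 K2 : nat) : 0 < del ->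
  (0 < K1)%N -> (0 < K2)%N -> K = (K1 * K2)%N -> d%:R * s <= K1%:R ->
  \sum_(Q <- good_cells n0 B) (psi_grid d h a K (k Q) s - count_err n (m Q) del (k Q)) +
  n%:R * M (ind inB) / h%:R - (size (bad_cells n0 B) * K1 ^ d)%:R <=
  iid M n (grid_pk a (h := h) delta).
Proof.
move=> del0 K10 K20 KE dK; have h0 : 0 < h%:R :> R by rewrite ltr0n.
apply: (@le_trans _ _ (iid M n (fun l =>
  \sum_(Q <- good_cells n0 B) npk (near_cells delta) (seq.filter (fun c => coarse K B c == Some Q)
      (pmap idfun l)) + ((count inB l)%:R / h%:R - (size (bad_cells n0 B) * K1 ^ d)%:R)))); last first.
  apply: (iid_le_supp (S := mem (ocells (d := d) (n0 * K)))) => // l sl lS.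
  apply: le_trans (npk_coarse_ge a h_gt0 n0 K B delta _).
  rewrite [leRHS]addrC lerD2l.
  have dK2 : d%:R * (delta * K2%:R) <= 1.
    rewrite /delta KE natrM.
    rewrite (_ : d%:R * _ = d%:R * s / K1%:R); last by field; rewrite !pnatr_eq0 -!lt0n K10.
    by rewrite ler_pdivrMr ?ltr0n// mul1r.
  have := npk_clump_ge a d_gt0 h_gt0 B n0_gt0 K_gt0 delta_gt0 K10 K20 KE dK2 (pmap_ocells lS).
  by rewrite count_pmap; apply.
rewrite !meanD meanN mean_cst meanZr iid_count addrA !lerD2r.
rewrite mean_sum big_seq [leRHS]big_seq; apply: ler_sum => Q Qg.
have := block_packing n (k Q) del0 Qg; rewrite ler_norml => /andP[+ _].
by rewrite lerBrDl.
Qed.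

End block_means.

(** * The mean packing number of a sample *)

Section regions.
Context {R : realType} {d : nat}.
Local Notation pt := (d.-tuple R).
Variable s : R.
Hypothesis s0 : 0 < s.

Definition region n (P : pred (cell d)) : set pt :=
  [set x | incube s x /\ P (cell_at s n x)].

Lemma measurable_region n P : (0 < n)%N -> measurable (region n P).
Proof.
move=> n0; have := measurable_ocell_pred s0 (olift P) n0.
by congr measurable; apply/seteqP; split => x; rewrite /region /ocell /=;
  case: ifP => xs //= => -[].
Qed.

Lemma region_cells n P : (0 < n)%N ->
  \big[setU/set0]_(c <- [seq c <- cells d n | P c]) cell_set s n c = region n P.
Proof.
move=> n0; rewrite -bigcup_seq; apply/seteqP; split => x /=.
  move=> [c /=]; rewrite mem_filter => /andP[Pc cn].
  by rewrite -(ocell_Some s0 n0 cn) /ocell /=; case: ifP => // xs [E]; split; rewrite ?E.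
move=> [xs Px]; have cn := cell_at_cells s0 n0 xs.
exists (cell_at s n x); first by rewrite /= mem_filter Px.
by rewrite -(ocell_Some s0 n0 cn) /= /ocell xs.
Qed.

Lemma trivIset_cells n P : (0 < n)%N ->
  trivIset [set` [seq c <- cells d n | P c]] (cell_set (d := d) s n).
Proof.
move=> n0; apply/trivIsetP => b c /=; rewrite !mem_filter => /andP[_ bn] /andP[_ cn] bc.
apply/seteqP; split => // x [].
rewrite -(ocell_Some s0 n0 bn) -(ocell_Some s0 n0 cn) /= => -> [E].
by rewrite E eqxx in bc.
Qed.

Lemma cells_integral (rho : {measure set pt -> \bar R}) n P (g : pt -> \bar R) : (0 < n)%N ->
  measurable_fun setT g -> (forall x, (0 <= g x)%E) ->
  (\int[rho]_(x in region n P) g x =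
  \sum_(c <- [seq c <- cells d n | P c]) \int[rho]_(x in cell_set s n c) g x)%E.
Proof.
move=> n0 mg g0; rewrite -(region_cells P n0) ge0_integral_bigsetU//.
- by move=> c; exact: measurable_cell_set.
- by rewrite filter_uniq ?cells_uniq.
- exact: trivIset_cells.
- exact: measurable_funTS.
Qed.

Lemma cells_measure (rho : {measure set pt -> \bar R}) n P : (0 < n)%N ->
  (rho (region n P) = \sum_(c <- [seq c <- cells d n | P c]) rho (cell_set s n c))%E.
Proof.
move=> n0; have := cells_integral rho P (g := fun=> 1%E) n0 (measurable_cst _) (fun=> lee01).
rewrite integral_cst ?mul1e; last exact: measurable_region.
by move=> ->; apply: eq_bigr => c _; rewrite integral_cst ?mul1e//; exact: measurable_cell_set.
Qed.

Lemma region_cdiv n k P : (0 < n)%N -> (0 < k)%N ->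
  region (n * k) (fun c => P (cdiv k c)) = region n P.
Proof.
move=> n0 k0; apply/seteqP; split => x [xs Px]; split => //.
  by move: Px; rewrite cell_at_cdiv.
by rewrite cell_at_cdiv.
Qed.

Lemma region_cell n c : (0 < n)%N -> c \in cells d n -> region n (pred1 c) = cell_set s n c.
Proof.
move=> n0 cn; rewrite -(ocell_Some s0 n0 cn); apply/seteqP; split => x /=.
  by move=> [xs /eqP <-]; rewrite /ocell xs.
by rewrite /region /ocell /=; case: ifP => // xs [->].
Qed.

Lemma cell_set_step n c b x : (0 < n)%N -> c \in cells d n -> cell_set s n c x ->
  step s n b x = b c.
Proof. by move=> n0 cn; rewrite -(ocell_Some s0 n0 cn) /step /= => ->. Qed.

Lemma cells_comb_filter n k (P : pred (cell d)) (F : cell d -> R) : (0 < n)%N -> (0 < k)%N ->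
  \sum_(c <- [seq c <- cells d (n * k) | P (cdiv k c)]) F c =
  \sum_(Q <- [seq Q <- cells d n | P Q]) \sum_(c <- cells d k) F (comb k Q c).
Proof.
move=> n0 k0; rewrite !big_filter big_mkcond (perm_big _ (cells_comb d n k0))/=.
rewrite big_allpairs_dep/= [RHS]big_mkcond/=; apply: eq_bigr => Q _.
case: ifPn => PQ; last first.
  by rewrite big_seq big1// => c ck; rewrite cdiv_comb// (negPf PQ).
by rewrite big_seq [RHS]big_seq; apply: eq_bigr => c ck; rewrite cdiv_comb// PQ.
Qed.

End regions.

Section density_decomposition.
Context {R : realType} {d : nat}.
Local Notation pt := (d.-tuple R).
Local Notation lam := (@lebesgue_tuple R d).
Variables (mu : probability pt R) (f : pt -> R) (mu_perp : {measure set pt -> \bar R}).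
Hypotheses (mf : measurable_fun setT f) (f0 : forall x, 0 <= f x)
  (muE : forall A, measurable A -> mu A = (\int[lam]_(x in A) (f x)%:E + mu_perp A)%E).

Lemma density_le A : measurable A -> (\int[lam]_(x in A) (f x)%:E <= mu A)%E.
Proof. by move=> mA; rewrite muE// leeDl. Qed.

Lemma perp_le A : measurable A -> (mu_perp A <= mu A)%E.
Proof. by move=> mA; rewrite muE// leeDr// integral_ge0// => x _; rewrite lee_fin. Qed.

Lemma mu_fin A : measurable A -> (mu A < +oo)%E.
Proof. by move=> mA; apply: le_lt_trans (probability_le1 mu mA) _; rewrite ltry. Qed.

Lemma perp_fin A : measurable A -> (mu_perp A < +oo)%E.
Proof. by move=> mA; exact: le_lt_trans (perp_le mA) (mu_fin mA). Qed.

Lemma density_integrable A : measurable A -> lam.-integrable A (EFin \o f).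
Proof.
move=> mA; apply/integrableP; split; first exact/measurable_EFinP/measurable_funTS.
rewrite (eq_integral (EFin \o f)) => [|x _]; last by rewrite /= ger0_norm.
by apply: le_lt_trans (density_le mA) (mu_fin mA).
Qed.

Lemma fine_muE A : measurable A ->
  fine (mu A) = \int[lam]_(x in A) f x + fine (mu_perp A).
Proof.
move=> mA; rewrite muE// fineD//.
  exact/integrable_fin_num/density_integrable.
by rewrite ge0_fin_numE// perp_fin.
Qed.

Variable s : R.
Hypothesis s0 : 0 < s.

(** The absolutely continuous part deviates by at most the L1 error of the step function, the
    singular part by its mass. *)
Lemma cell_density_error n b c : (0 < n)%N -> c \in cells d n ->
  ((`|fine (mu (cell_set s n c)) - b c * (s / n%:R) ^+ d|)%:E <=
  \int[lam]_(x in cell_set s n c) (`|f x - step s n b x|)%:E + mu_perp (cell_set s n c))%E.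
Proof.
move=> n0 cn; have mc := measurable_cell_set s n c.
have fc := lebesgue_cell_set s0 n0 c.
have intb : lam.-integrable (cell_set s n c) (EFin \o (fun=> b c)).
  apply: measurable_bounded_integrable => //.
    by apply: (@le_lt_trans _ _ ((s / n%:R) ^+ d)%:E); [rewrite -fc|exact: ltry].
  exists `|b c|; split; first exact: num_real.
  by move=> x bx w _; exact: ltW.
have intf := density_integrable mc.
rewrite fine_muE//.
have -> : b c * (s / n%:R) ^+ d = \int[lam]_(x in cell_set s n c) b c.
  by rewrite Rintegral_cst//; congr (_ * _); exact: (congr1 fine (esym fc)).
rewrite addrAC -RintegralB//.
apply: (@le_trans _ _ (`|\int[lam]_(x in cell_set s n c) (f x - b c)| + fine (mu_perp (cell_set s n c)))%:E).
  by rewrite lee_fin; apply: le_trans (ler_normD _ _) _; rewrite lerD2l ger0_norm.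
rewrite EFinD fineK; last by rewrite ge0_fin_numE// perp_fin.
apply: leeD => //.
have intfb : lam.-integrable (cell_set s n c) (EFin \o (fun x => f x - b c)).
  by have := integrableB mc intf intb; congr integrable.
apply: le_trans (_ : ((\int[lam]_(x in cell_set s n c) `|f x - b c|)%:E <= _)%E).
  by rewrite lee_fin; exact: le_normr_Rintegral.
rewrite /Rintegral fineK.
  rewrite le_eqVlt; apply/orP; left; apply/eqP; apply: eq_integral => x.
  by rewrite inE => xc; rewrite (cell_set_step s0 b n0 cn xc).
by apply: integrable_fin_num => //; have := integrable_norm intfb.
Qed.

Lemma region_density_error n b P : (0 < n)%N ->
  ((\sum_(c <- [seq c <- cells d n | P c])
     `|fine (mu (cell_set s n c)) - b c * (s / n%:R) ^+ d|)%:E <=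
  \int[lam]_(x in region s n P) (`|f x - step s n b x|)%:E + mu_perp (region s n P))%E.
Proof.
move=> n0; rewrite cells_measure// cells_integral//; first last.
- by apply/measurable_EFinP/measurableT_comp => //; apply: measurable_funB => //; exact: measurable_step.
rewrite -big_split/= -sumEFin big_seq [leRHS]big_seq; apply: lee_sum => c.
by rewrite mem_filter => /andP[_ cn]; exact: cell_density_error.
Qed.

End density_decomposition.

(** * Averaging the law over coarse cells *)

Section averaged_law.
Context {R : realType} {d : nat}.
Local Notation pt := (d.-tuple R).
Variables (mu : probability pt R) (s : R) (n0 K : nat) (B : pred (cell d)).
Hypotheses (s0 : 0 < s) (n0_gt0 : (0 < n0)%N) (K_gt0 : (0 < K)%N).

Definition cell_mass n (c : cell d) : R := fine (mu (cell_set s n c)).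

Lemma cell_mass_ge0 n c : 0 <= cell_mass n c.
Proof. by apply: fine_ge0; exact: measure_ge0. Qed.

Let nK_gt0 : (0 < n0 * K)%N. Proof. by rewrite muln_gt0 n0_gt0. Qed.

Lemma cell_mass_fin n c : (cell_mass n c)%:E = mu (cell_set s n c).
Proof.
rewrite fineK// ge0_fin_numE// (le_lt_trans (probability_le1 mu _)) ?ltry//.
exact: measurable_cell_set.
Qed.

Lemma region_mass n P : (0 < n)%N ->
  fine (mu (region s n P)) = \sum_(c <- [seq c <- cells d n | P c]) cell_mass n c.
Proof.
move=> n_gt0; rewrite cells_measure//.
rewrite (eq_bigr (fun c => (cell_mass n c)%:E)) => [|c _]; last by rewrite cell_mass_fin.
by rewrite sumEFin.
Qed.

Lemma sum_subcell_mass Q : Q \in cells d n0 ->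
  \sum_(c <- cells d K) cell_mass (n0 * K) (comb K Q c) = cell_mass n0 Q.
Proof.
move=> Qn; rewrite /cell_mass -(region_cell s0 n0_gt0 Qn) -(region_cdiv s0 _ n0_gt0 K_gt0).
rewrite region_mass// (cells_comb_filter (pred1 Q))//.
rewrite (_ : [seq x <- _ | _] = [:: Q]) ?big_seq1//.
by rewrite filter_pred1_uniq ?cells_uniq.
Qed.

Lemma big_ocells (F : option (cell d) -> R) :
  \sum_(v <- ocells (n0 * K)) F v =
  F None + \sum_(Q <- cells d n0) \sum_(c <- cells d K) F (Some (comb K Q c)).
Proof.
rewrite /ocells big_cons big_map; congr (_ + _).
have := cells_comb_filter xpredT (fun c => F (Some c)) n0_gt0 K_gt0.
by rewrite !filter_predT.
Qed.

Lemma grid_lawE (N_gt0 : (0 < n0 * K)%N) f : grid_law mu s0 N_gt0 f =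
  fine (mu (~` cube s)) * f None + \sum_(Q <- cells d n0) \sum_(c <- cells d K)
    cell_mass (n0 * K) (comb K Q c) * f (Some (comb K Q c)).
Proof.
rewrite law_sumE big_ocells ocell_None; congr (_ + _).
rewrite big_seq [RHS]big_seq; apply: eq_bigr => Q Qn.
rewrite big_seq [RHS]big_seq; apply: eq_bigr => c cK; rewrite ocell_Some//.
rewrite (perm_mem (cells_comb d n0 K_gt0)); apply/allpairsP; by exists (Q, c).
Qed.

(* Outside [B], the mass of each coarse cell is spread uniformly over its subcells. *)
Definition avg_weight (v : option (cell d)) : R :=
  if v is Some c then
    if B (cdiv K c) then cell_mass (n0 * K) c else cell_mass n0 (cdiv K c) / (K ^ d)%:R
  else fine (mu (~` cube s)).

Fact avg_weight_ge0 v : 0 <= avg_weight v.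
Proof.
case: v => [c|] /=; last by apply: fine_ge0; exact: measure_ge0.
by case: ifP => _; rewrite ?divr_ge0 ?cell_mass_ge0.
Qed.

Lemma avg_weight_comb Q c : c \in cells d K -> avg_weight (Some (comb K Q c)) =
  if B Q then cell_mass (n0 * K) (comb K Q c) else cell_mass n0 Q / (K ^ d)%:R.
Proof. by move=> cK; rewrite /avg_weight cdiv_comb. Qed.

Let Kd_neq0 : (K ^ d)%:R != 0 :> R.
Proof. by rewrite pnatr_eq0 -lt0n expn_gt0 K_gt0. Qed.

Lemma sum_avg_weight Q : Q \in cells d n0 ->
  \sum_(c <- cells d K) avg_weight (Some (comb K Q c)) = cell_mass n0 Q.
Proof.
move=> Qn; rewrite big_seq (eq_bigr _ (fun c cK => avg_weight_comb Q cK)) -big_seq.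
case: (B Q); first exact: sum_subcell_mass.
rewrite big_const_seq count_predT iter_addr addr0 size_cells -[LHS]mulr_natr.
by rewrite divfK.
Qed.

Fact avg_weight_sum : \sum_(v <- ocells (n0 * K)) avg_weight v = 1.
Proof.
rewrite big_ocells big_seq (eq_bigr _ sum_avg_weight) -big_seq.
rewrite -[RHS](mean_cst (grid_law mu s0 nK_gt0)) grid_lawE mulr1; congr (_ + _).
rewrite big_seq [RHS]big_seq; apply: eq_bigr => Q Qn.
by under [RHS]eq_bigr do rewrite mulr1; rewrite sum_subcell_mass.
Qed.

Definition avg_law : mean R (option (cell d)) := seq_mean avg_weight_ge0 avg_weight_sum.

Lemma avg_law_supp i : mpt (m := avg_law) i \in ocells (n0 * K).
Proof. exact: mem_tnth. Qed.

Lemma avg_lawE f : avg_law f = fine (mu (~` cube s)) * f None +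
  \sum_(Q <- cells d n0) \sum_(c <- cells d K)
    avg_weight (Some (comb K Q c)) * f (Some (comb K Q c)).
Proof. by rewrite seq_meanE big_ocells. Qed.

Lemma avg_law_block Q : Q \in good_cells n0 B -> forall f : option (cell d) -> R,
  avg_law (fun v => ind (olift (fun c => coarse K B c == Some Q)) v * f v) =
  cell_mass n0 Q * unif d K (fun c => f (Some (comb K Q c))).
Proof.
rewrite mem_filter => /andP[/= nB Qn] f; rewrite avg_lawE /ind /= mul0r mulr0 add0r.
rewrite (bigD1_seq Q)//= ?cells_uniq// [X in _ + X]big1 ?addr0 => [|Q' QQ'].
  rewrite unifE// mulrA mulr_sumr big_seq [RHS]big_seq; apply: eq_bigr => c cK.
  by rewrite /coarse cdiv_comb// (negPf nB) eqxx mul1r.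
rewrite big_seq big1// => c cK; rewrite /coarse cdiv_comb//.
case: ifP => _; first by rewrite mul0r mulr0.
by rewrite (_ : (_ == _) = false) ?mul0r ?mulr0//; apply/eqP => -[E]; rewrite E eqxx in QQ'.
Qed.

Lemma avg_law_bad :
  avg_law (ind (olift (fun c => coarse K B c == None))) =
  \sum_(Q <- bad_cells n0 B) cell_mass n0 Q.
Proof.
rewrite avg_lawE /ind /= mulr0 add0r big_filter [RHS]big_mkcond/=.
rewrite big_seq [RHS]big_seq; apply: eq_bigr => Q Qn.
case: ifPn => BQ.
  rewrite -(sum_avg_weight Qn) big_seq [RHS]big_seq; apply: eq_bigr => c cK.
  by rewrite /avg_weight /coarse !cdiv_comb// BQ eqxx mulr1.
by rewrite big_seq big1// => c cK; rewrite /coarse cdiv_comb// (negPf BQ) mulr0.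
Qed.

(** The reference mass, density [b] times volume, is the same on all subcells of a coarse cell, so
    in total the averaged masses are no further from it than the true ones: hence the factor 2. *)
Lemma avg_law_distance (b : cell d -> R) (N_gt0 : (0 < n0 * K)%N) (f : option (cell d) -> R) :
  (forall v, 0 <= f v <= 1) ->
  `|grid_law mu s0 N_gt0 f - avg_law f| <=
  2 * \sum_(c <- [seq c <- cells d (n0 * K) | predC B (cdiv K c)])
    `|cell_mass (n0 * K) c - b (cdiv K c) * (s / (n0 * K)%:R) ^+ d|.
Proof.
move=> f01; rewrite grid_lawE avg_lawE.
rewrite (_ : _ - _ = \sum_(Q <- cells d n0) \sum_(c <- cells d K)
  (cell_mass (n0 * K) (comb K Q c) - avg_weight (Some (comb K Q c))) * f (Some (comb K Q c))); last first.
  rewrite opprD addrACA subrr add0r -sumrB; apply: eq_bigr => Q _.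
  by rewrite -sumrB; apply: eq_bigr => c _; rewrite mulrBl.
rewrite (cells_comb_filter (predC B)
  (fun c => `|cell_mass (n0 * K) c - b (cdiv K c) * (s / (n0 * K)%:R) ^+ d|))//.
rewrite big_filter mulr_sumr [leRHS]big_mkcond/=.
apply: le_trans (ler_norm_sum _ _ _) _; rewrite big_seq [leRHS]big_seq.
apply: ler_sum => Q Qn; apply: le_trans (ler_norm_sum _ _ _) _.
case: ifPn => /= [nB|]; last first.
  rewrite negbK => BQ; rewrite big_seq big1// => c cK.
  by rewrite /avg_weight !cdiv_comb// BQ subrr mul0r normr0.
set v := (s / (n0 * K)%:R) ^+ d.
pose x c := cell_mass (n0 * K) (comb K Q c) - b Q * v.
have xE : \sum_(c <- cells d K) x c = cell_mass n0 Q - b Q * v * (K ^ d)%:R.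
  rewrite sumrB sum_subcell_mass// big_const_seq count_predT iter_addr addr0 size_cells.
  by rewrite -[X in _ - X]mulr_natr.
apply: (@le_trans _ _ (\sum_(c <- cells d K) (`|x c| + `|\sum_(c <- cells d K) x c| / (K ^ d)%:R))).
  rewrite big_seq [leRHS]big_seq; apply: ler_sum => c cK.
  rewrite /avg_weight !cdiv_comb// (negPf nB).
  have /andP[fc0 fc1] := f01 (Some (comb K Q c)).
  rewrite normrM (ger0_norm fc0); apply: le_trans (ler_piMr _ fc1) _ => //.
  (* The averaged mass differs from the reference mass by the average of the deviations [x c]. *)
  rewrite (_ : _ - _ = x c - (\sum_(c <- cells d K) x c) / (K ^ d)%:R); last first.
    by rewrite xE /x; field.
  by apply: le_trans (ler_normB _ _) _; rewrite lerD2l normrM normfV (ger0_norm (ler0n R (K ^ d)%N)).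
rewrite big_split/= big_const_seq count_predT iter_addr addr0 size_cells -[X in _ + X]mulr_natr.
rewrite divfK// (_ : 2 * _ = \sum_(c <- cells d K) `|x c| + \sum_(c <- cells d K) `|x c|).
  by rewrite lerD2l; exact: ler_norm_sum.
rewrite big_seq (eq_bigr (fun c => `|x c|)) => [|c cK]; last by rewrite cdiv_comb.
by rewrite -big_seq; ring.
Qed.

End averaged_law.

Section box_mean.
Context {R : realType} {d h : nat} (a : rel nat).
Hypotheses (d_gt0 : (0 < d)%N) (h_gt0 : (0 < h)%N) (a_conn : index_connected h a).
Local Notation pt := (d.-tuple R).
Local Notation lam := (@lebesgue_tuple R d).
Variables (mu : probability pt R) (f : pt -> R) (mu_perp : {measure set pt -> \bar R}).
Hypotheses (mf : measurable_fun setT f) (f0 : forall x, 0 <= f x)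
  (muE : forall A, measurable A -> mu A = (\int[lam]_(x in A) (f x)%:E + mu_perp A)%E).
Context {dO : measure_display} {Omega : measurableType dO}.
Variables (P : probability Omega R) (X : nat -> {RV P >-> pt}).
Hypotheses (X_law : forall i A, measurable A -> distribution P (X i) A = mu A)
  (X_indep : mutually_independent P X).
Variables (s : R) (n0 : nat) (B : pred (cell d)) (b : cell d -> R) (E : R).
Hypotheses (s0 : 0 < s) (n0_gt0 : (0 < n0)%N).
Hypothesis E_bound : (\int[lam]_(x in region s n0 (predC B)) (`|f x - step s n0 b x|)%:E +
  mu_perp (region s n0 (predC B)) <= E%:E)%E.
Variables (n : nat) (r : R).
Hypothesis r0 : 0 < r.

Definition box_mean : R := mean_rv P (fun w =>
  npk h a (close r) (seq.filter (incube s) [seq X i w | i <- iota 0 n])).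

Let s' := s / n0%:R / r.
Let s'0 : 0 < s'. Proof. by rewrite !divr_gt0// ltr0n. Qed.
Let m := cell_mass mu s n0.

(** [E] controls both the variation of the density inside good cells and the singular mass there,
    hence the price of averaging per sampled point. *)
Let distance K (K0 : (0 < K)%N) (N0 : (0 < n0 * K)%N) F : unit_increments F ->
  `|iid (grid_law mu s0 N0) n F - iid (avg_law mu B s0 n0_gt0 K0) n F| <= n%:R * (2 * E).
Proof.
move=> FI; apply: iid_total_variation => // g g01.
apply: le_trans (avg_law_distance mu B s0 n0_gt0 K0 b N0 g01) _.
rewrite ler_pM2l// -lee_fin.
apply: le_trans (region_density_error mf f0 muE s0 (fun c => b (cdiv K c)) _ N0) _.
apply: le_trans E_bound.
rewrite (region_cdiv s0 (predC B) n0_gt0 K0) leeD2r//.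
rewrite le_eqVlt; apply/orP; left; apply/eqP; apply: eq_integral => x.
by rewrite inE => -[xs _]; rewrite !step_cell// cell_at_cdiv.
Qed.

(** The product of the grid sizes required by the finitely many coarse cells works for all of
    them. *)
Let common_divisor (k : cell d -> nat) eps (l : seq (cell d)) : 0 < eps ->
  exists2 D, (0 < D)%N & forall K, (0 < K)%N -> (D %| K)%N -> {in l, forall Q,
    psi_grid d h a K (k Q) s' <= psi_unif d h a (k Q) s' + eps}.
Proof.
move=> e0; elim: l => [|Q l [D D0 IH]]; first by exists 1%N.
have [D' D'0 H] := psi_unif_approx d a h_gt0 (k Q) (ltW s'0) e0.
exists (D * D')%N; first by rewrite muln_gt0 D0.
move=> K K0 DK Q'; rewrite inE => /predU1P[->|Q'l].
  by apply: H => //; apply: dvdn_trans DK; exact: dvdn_mull.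
by apply: IH => //; apply: dvdn_trans DK; exact: dvdn_mulr.
Qed.

Variables (k : cell d -> nat) (del : R).
Hypothesis del0 : 0 < del.

Lemma box_mean_bounds K1 : (0 < K1)%N -> d%:R * s' <= K1%:R ->
  \sum_(Q <- good_cells n0 B) (psi_unif d h a (k Q) s' - count_err n (m Q) del (k Q)) +
    n%:R * (\sum_(Q <- bad_cells n0 B) m Q) / h%:R -
    (size (bad_cells n0 B) * K1 ^ d)%:R - n%:R * (2 * E) <= box_mean <=
  \sum_(Q <- good_cells n0 B) (psi_unif d h a (k Q) s' + count_err n (m Q) del (k Q)) +
    n%:R * (\sum_(Q <- bad_cells n0 B) m Q) / h%:R + n%:R * (2 * d%:R / s') + n%:R * (2 * E).
Proof.
move=> K10 dK1.
(* The factor [K1] divides bad cells into cliques, the factorial being [K2]; as every given size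
   eventually divides the factorial, [psi_grid] comes down to [psi_unif]. *)
pose K_ j := (K1 * j.+1`!)%N; have K_0 j : (0 < K_ j)%N by rewrite muln_gt0 K10 fact_gt0.
have N_0 j : (0 < n0 * K_ j)%N by rewrite muln_gt0 n0_gt0 K_0.
have Koo M : exists j0, forall j, (j0 <= j)%N -> (M <= n0 * K_ j)%N.
  exists M => j Mj; apply: (@leq_trans (1 * (1 * j.+1))%N).
    by rewrite !mul1n leqW.
  rewrite leq_mul// leq_mul//; elim: (j) => // i IH; rewrite factS.
  by rewrite leq_pmulr// fact_gt0.
have [_ /(_ s0 N_0) lim] := npk_box_cvg a h_gt0 X_law X_indep n r0 s0 N_0 Koo.
have dE j : s / r / (n0 * K_ j)%:R = s' / (K_ j)%:R.
  by rewrite /s' natrM; field; rewrite !gt_eqF// ltr0n.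
have dist j := distance (K_0 j) (N_0 j) (grid_pk_unit_increments (h := h) a h_gt0 (s' / (K_ j)%:R)).
have le_lim (u : nat -> R) (v : R) : u j @[j --> \oo] --> v -> forall c, (\forall j \near \oo, u j <= c) -> v <= c.
  move=> uv c uc; have <- := cvg_lim (@Rhausdorff R) uv.
  by apply: limr_le => //; apply/cvg_ex; exists v.
have ge_lim (u : nat -> R) (v : R) : u j @[j --> \oo] --> v -> forall c, (\forall j \near \oo, c <= u j) -> c <= v.
  move=> uv c uc; have <- := cvg_lim (@Rhausdorff R) uv.
  by apply: limr_ge => //; apply/cvg_ex; exists v.
apply/andP; split.
  apply: (ge_lim _ _ lim); apply: nearW => j; rewrite dE.
  have := iid_grid_pk_ge a d_gt0 h_gt0 n0_gt0 (K_0 j) s'0 (@avg_law_supp R d mu s n0 (K_ j) B s0 n0_gt0 (K_0 j))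
    (@avg_law_block R d mu s n0 (K_ j) B s0 n0_gt0 (K_0 j)) n k del0 K10 (fact_gt0 j.+1) erefl dK1.
  rewrite avg_law_bad => H.
  have := dist j; rewrite ler_norml => /andP[+ _].
  rewrite lerBrDl => H'; apply: le_trans H'.
  rewrite lerD2r; apply: le_trans H; rewrite !lerD2r; apply: ler_sum => Q _.
  by rewrite lerD2r psi_unif_le.
apply/ler_addgt0Pr => eps e0.
(* [eps] is shared between the good cells and the term [2 / K] of the exposed mass, with one share
   to spare. *)
pose c0 := (size (good_cells n0 B))%:R + n%:R * (2 * d%:R) + 1 : R.
have c00 : 0 < c0 by rewrite ltr_wpDl// addr_ge0// mulr_ge0.
have e1 : 0 < eps / c0 by rewrite divr_gt0.
have [D D0 HD] := common_divisor k (good_cells n0 B) e1.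
apply: (le_lim _ _ lim); exists (maxn D (Num.truncn (2 / (eps / c0))).+1) => // j /=.
rewrite geq_max dE => /andP[Dj ej].
have Kj : (j.+1 <= K_ j)%N.
  rewrite /K_ -[leqLHS]mul1n leq_mul//; elim: (j) => // i IH; rewrite factS.
  by rewrite leq_pmulr// fact_gt0.
have DK : (D %| K_ j)%N.
  by rewrite /K_ dvdn_mull// dvdn_fact// D0 leqW.
have KR : 2 / (K_ j)%:R <= eps / c0.
  rewrite ler_pdivrMr ?ltr0n// -ler_pdivrMl// mulrC.
  apply: le_trans (ltW (Num.Theory.truncnS_gt _)) _.
  by rewrite ler_nat (leq_trans ej)// (leq_trans _ Kj).
have H := iid_grid_pk_le d_gt0 h_gt0 a_conn n0_gt0 (K_0 j) s'0 (@avg_law_supp R d mu s n0 (K_ j) B s0 n0_gt0 (K_0 j))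
    (@avg_law_block R d mu s n0 (K_ j) B s0 n0_gt0 (K_0 j)) n k del0.
rewrite avg_law_bad in H.
have := dist j; rewrite ler_norml => /andP[_]; rewrite lerBlDl => /le_trans; apply.
rewrite [leRHS]addrAC lerD2r; apply: le_trans H _.
have S : \sum_(Q <- good_cells n0 B) (psi_grid d h a (K_ j) (k Q) s' + count_err n (m Q) del (k Q)) <=
    \sum_(Q <- good_cells n0 B) (psi_unif d h a (k Q) s' + count_err n (m Q) del (k Q)) +
    (size (good_cells n0 B))%:R * (eps / c0).
  rewrite mulr_natl -(count_predT (good_cells n0 B)) -iter_addr_0 -big_const_seq -big_split/=.
  rewrite big_seq [leRHS]big_seq; apply: ler_sum => Q Qg.
  by rewrite addrAC lerD2r; apply: HD.
have T : n%:R * (2 * d%:R * (s'^-1 + 2 / (K_ j)%:R)) <=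
    n%:R * (2 * d%:R / s') + n%:R * (2 * d%:R) * (eps / c0).
  rewrite [leRHS](_ : _ = n%:R * (2 * d%:R * (s'^-1 + eps / c0))); last by ring.
  by rewrite ler_wpM2l// ler_wpM2l// lerD2l.
have epsE : eps = (size (good_cells n0 B))%:R * (eps / c0) +
    n%:R * (2 * d%:R) * (eps / c0) + eps / c0.
  by rewrite -mulrDl -{2}[eps / c0]mul1r -mulrDl mulrC divfK// gt_eqF.
rewrite [X in _ <= _ + X]epsE; apply: le_trans (lerD (lerD S (lexx _)) T) _.
set v := \sum_(Q <- _) _; set k1 := _ / h%:R; set q := n%:R * _.
set x := _ * (eps / c0); set y := _ * (eps / c0); set z := eps / c0 in e1 *.
by rewrite (_ : v + x + k1 + (q + y) = v + k1 + q + (x + y)) ?lerD2l ?lerDl ?(ltW e1)//; ring.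
Qed.

End box_mean.

(** * Letting the sample size grow *)

Section thermodynamic_limit.
Context {R : realType} {d h : nat} (a : rel nat).
Hypotheses (d_gt0 : (0 < d)%N) (h_gt0 : (0 < h)%N).
Variables (r : nat -> R) (t : R).
Hypotheses (r_gt0 : forall n, (0 < n)%N -> 0 < r n) (t_gt0 : 0 < t)
  (r_lim : n%:R * r n ^+ d @[n --> \oo] --> t).

Lemma radius_pow_cvg0 : r n ^+ d @[n --> \oo] --> 0.
Proof.
have H : (n%:R * r n ^+ d) * n%:R^-1 @[n --> \oo] --> t * 0.
  apply: cvgM => //; apply/gtr0_cvgV0; last exact: cvgr_idn.
  by exists 1%N => // n /=; rewrite ltr0n.
rewrite mulr0 in H; apply: cvg_trans H; apply: near_eq_cvg.
by exists 1%N => // n /= n0; rewrite mulrAC divff ?mul1r// pnatr_eq0 -lt0n.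
Qed.

Lemma radius_cvg0 : r n @[n --> \oo] --> 0.
Proof.
apply/cvgrPdist_le => eps e0.
have ed : 0 < eps ^+ d by rewrite exprn_gt0.
have /cvgrPdist_le/(_ _ ed)[n0 _ H] := radius_pow_cvg0.
exists (maxn n0 1) => // n /=; rewrite geq_max => /andP[nn0 n1].
have rn := r_gt0 n1; rewrite sub0r normrN gtr0_norm//.
have := H n nn0; rewrite /= sub0r normrN gtr0_norm ?exprn_gt0//.
by rewrite ler_pXn2r// nnegrE ltW.
Qed.

(** In units of [r n] the cell has volume [c ^+ d / r n ^+ d], asymptotically [n * c ^+ d / t], and
    contains about [n * q] points: its density tends to [t * q / c ^+ d]. *)
Lemma psi_unif_rate_cvg (c q : R) : 0 < c -> 0 <= q ->
  psi_unif d h a (Num.truncn (n%:R * q)) (c / r n) / n%:R @[n --> \oo] -->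
  packing_limit d h a (t * q / c ^+ d) * (c ^+ d / t).
Proof.
move=> c0 q0; have cd0 : 0 < c ^+ d by rewrite exprn_gt0.
have l0 : 0 <= t * q / c ^+ d by rewrite divr_ge0 ?mulr_ge0// ltW.
have H1 : psi_unif d h a (Num.truncn (n%:R * q)) (c / r n) / (c / r n) ^+ d @[n --> \oo] -->
    packing_limit d h a (t * q / c ^+ d).
  apply/cvgrPdist_le => eps e0; have e3 : 0 < eps / 3 by rewrite divr_gt0.
  have [S S0 HS] := packing_limitP a d_gt0 h_gt0 l0 e3.
  have cS : 0 < c / S by rewrite divr_gt0.
  have /cvgrPdist_le/(_ _ cS)[n1 _ Hn1] := radius_cvg0.
  have e2 : 0 < eps / 3 * c ^+ d / 2 by rewrite divr_gt0 ?mulr_gt0.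
  have /cvgrPdist_le/(_ _ e2)[n2 _ Hn2] := radius_pow_cvg0.
  have e4 : 0 < eps / 3 * c ^+ d / 2 / (q + 1).
    by rewrite divr_gt0// ltr_wpDl.
  have /cvgrPdist_le/(_ _ e4)[n3 _ Hn3] := r_lim.
  exists (maxn 1 (maxn n1 (maxn n2 n3))) => // n /=.
  rewrite !geq_max => /and4P[n0 nn1 nn2 nn3].
  have rn := r_gt0 n0; have rd : 0 < r n ^+ d by rewrite exprn_gt0.
  rewrite distrC (_ : eps = 3 * (eps / 3)); last by field.
  apply: HS.
    rewrite ler_pdivlMr// mulrC -ler_pdivlMr//.
    by have := Hn1 n nn1; rewrite /= sub0r normrN gtr0_norm.
  have nq : 0 <= n%:R * q by rewrite mulr_ge0.
  have /andP[k1 k2] := Num.Theory.truncn_itv nq.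
  rewrite -natr1 in k2; set k := (Num.truncn (n%:R * q))%:R in k1 k2 *.
  rewrite expr_div_n (_ : t * q / c ^+ d * (c ^+ d / r n ^+ d) = t * q / r n ^+ d); last first.
    by field; rewrite !gt_eqF.
  rewrite -(ler_pM2r rd) -[X in _ * X <= _](gtr0_norm rd) -normrM mulrBl divfK ?gt_eqF//.
  rewrite (_ : eps / 3 * (c ^+ d / r n ^+ d) * r n ^+ d = eps / 3 * c ^+ d); last first.
    by field; rewrite gt_eqF.
  have := Hn2 n nn2; rewrite /= sub0r normrN gtr0_norm// => r2.
  have := Hn3 n nn3; rewrite /= ler_pdivlMr ?ltr_wpDl// => r3.
  rewrite (_ : k * r n ^+ d - t * q = (k - n%:R * q) * r n ^+ d - (t - n%:R * r n ^+ d) * q); last by ring.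
  apply: le_trans (ler_normB _ _) _.
  rewrite [leRHS](_ : _ = eps / 3 * c ^+ d / 2 + eps / 3 * c ^+ d / 2); last by field.
  apply: lerD; rewrite normrM.
    apply: le_trans r2; rewrite (gtr0_norm rd) ler_piMl ?(ltW rd)//.
    by rewrite ler_norml; apply/andP; split; lra.
  apply: le_trans r3; rewrite (ger0_norm q0) ler_wpM2l//.
  by rewrite lerDl.
have H2 : c ^+ d / (n%:R * r n ^+ d) @[n --> \oo] --> c ^+ d / t.
  apply: cvgM; first exact: cvg_cst.
  by apply: cvgV => //; rewrite gt_eqF.
apply: cvg_trans (cvgM H1 H2); apply: near_eq_cvg; exists 1%N => // n /= n0.
have rn := r_gt0 n0; rewrite /= expr_div_n; field.
by rewrite !gt_eqF ?ltr0n// exprn_gt0.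
Qed.

Context (a_conn : index_connected h a).
Local Notation pt := (d.-tuple R).
Local Notation lam := (@lebesgue_tuple R d).
Variables (mu : probability pt R) (f : pt -> R) (mu_perp : {measure set pt -> \bar R}).
Hypotheses (mf : measurable_fun setT f) (f0 : forall x, 0 <= f x)
  (muE : forall A, measurable A -> mu A = (\int[lam]_(x in A) (f x)%:E + mu_perp A)%E).
Context {dO : measure_display} {Omega : measurableType dO}.
Variables (P : probability Omega R) (X : nat -> {RV P >-> pt}).
Hypotheses (X_law : forall i A, measurable A -> distribution P (X i) A = mu A)
  (X_indep : mutually_independent P X).
Variables (s : R) (n0 : nat) (B : pred (cell d)) (b : cell d -> R) (E : R).
Hypotheses (s0 : 0 < s) (n0_gt0 : (0 < n0)%N).
Hypothesis E_bound : (\int[lam]_(x in region s n0 (predC B)) (`|f x - step s n0 b x|)%:E +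
  mu_perp (region s n0 (predC B)) <= E%:E)%E.

Let c := s / n0%:R.
Let c0 : 0 < c. Proof. by rewrite divr_gt0// ltr0n. Qed.
Let m := cell_mass mu s n0.

(** What the mean per sampled point approaches for a fixed coarse grid, up to the errors of
    averaging and of cliques. *)
Definition grid_target : R :=
  \sum_(Q <- good_cells n0 B) packing_limit d h a (t * m Q / c ^+ d) * (c ^+ d / t) +
  (\sum_(Q <- bad_cells n0 B) m Q) / h%:R.

(** With [del] proportional to [n], the variance, of order [n], contributes a bounded amount
    only. *)
Lemma count_err_trunc (q : R) (n : nat) eta : 0 <= q <= 1 -> (0 < n)%N -> 0 < eta ->
  2 / eta ^+ 2 <= n%:R ->
  count_err n q (eta * n%:R) (Num.truncn (n%:R * q)) <= 2 * eta * n%:R.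
Proof.
move=> /andP[q0 q1] n_gt0 e0 ne; rewrite /count_err.
have nR : 1 <= n%:R :> R by rewrite ler1n.
have nR0 : 0 < n%:R :> R by rewrite ltr0n.
have nq : 0 <= n%:R * q by rewrite mulr_ge0.
have /andP[k1 k2] := Num.Theory.truncn_itv nq.
rewrite -natr1 in k2; set k := (Num.truncn (n%:R * q))%:R in k1 k2 *.
rewrite (_ : 2 * eta * n%:R = eta * n%:R + eta * n%:R) ?lerD2l; last by ring.
rewrite ler_pdivrMr ?mulr_gt0//.
apply: (@le_trans _ _ (2 * n%:R)).
  have : (n%:R * q - k) ^+ 2 <= 1 by rewrite expr_le1//; lra.
  have : n%:R * q <= n%:R by rewrite ler_piMr// ltW.
  lra.
have -> : eta * n%:R * (eta * n%:R) = eta ^+ 2 * n%:R * n%:R by ring.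
by rewrite ler_pM2r// -ler_pdivrMl ?exprn_gt0// mulrC.
Qed.

(** Eventually [r n ^+ d >= t / (2 * n)] and [K1 <= 2 * d * c / r n], so the [K1 ^ d] cliques of a
    bad cell cost at most [c ^+ d * (2 * (2 * d) ^+ d / t)] per sampled point. Averaging the law
    costs [2 * E]. *)
Lemma box_mean_limit eta : 0 < eta -> exists n1, forall n, (n1 <= n)%N ->
  `|box_mean (d := d) (h := h) a X s n (r n) / n%:R - grid_target| <=
    2 * E + (size (bad_cells n0 B))%:R * c ^+ d * (2 * (2 * d%:R) ^+ d / t) + eta.
Proof.
move=> eta0.
set gc := good_cells n0 B.
pose g : R := (size gc)%:R + 1; have g0 : 0 < g by rewrite /g ltr_wpDl.
pose e' := eta / (4 * g); have e'0 : 0 < e' by rewrite divr_gt0 ?mulr_gt0.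
have m0 Q : 0 <= m Q by exact: cell_mass_ge0.
have m1 Q : m Q <= 1.
  by rewrite -lee_fin cell_mass_fin//; apply: probability_le1; exact: measurable_cell_set.
pose u n := \sum_(Q <- gc) psi_unif d h a (Num.truncn (n%:R * m Q)) (c / r n) / n%:R.
pose L := \sum_(Q <- gc) packing_limit d h a (t * m Q / c ^+ d) * (c ^+ d / t).
have uL : u n @[n --> \oo] --> L.
  rewrite /u /L; elim: gc {g g0 e' e'0 u L} => [|Q l IH].
    by under eq_fun do rewrite big_nil; rewrite big_nil; exact: cvg_cst.
  under eq_fun do rewrite big_cons; rewrite big_cons.
  by apply: cvgD => //; exact: psi_unif_rate_cvg.
have eta4 : 0 < eta / 4 by rewrite divr_gt0.
have /cvgrPdist_le/(_ _ eta4)[n1 _ Hn1] := uL.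
have e5 : 0 < eta / 4 * c / (2 * d%:R) by apply: divr_gt0; apply: mulr_gt0 => //; rewrite ltr0n.
have /cvgrPdist_le/(_ _ e5)[n2 _ Hn2] := radius_cvg0.
have t2 : 0 < t / 2 by rewrite divr_gt0.
have /cvgrPdist_le/(_ _ t2)[n3 _ Hn3] := r_lim.
have /cvgrPdist_le/(_ _ c0)[n4 _ Hn4] := radius_cvg0.
exists (maxn 1 (maxn n1 (maxn n2 (maxn n3 (maxn n4 (Num.truncn (2 / e' ^+ 2)).+1))))) => n.
rewrite !geq_max => /and5P[n_gt0 nn1 nn2 nn3 /andP[nn4 nn5]].
have nR : 0 < n%:R :> R by rewrite ltr0n.
have rn := r_gt0 n_gt0; have rd : 0 < r n ^+ d by rewrite exprn_gt0.
pose s' := c / r n; have s'0 : 0 < s' by rewrite divr_gt0.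
have dR : 1 <= d%:R :> R by rewrite ler1n.
pose K1 := (Num.truncn (d%:R * s')).+1.
have K1s : d%:R * s' <= K1%:R by exact: ltW (Num.Theory.truncnS_gt _).
(* Once [r n <= c], this value is at least one, so that rounding it up at most doubles it. *)
have ds1 : 1 <= d%:R * s'.
  have := Hn4 n nn4; rewrite /= sub0r normrN gtr0_norm// => rc.
  have : 1 <= s' by rewrite ler_pdivlMr// mul1r.
  by move: dR; nra.
have K1b : K1%:R <= 2 * (d%:R * s').
  rewrite /K1 -natr1; have /andP[+ _] := Num.Theory.truncn_itv (le_trans ler01 ds1); lra.
pose del := e' * n%:R; have del0 : 0 < del by rewrite mulr_gt0.
have := box_mean_bounds d_gt0 h_gt0 a_conn mf f0 muE X_law X_indep s0 n0_gt0 E_bound n rn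
  (fun Q => Num.truncn (n%:R * m Q)) del0 (ltn0Sn _) K1s.
rewrite -/c -/s' -/gc -/m; set bm := box_mean _ _ _ _ _.
set ps := fun Q => psi_unif d h a (Num.truncn (n%:R * m Q)) s'.
set ce := fun Q => count_err n (m Q) del (Num.truncn (n%:R * m Q)).
set mB := \sum_(Q <- bad_cells n0 B) m Q => /andP[lo' up'].
pose CE := \sum_(Q <- gc) ce Q; pose PS := \sum_(Q <- gc) ps Q.
have lo : PS - CE + n%:R * mB / h%:R - (size (bad_cells n0 B) * K1 ^ d)%:R - n%:R * (2 * E) <= bm.
  by rewrite /PS /CE -sumrB.
have up : bm <= PS + CE + n%:R * mB / h%:R + n%:R * (2 * d%:R / s') + n%:R * (2 * E).
  by rewrite /PS /CE -big_split.
clear lo' up'.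
have ceb : CE <= eta / 2 * n%:R.
  apply: (@le_trans _ _ (\sum_(Q <- gc) 2 * e' * n%:R)).
    apply: ler_sum => Q _; apply: count_err_trunc => //; first by rewrite m0 m1.
    apply: le_trans (ltW (Num.Theory.truncnS_gt _)) _.
    by rewrite ler_nat.
  rewrite big_const_seq count_predT iter_addr addr0 -[X in X <= _]mulr_natr.
  rewrite [leRHS](_ : _ = 2 * e' * n%:R * g); last by rewrite /e'; field; rewrite gt_eqF.
  by apply: ler_wpM2l; [rewrite mulr_ge0// mulr_ge0// ltW|rewrite lerDl].
have psE : PS = u n * n%:R.
  by rewrite /PS /u mulr_suml; apply: eq_bigr => Q _; rewrite divfK// gt_eqF.
have := Hn1 n nn1; rewrite /= distrC ler_distl => /andP[u1 u2].
have blk : (size (bad_cells n0 B) * K1 ^ d)%:R <=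
    (size (bad_cells n0 B))%:R * c ^+ d * (2 * (2 * d%:R) ^+ d / t) * n%:R.
  rewrite natrM natrX -!mulrA ler_wpM2l//.
  apply: (@le_trans _ _ ((2 * (d%:R * s')) ^+ d)).
    by rewrite lerXn2r ?nnegrE// mulr_ge0// mulr_ge0// ltW.
  rewrite mulrA exprMn /s' expr_div_n.
  have := Hn3 n nn3; rewrite /= ler_norml => /andP[_ tn].
  have tn' : t / 2 <= n%:R * r n ^+ d by lra.
  rewrite [leLHS](_ : _ = c ^+ d * (2 * d%:R) ^+ d / r n ^+ d); last by ring.
  rewrite ler_pdivrMr// [leRHS](_ : _ =
     c ^+ d * (2 * d%:R) ^+ d * (2 / t * (n%:R * r n ^+ d))); last by ring.
  rewrite ler_peMr ?mulr_ge0 ?exprn_ge0 ?(ltW c0)//.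
  rewrite [leLHS](_ : _ = 2 / t * (t / 2)); last by field; rewrite gt_eqF.
  by rewrite ler_pM2l// divr_gt0.
have ds : 2 * d%:R / s' <= eta / 4.
  have := Hn2 n nn2; rewrite /= sub0r normrN gtr0_norm// ler_pdivlMr ?mulr_gt0 ?ltr0n// => rr.
  rewrite /s' invf_div mulrA ler_pdivrMr//; lra.
rewrite psE in lo up.
rewrite ler_distl ler_pdivlMr// ler_pdivrMr//.
have hm : (grid_target = L + mB / h%:R) by [].
rewrite hm; set V := _ * _ * (2 * _ / t) in blk *.
have U1 : (L - eta / 4) * n%:R <= u n * n%:R by rewrite ler_pM2r.
have U2 : u n * n%:R <= (L + eta / 4) * n%:R by rewrite ler_pM2r.
have D1 : n%:R * (2 * d%:R / s') <= n%:R * (eta / 4) by rewrite ler_pM2l.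
have nmb : n%:R * mB / h%:R = mB / h%:R * n%:R by ring.
rewrite nmb in lo up; have k0 : 0 <= (size (bad_cells n0 B) * K1 ^ d)%:R :> R by [].
move: k0 lo up ceb blk U1 U2 D1; clear.
move: (mB / h%:R) (_ * K1 ^ d)%:R (u n * n%:R) (n%:R * (2 * d%:R / s')) (n%:R) => w k z v y.
by move=> k0 lo up ceb blk U1 U2 D1; apply/andP; split; lra.
Qed.

End thermodynamic_limit.

(** * From the coarse grid to the integral *)

Section target_error.
Context {R : realType} {d h : nat} (a : rel nat).
Hypotheses (d_gt0 : (0 < d)%N) (h_gt0 : (0 < h)%N).
Variable t : R.
Hypothesis t_gt0 : 0 < t.
Local Notation pt := (d.-tuple R).
Local Notation lam := (@lebesgue_tuple R d).
Variables (mu : probability pt R) (f : pt -> R) (mu_perp : {measure set pt -> \bar R}).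
Hypotheses (mf : measurable_fun setT f) (f0 : forall x, 0 <= f x)
  (muE : forall A, measurable A -> mu A = (\int[lam]_(x in A) (f x)%:E + mu_perp A)%E).

(** This is [rho (t * f x) * f x], written without division by [f x]. *)
Definition limit_density (x : pt) : R := packing_limit d h a (t * f x) / t.

Lemma limit_density_ge0 x : 0 <= limit_density x.
Proof. by rewrite divr_ge0 ?(ltW t_gt0)// packing_limit_ge0// mulr_ge0// ltW. Qed.

Lemma limit_density_le x : limit_density x <= f x.
Proof. by rewrite ler_pdivrMr// mulrC packing_limit_le// mulr_ge0// ltW. Qed.

Lemma measurable_limit_density : measurable_fun setT limit_density.
Proof.
(* The Lipschitz bound holds for nonnegative densities only; clipping at 0 gives a function
   continuous on the whole line. *)
pose G l := packing_limit d h a (Num.max l 0) / t.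
rewrite (_ : limit_density = G \o (fun x => t * f x)); last first.
  apply/funext => x; rewrite /limit_density /G /= (max_idPl _)//.
  by rewrite mulr_ge0// ltW.
apply: measurableT_comp; last exact: measurable_funM.
apply: measurable_funM => //.
apply: continuous_measurable_fun => l.
apply/cvgrPdist_le => e e0; near=> m.
apply: le_trans (packing_limit_lipschitz a d_gt0 h_gt0 _ _) _; rewrite ?le_max ?lexx ?orbT//.
apply: (@le_trans _ _ `|l - m|).
  have := ler_norm (l - m); have := ler_norm (- (l - m)); rewrite normrN => h1 h2.
  by rewrite /Num.max ler_norml; case: ltP => l0; case: ltP => m0; apply/andP; split; lra.
near: m; exact: (@cvgr_dist_le _ _ _ _ (nbhs_filter l) id).
Unshelve. all: by end_near. Qed.

Lemma integrable_limit_density A : measurable A -> lam.-integrable A (EFin \o limit_density).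
Proof.
move=> mA; apply: le_integrable (density_integrable mf f0 muE mA) => //.
  by apply/measurable_EFinP/measurable_funTS; exact: measurable_limit_density.
move=> x _ /=; rewrite lee_fin !ger0_norm ?limit_density_le//.
exact: limit_density_ge0.
Qed.

Lemma limit_density_mass A : measurable A ->
  0 <= \int[lam]_(x in A) limit_density x <= \int[lam]_(x in A) f x.
Proof.
move=> mA; rewrite Rintegral_ge0/=; last by move=> x _; exact: limit_density_ge0.
apply: le_Rintegral => //; first exact: integrable_limit_density.
  exact: (density_integrable mf f0 muE).
by move=> x _; exact: limit_density_le.
Qed.

Variables (s : R) (n0 : nat) (B : pred (cell d)) (b : cell d -> R) (E : R).
Hypotheses (s0 : 0 < s) (n0_gt0 : (0 < n0)%N).
Hypothesis E_bound : (\int[lam]_(x in region s n0 (predC B)) (`|f x - step s n0 b x|)%:E +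
  mu_perp (region s n0 (predC B)) <= E%:E)%E.
Let c := s / n0%:R.
Let c0 : 0 < c. Proof. by rewrite divr_gt0// ltr0n. Qed.
Let m := cell_mass mu s n0.

Lemma cells_limit_density P :
  \int[lam]_(x in region s n0 P) limit_density x =
  \sum_(Q <- [seq Q <- cells d n0 | P Q]) \int[lam]_(x in cell_set s n0 Q) limit_density x.
Proof.
rewrite /Rintegral sum_fine => [|Q _]; last first.
  by apply: integrable_fin_num; [|apply: integrable_limit_density]; exact: measurable_cell_set.
congr fine; apply: cells_integral => //.
  by apply/measurable_EFinP; exact: measurable_limit_density.
by move=> x; rewrite lee_fin limit_density_ge0.
Qed.

(** As [packing_limit] is 1-Lipschitz, the error is at most the L1 distance of [f] and the mean
    density [m Q / c ^+ d] on the cell; both are compared with [b Q], whence the factor 2. *)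
Lemma cell_target_error Q : Q \in cells d n0 ->
  ((`|packing_limit d h a (t * m Q / c ^+ d) * (c ^+ d / t) -
     \int[lam]_(x in cell_set s n0 Q) limit_density x|)%:E <=
  2%:E * (\int[lam]_(x in cell_set s n0 Q) (`|f x - step s n0 b x|)%:E +
  mu_perp (cell_set s n0 Q)))%E.
Proof.
move=> Qn; have mQ := measurable_cell_set s n0 Q.
have lamQ := lebesgue_cell_set s0 n0_gt0 Q.
have cd0 : 0 < c ^+ d by rewrite exprn_gt0.
have intc (v : R) : lam.-integrable (cell_set s n0 Q) (EFin \o (fun=> v)).
  apply: measurable_bounded_integrable => //.
    by apply: (@le_lt_trans _ _ ((s / n0%:R) ^+ d)%:E); [rewrite -lamQ|exact: ltry].
  exists `|v|; split; first exact: num_real.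
  by move=> x vx w _; exact: ltW.
have cstE (v : R) : \int[lam]_(x in cell_set s n0 Q) v = v * c ^+ d.
  by rewrite Rintegral_cst//; congr (_ * _); exact: (congr1 fine lamQ).
pose G0 := packing_limit d h a (t * m Q / c ^+ d) / t.
rewrite (_ : _ * (c ^+ d / t) = \int[lam]_(x in cell_set s n0 Q) G0); last by rewrite cstE /G0; ring.
have intg := integrable_limit_density mQ; have intf := density_integrable mf f0 muE mQ.
rewrite -RintegralB//.
have intd : lam.-integrable (cell_set s n0 Q) (EFin \o (fun x => G0 - limit_density x)).
  by have := integrableB mQ (intc G0) intg; congr integrable.
have intfb : lam.-integrable (cell_set s n0 Q) (EFin \o (fun x => f x - b Q)).
  by have := integrableB mQ intf (intc (b Q)); congr integrable.
have intnd := integrable_norm intd; have intnf := integrable_norm intfb.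
have intS : lam.-integrable (cell_set s n0 Q) (EFin \o (fun x => `|m Q / c ^+ d - b Q| + `|f x - b Q|)).
  by have := integrableD mQ (intc (`|m Q / c ^+ d - b Q|)) intnf; congr integrable.
have stepE : (\int[lam]_(x in cell_set s n0 Q) (`|f x - step s n0 b x|)%:E =
    (\int[lam]_(x in cell_set s n0 Q) `|f x - b Q|)%:E)%E.
  rewrite /Rintegral fineK; last exact: integrable_fin_num.
  apply: eq_integral => x; rewrite inE => xQ.
  by rewrite (cell_set_step s0 b n0_gt0 Qn xQ).
have cde := cell_density_error mf f0 muE s0 b n0_gt0 Qn.
have pf : mu_perp (cell_set s n0 Q) \is a fin_num.
  by rewrite ge0_fin_numE// (perp_fin f0 muE).
rewrite stepE -(fineK pf) in cde *.
rewrite -EFinD -EFinM !lee_fin in cde *.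
apply: le_trans (le_normr_Rintegral mQ intd) _.
apply: le_trans (_ : \int[lam]_(x in cell_set s n0 Q) (`|m Q / c ^+ d - b Q| + `|f x - b Q|) <= _).
  apply: le_Rintegral => // x _.
  rewrite /G0 /limit_density -mulrBl normrM (@gtr0_norm _ t^-1) ?invr_gt0// ler_pdivrMr//.
  apply: le_trans (packing_limit_lipschitz a d_gt0 h_gt0 _ _) _.
  - by rewrite mulr_ge0 ?invr_ge0 ?(ltW cd0)// mulr_ge0 ?(ltW t_gt0)// cell_mass_ge0.
  - by rewrite mulr_ge0 ?(ltW t_gt0).
  rewrite -mulrA -mulrBr normrM gtr0_norm// [leRHS]mulrC ler_pM2l//.
  rewrite (_ : _ - f x = (m Q / c ^+ d - b Q) - (f x - b Q)); last by ring.
  exact: ler_normB.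
rewrite RintegralD//.
rewrite cstE.
have -> : `|m Q / c ^+ d - b Q| * c ^+ d = `|m Q - b Q * c ^+ d|.
  by rewrite -[X in _ * X](gtr0_norm cd0) -normrM mulrBl divfK ?gt_eqF.
have : 0 <= fine (mu_perp (cell_set s n0 Q)) by rewrite fine_ge0.
rewrite /m /cell_mass -/c in cde *; lra.
Qed.

(** The good cells give [2 * E], and the singular mass in them is at most another [E]. In [B] the
    singular mass has weight [1 / h] on both sides, so only [f] matters; outside the cube all is
    lost. *)
Lemma grid_target_error :
  `|grid_target a t mu s n0 B (h := h) -
    (\int[lam]_x limit_density x + fine (mu_perp setT) / h%:R)| <=
  3 * E + \int[lam]_(x in region s n0 B) f x + fine (mu (~` cube s)).
Proof.
pose WG := region s n0 (predC B); pose WB := region s n0 B.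
have mG : measurable WG by exact: measurable_region.
have mB : measurable WB by exact: measurable_region.
have mC : measurable (~` cube s : set pt) by apply: measurableC; exact: measurable_cube.
have UT : [set: pt] = WG `|` (WB `|` ~` cube s).
  apply/esym/seteqP; split => // x _.
  case: (boolP (incube s x)) => xs; last by right; right => /incubeP; apply/negP.
  by case: (boolP (B (cell_at s n0 x))) => Bx; [right; left|left]; split.
have d1 : [disjoint WG & WB `|` ~` cube s].
  apply/disj_setPS => x /= [[xs Bx] [[_ Bx']|/incubeP]]; last by rewrite xs.
  by rewrite /= Bx' in Bx.
have d2 : [disjoint WB & ~` cube s].
  by apply/disj_setPS => x /= [[xs Bx] /incubeP]; rewrite xs.
have mBC : measurable (WB `|` ~` cube s) by exact: measurableU.
have gE : \int[lam]_x limit_density x = \int[lam]_(x in WG) limit_density x +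
    (\int[lam]_(x in WB) limit_density x + \int[lam]_(x in ~` cube s) limit_density x).
  rewrite UT Rintegral_setU//; last by rewrite -UT; exact: integrable_limit_density.
  by rewrite Rintegral_setU//; exact: integrable_limit_density.
have pfin A : measurable A -> mu_perp A \is a fin_num.
  by move=> mA; rewrite ge0_fin_numE// (perp_fin f0 muE).
have pE : fine (mu_perp setT) = fine (mu_perp WG) + (fine (mu_perp WB) + fine (mu_perp (~` cube s))).
  rewrite UT measureU//; last exact/disj_set2P/d1.
  rewrite measureU//; last exact/disj_set2P/d2.
  by rewrite !fineD// ?fin_numD ?pfin.
have [gB0 gB1] := andP (limit_density_mass mB).
have [gC0 gC1] := andP (limit_density_mass mC).
have muB := fine_muE mf f0 muE mB; have muC := fine_muE mf f0 muE mC.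
have pG0 : 0 <= fine (mu_perp WG) by rewrite fine_ge0.
have pB0 : 0 <= fine (mu_perp WB) by rewrite fine_ge0.
have pC0 : 0 <= fine (mu_perp (~` cube s)) by rewrite fine_ge0.
have G_err : `|\sum_(Q <- good_cells n0 B) packing_limit d h a (t * m Q / c ^+ d) * (c ^+ d / t) -
    \int[lam]_(x in WG) limit_density x| <= 2 * E.
  rewrite cells_limit_density -sumrB.
  apply: le_trans (ler_norm_sum _ _ _) _.
  rewrite -lee_fin; apply: le_trans (_ : 2%:E * E%:E <= _)%E; last by rewrite -EFinM.
  apply: le_trans (_ : 2%:E * (\int[lam]_(x in WG) (`|f x - step s n0 b x|)%:E + mu_perp WG) <= _)%E; last first.
    by apply: lee_wpmul2l.
  rewrite /WG cells_measure// cells_integral//; first last.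
    by apply/measurable_EFinP/measurableT_comp => //; apply: measurable_funB => //; exact: measurable_step.
  rewrite -big_split/= ge0_sume_distrr => [|Q _]; last first.
    by rewrite adde_ge0// integral_ge0// => x _; rewrite lee_fin.
  rewrite -sumEFin big_seq [leRHS]big_seq; apply: lee_sum => Q.
  by rewrite mem_filter => /andP[_ Qn]; exact: cell_target_error.
have pGE : fine (mu_perp WG) <= E.
  rewrite -lee_fin fineK ?pfin//; apply: le_trans E_bound.
  by rewrite leeDr// integral_ge0// => x _; rewrite lee_fin.
have bad_mass : \sum_(Q <- bad_cells n0 B) m Q = fine (mu WB).
  by rewrite (region_mass mu s0 B n0_gt0).
rewrite /grid_target -/c -/m bad_mass gE pE muB.
have hR : 1 <= h%:R :> R by rewrite ler1n.
have hi1 : h%:R^-1 <= 1 :> R by rewrite invf_le1// ltr0n.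
have hi0 : 0 <= h%:R^-1 :> R by rewrite invr_ge0.
move: G_err; rewrite !ler_norml => /andP[g1 g2].
set SG := \sum_(Q <- _) _ in g1 g2 *.
set IG := \int[lam]_(x in WG) _ in g1 g2 *.
set fB := \int[lam]_(x in WB) f x in gB1 muB *; set gB := \int[lam]_(x in WB) _ in gB0 gB1 *.
set fC := \int[lam]_(x in ~` cube s) f x in gC1 muC *; set gC := \int[lam]_(x in ~` cube s) _ in gC0 gC1 *.
rewrite muC; set pG := fine (mu_perp WG) in pGE pG0 *; set pB := fine (mu_perp WB) in pB0 *.
set pC := fine _ in pC0 *; set i := h%:R^-1 in hi0 hi1 *.
have k1 : 0 <= fB * i <= fB by rewrite mulr_ge0 ?ler_piMr//; lra.
have k2 : 0 <= pG * i <= pG by rewrite mulr_ge0 ?ler_piMr.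
have k3 : 0 <= pC * i <= pC by rewrite mulr_ge0 ?ler_piMr.
move/andP: k1 => [k1 k1']; move/andP: k2 => [k2 k2']; move/andP: k3 => [k3 k3'].
by apply/andP; split; lra.
Qed.

End target_error.

Section mean_packing.
Context {R : realType} {d h : nat} (a : rel nat).
Hypotheses (d_gt0 : (0 < d)%N) (h_gt0 : (0 < h)%N).
Local Notation pt := (d.-tuple R).
Local Notation lam := (@lebesgue_tuple R d).
Variable mu : probability pt R.

Lemma cube_tail eps : 0 < eps -> exists2 s, 0 < s & fine (mu (~` cube s)) <= eps.
Proof.
move=> e0; pose F k : set pt := ~` cube k.+1%:R.
have mF k : measurable (F k) by apply: measurableC; exact: measurable_cube.
have F0 : \bigcap_k F k = set0.
  apply/seteqP; split => // x Fx.
  have [M HM] : exists M : nat, forall i, `|tnth x i| < M%:R.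
    exists (\max_(i < d) (Num.truncn `|tnth x i|).+1)%N => i.
    apply: lt_le_trans (Num.Theory.truncnS_gt _) _; rewrite ler_nat.
    by rewrite (bigD1 i)//= leq_maxl.
  apply: (Fx (2 * M)%N I) => i; have := HM i; rewrite ltr_norml -natr1 natrM; lra.
have ndF : nonincreasing_seq F.
  move=> k l kl; apply/subsetPset => x Fl Fk; apply: Fl => i; have := Fk i.
  have : (k.+1%:R <= l.+1%:R :> R) by rewrite ler_nat.
  by move=> kl' /andP[x1 x2]; apply/andP; split; lra.
have fin : (mu (F 0%N) < +oo)%E by apply: le_lt_trans (probability_le1 mu (mF _)) _; rewrite ltry.
have := nonincreasing_cvg_mu fin mF; rewrite F0 measure0 => /(_ measurable0 ndF).
move=> /fine_cvgP[_ /cvgrPdist_le /(_ _ e0)[k _ /(_ k (leqnn k))]] /=.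
rewrite sub0r normrN ger0_norm ?fine_ge0 ?measure_ge0// => H.
by exists k.+1%:R.
Qed.

Variables (f : pt -> R) (mu_perp : {measure set pt -> \bar R}).
Hypotheses (mf : measurable_fun setT f) (f0 : forall x, 0 <= f x)
  (muE : forall A, measurable A -> mu A = (\int[lam]_(x in A) (f x)%:E + mu_perp A)%E)
  (sing : mutually_singular mu_perp lam).

(* [B] approximates, for the measure [mu + lam], a Lebesgue-null set carrying
   [mu_perp]. *)
Lemma grid_choice eta : 0 < eta -> exists s n0 B b, [/\ 0 < s, (0 < n0)%N,
  fine (mu (~` cube s)) <= eta,
  (\int[lam]_(x in region s n0 (predC B)) (`|f x - step s n0 b x|)%:E +
    mu_perp (region s n0 (predC B)) <= (2 * eta)%:E)%E &
  \int[lam]_(x in region s n0 B) f x <= eta /\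
  (size (bad_cells (d := d) n0 B))%:R * (s / n0%:R) ^+ d <= eta].
Proof.
move=> e0; have [s s0 mus] := cube_tail e0.
have [A [mA pA lA]] := sing.
have mcube : measurable (cube s : set pt) by exact: measurable_cube.
have nu_fin : (measure_add mu lam (cube s) < +oo)%E.
  rewrite measure_addE; apply: (@le_lt_trans _ _ (1 + (s ^+ d)%:E)%E); last by rewrite -EFinD ltry.
  apply: leeD; first exact: probability_le1.
  by have /eqP := @lebesgue_cube R d s s0; rewrite eq_le => /andP[].
(* [A] is null for [mu_perp]; it is its complement that carries the singular part while being
   Lebesgue-null. *)
have [_ /(_ _ e0)[n1 [n1_gt0 [B1 HB1]]]] := measurable_grid_approximable s0 nu_fin (measurableC mA).
have [n2 [n2_gt0 [b2 Hb2]]] := integrable_step_approx s0 e0 mf (density_integrable mf f0 muE mcube).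
(* The singular support and the density are approximated on different grids; the product refines
   both. *)
pose n0 := (n1 * n2)%N; have n0_gt0 : (0 < n0)%N by rewrite muln_gt0 n1_gt0.
pose B c := B1 (cdiv n2 c); pose b c := b2 (cdiv n1 c).
have rB : region s n0 B = region s n1 B1 by exact: region_cdiv.
have rG : region s n0 (predC B) = region s n1 (predC B1) by rewrite -(region_cdiv s0 (predC B1) n1_gt0 n2_gt0).
have mB : measurable (region s n0 B) by exact: measurable_region.
have mG : measurable (region s n0 (predC B)) by exact: measurable_region.
have mD : measurable (grid_diff s n1 B1 (~` A)) by apply: measurable_grid_diff => //; exact: measurableC.
have HB : (mu (grid_diff s n1 B1 (~` A)) + lam (grid_diff s n1 B1 (~` A)) <= eta%:E)%E.
  by rewrite -measure_addE.
have muD : (mu (grid_diff s n1 B1 (~` A)) <= eta%:E)%E.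
  by apply: le_trans HB; rewrite leeDl.
have lamD : (lam (grid_diff s n1 B1 (~` A)) <= eta%:E)%E.
  by apply: le_trans HB; rewrite leeDr.
have BD : region s n0 B `&` A `<=` grid_diff s n1 B1 (~` A).
  by move=> x; rewrite rB => -[[xs Bx] Ax]; split=> //= -[_ /(_ Bx)].
have GD : region s n0 (predC B) `&` ~` A `<=` grid_diff s n1 B1 (~` A).
  by move=> x; rewrite rG => -[[xs /negP Bx] nAx]; split=> //= -[/(_ nAx)].
have lamB : (lam (region s n0 B) <= eta%:E)%E.
  have DE : (lam (region s n0 B) = lam (region s n0 B `\` A) + lam (region s n0 B `&` A))%E.
    exact: measureDI.
  rewrite DE (_ : lam (_ `\` A) = 0%E); last first.
    by apply: (subset_measure0 _ _ _ lA); [exact: measurableD|exact: measurableC|move=> x []].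
  rewrite add0e; apply: le_trans lamD; apply: le_measure; rewrite ?inE//.
  exact: measurableI.
exists s, n0, B, b; split => //.
- rewrite (_ : 2 * eta = eta + eta); last by ring.
  rewrite EFinD; apply: leeD.
    apply: le_trans _ Hb2.
    rewrite (eq_integral (fun x => `|f x - step s n2 b2 x|%:E)) => [|x]; last first.
      rewrite inE => -[xs _]; rewrite !step_cell// /b /n0 mulnC cell_at_cdiv//.
    apply: ge0_subset_integral => //.
    + apply/measurable_EFinP/measurable_funTS/measurableT_comp => //.
      by apply: measurable_funB => //; exact: measurable_step.
    + by move=> x [/incubeP].
  have DE : (mu_perp (region s n0 (predC B)) = mu_perp (region s n0 (predC B) `\` A) +
      mu_perp (region s n0 (predC B) `&` A))%E by exact: measureDI.
  rewrite DE (_ : mu_perp (_ `&` A) = 0%E) ?adde0; last first.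
    by apply: (subset_measure0 _ _ _ pA); [exact: measurableI| |move=> x []].
  apply: le_trans muD; apply: le_trans (perp_le f0 muE _) _; first exact: measurableD.
  by apply: le_measure; rewrite ?inE//; exact: measurableD.
- split.
    have intB := density_integrable mf f0 muE mB.
    rewrite -lee_fin /Rintegral fineK; last exact: integrable_fin_num.
    rewrite (ge0_negligible_integral (measurableC mA))//; last 2 first.
    - by apply/measurable_EFinP; exact: measurable_funTS.
    - by move=> x _; rewrite lee_fin.
    have mBA : measurable (region s n0 B `\` ~` A) by apply: measurableD => //; exact: measurableC.
    apply: le_trans (density_le muE mBA) _; apply: le_trans muD.
    by apply: le_measure; rewrite ?inE// setDE setCK.
  rewrite -lee_fin; apply: le_trans lamB.
  rewrite cells_measure// (eq_bigr (fun=> ((s / n0%:R) ^+ d)%:E)) => [|c _]; last first.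
    exact: lebesgue_cell_set.
  by rewrite sumEFin big_const_seq count_predT iter_addr addr0 mulr_natl.
Qed.

Hypothesis mu_diffuse : forall x, mu [set x] = 0%E.
Variables (r : nat -> R) (t : R).
Hypotheses (r_gt0 : forall n, (0 < n)%N -> 0 < r n) (t_gt0 : 0 < t)
  (r_lim : n%:R * r n ^+ d @[n --> \oo] --> t) (a_conn : index_connected h a).
Context {dO : measure_display} {Omega : measurableType dO}.
Variables (P : probability Omega R) (X : nat -> {RV P >-> pt}).
Hypotheses (X_law : forall i A, measurable A -> distribution P (X i) A = mu A)
  (X_indep : mutually_independent P X).

Lemma npk_sample_mean_cvg :
  mean_rv P (npk_sample (h := h) a X n (r n)) / n%:R @[n --> \oo] -->
  \int[lam]_x limit_density (h := h) a t f x + fine (mu_perp setT) / h%:R.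
Proof.
set L := _ + _; apply/cvgrPdist_le => eps e0.
pose K := 2 * (2 * d%:R) ^+ d / t; have K0 : 0 <= K.
  by rewrite divr_ge0 ?(ltW t_gt0)// mulr_ge0// exprn_ge0// mulr_ge0.
(* With [E = 2 * eta] the shares of [eta] are 1 for leaving the cube, [4 + K + 1] from
   [box_mean_limit] and [6 + 1 + 1] from [grid_target_error]. *)
pose eta := eps / (14 + K); have eta0 : 0 < eta by rewrite divr_gt0// ltr_wpDr.
have [s [n0 [B [b [s0 n0_gt0 mus Eb [fB badB]]]]]] := grid_choice eta0.
have [n1 Hn1] := box_mean_limit d_gt0 h_gt0 r_gt0 t_gt0 r_lim a_conn mf f0 muE X_law X_indep
  s0 n0_gt0 Eb eta0.
have T := grid_target_error a d_gt0 h_gt0 t_gt0 mf f0 muE s0 n0_gt0 Eb.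
exists (maxn 1 n1) => // n; rewrite /= geq_max => /andP[n_gt0 nn1].
have nR : 0 < n%:R :> R by rewrite ltr0n.
have S := npk_sample_box a h_gt0 X_law X_indep n (r_gt0 n_gt0) mu_diffuse s0.
have {}S : `|mean_rv P (npk_sample (h := h) a X n (r n)) / n%:R -
    box_mean (h := h) a X s n (r n) / n%:R| <= eta.
  rewrite -mulrBl normrM (@gtr0_norm _ n%:R^-1) ?invr_gt0// ler_pdivrMr// mulrC.
  by apply: le_trans S _; rewrite ler_pM2l.
have M := Hn1 n nn1; rewrite -/K in M.
have bK : (size (bad_cells n0 B))%:R * (s / n0%:R) ^+ d * K <= eta * K by rewrite ler_wpM2r.
have -> : eps = 14 * eta + eta * K by rewrite /eta; field; rewrite gt_eqF// ltr_wpDr.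
move: S M T bK fB mus; rewrite -/L; clear.
move: (mean_rv _ _ / _) (box_mean _ _ _ _ _ / _) (grid_target _ _ _ _ _ _) L => x y z L.
move: (_ * K) (eta * K) (\int[lam]_(x in _) _) (fine _) => u v w q.
by rewrite !ler_norml => /andP[? ?] /andP[? ?] /andP[? ?] *; apply/andP; split; lra.
Qed.

End mean_packing.

(** * Concentration *)

Lemma edist_dilate (R : realType) (d : nat) (c : R) (x y : d.-tuple R) : 0 < c ->
  edist (dilate c x) (dilate c y) = c * edist x y.
Proof.
move=> c0; rewrite /edist (eq_bigr (fun i => c ^+ 2 * (tnth x i - tnth y i) ^+ 2)).
  by rewrite -mulr_sumr sqrtrM ?sqr_ge0// sqrtr_sqr gtr0_norm.
by move=> i _; rewrite !tnth_mktuple -mulrBr exprMn.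
Qed.

Lemma dilate_inj (R : realType) (d : nat) (c : R) : 0 < c -> injective (@dilate R d c).
Proof.
move=> c0 x y /(congr1 (fun z => tnth z)) xy; apply: eq_from_tnth => i.
by have := congr1 (fun g => g i) xy; rewrite !tnth_mktuple => /(mulfI (lt0r_neq0 c0)).
Qed.

Section dilated_sample.
Context {R : realType} {d h : nat} (U : choiceType) (H : graph U) (u0 : U).
Hypotheses (h_gt0 : (0 < h)%N) (H_card : #|` vertices H| = h).
Context {dO : measure_display} {Omega : measurableType dO}.
Variables (P : probability Omega R) (X : nat -> {RV P >-> d.-tuple R}).

(** Dilation is injective and turns distance at most [r] into distance at most 1; the set of sampled
    points is the sample without repetitions. *)
Lemma psi_dilate (n : nat) (r : R) (w : Omega) : 0 < r ->
  (psi H (dilate_fset r^-1 [fset X i w | i in iota 0 n]%fset))%:R =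
  npk_sample (h := h) (index_adj H u0) X n r w.
Proof.
move=> r0; have ri0 : 0 < r^-1 by rewrite invr_gt0.
rewrite (psiE u0) ?H_card// /npk_sample /npk; congr (_%:R).
rewrite -(pk_map (index_adj H u0) h_gt0 (g := dilate r^-1) (e := close r)
   (e' := fun x y => edist x y <= 1)); last first.
  by move=> x y _ _; rewrite edist_dilate// ler_pdivrMl// mulr1.
apply: pk_perm => //; apply: uniq_perm.
- exact: fset_uniq.
- by rewrite (map_inj_uniq (dilate_inj ri0)) undup_uniq.
- move=> x; rewrite /dilate_fset; apply/imfsetP/mapP => [[y /imfsetP[i /= ii ->] ->]|[y]].
    by exists (X i w) => //; rewrite mem_undup; apply/mapP; exists i.
  rewrite mem_undup => /mapP[i ii ->] ->; exists (X i w) => //.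
  by apply/imfsetP; exists i.
Qed.

End dilated_sample.

Section concentration.
Context {R : realType} {d h : nat} (a : rel nat).
Hypothesis h_gt0 : (0 < h)%N.
Local Notation pt := (d.-tuple R).
Variable mu : probability pt R.
Context {dO : measure_display} {Omega : measurableType dO}.
Variables (P : probability Omega R) (X : nat -> {RV P >-> pt}).
Hypotheses (X_law : forall i A, measurable A -> distribution P (X i) A = mu A)
  (X_indep : mutually_independent P X).
Variable r : nat -> R.
Hypothesis r_gt0 : forall n, (0 < n)%N -> 0 < r n.
Local Notation Z n := (npk_sample (h := h) a X n (r n)).

(** Markov's inequality for the exponential of the deviation; [b] of either sign covers both
    tails. *)
Lemma npk_sample_chernoff n (b e : R) : (0 < n)%N -> `|b| <= 1 / 2 ->
  (P [set w | (n%:R * e <= b * (Z n w - mean_rv P (Z n)))%R] <=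
  (expR (n%:R * (2 * b ^+ 2 - e)))%:E)%E.
Proof.
move=> n_gt0 bb; have rn := r_gt0 n_gt0.
have [bE /(_ bb) HE] := bounded_rv_exp a h_gt0 X_law X_indep n rn b.
have bZ := bounded_rv_npk_sample a h_gt0 X n rn.
set M := mean_rv P (Z n) in HE *.
set A := [set w | _].
have mA : measurable A.
  have bb' : bounded_rv (fun w => b * (Z n w - M)).
    by apply: bounded_rvZ; apply: bounded_rvB => //; exact: bounded_rv_cst.
  rewrite (_ : A = (fun w => b * (Z n w - M)) @^-1` `[n%:R * e, +oo[%classic).
    by rewrite -[X in measurable X]setTI; apply: bb'.1 => //; exact: measurable_itv.
  by apply/seteqP; split => w; rewrite /A /= in_itv/= andbT.
have PA : P A \is a fin_num by rewrite ge0_fin_numE// (le_lt_trans (probability_le1 P mA)) ?ltry.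
rewrite -(fineK PA) lee_fin -mean_rv_indic//.
apply: (@le_trans _ _ (mean_rv P (fun w => expR (- (b * M + n%:R * e)) * expR (b * Z n w)))).
  apply: mean_rv_le => //; first exact: bounded_rv_indic.
    exact: bounded_rvZ.
  move=> w; rewrite -expRD indicE; case: (boolP (w \in A)) => [|_]; last exact: expR_ge0.
  rewrite inE => Aw; have {}Aw : n%:R * e <= b * (Z n w - M) := Aw.
  by rewrite [leLHS](_ : _ = expR 0) ?ler_expR; [lra|rewrite expR0].
rewrite mean_rvZ//; apply: le_trans (ler_wpM2l (expR_ge0 _) HE) _.
by rewrite -expRD ler_expR; lra.
Qed.

Lemma npk_sample_tail (L : R) : mean_rv P (Z n) / n%:R @[n --> \oo] --> L ->
  forall eps, 0 < eps -> exists K q, [/\ 0 <= K, 0 < q < 1 & forall n, (0 < n)%N ->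
    (P [set w | (eps < `|n%:R^-1 * Z n w - L|)%R] <= (K * q ^+ n)%:E)%E].
Proof.
move=> lim eps e0; have e2 : 0 < eps / 2 by rewrite divr_gt0.
have /cvgrPdist_le/(_ _ e2)[n1 _ Hn1] := lim.
(* With [e = b * eps / 2], [b <= eps / 8] gives [2 * b ^+ 2 - e <= - (b * eps / 4)], the exponent in
   [q]; the exponential bound asks for [b <= 1 / 2]. *)
pose b := Num.min (eps / 8) (1 / 2); have b0 : 0 < b by rewrite lt_min !divr_gt0.
have b1 : b <= eps / 8 by rewrite ge_min lexx.
have b2 : b <= 1 / 2 by rewrite ge_min lexx orbT.
have be0 : 0 < b * eps / 4 by rewrite divr_gt0 ?mulr_gt0.
pose q := expR (- (b * eps / 4)); have q0 : 0 < q by exact: expR_gt0.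
have q1 : q < 1 by rewrite expR_lt1 oppr_lt0.
(* 2 counts the tails; [q ^- n1] makes the bound trivial for [n < n1], where the mean need not be
   near [L]. *)
pose K := Num.max 2 (q ^- n1); have K2 : 2 <= K by rewrite le_max lexx.
have K0 : 0 <= K by exact: le_trans K2.
exists K, q; split => //; first by rewrite q0 q1.
move=> n n_gt0; have rn := r_gt0 n_gt0; have nR : 0 < n%:R :> R by rewrite ltr0n.
have bZ := bounded_rv_npk_sample a h_gt0 X n rn.
have mle (g : Omega -> R) c : bounded_rv g -> measurable [set w | c <= g w].
  move=> bg; rewrite (_ : [set w | _] = g @^-1` `[c, +oo[%classic).
    by rewrite -[X in measurable X]setTI; apply: bg.1 => //; exact: measurable_itv.
  by apply/seteqP; split => w; rewrite /= in_itv/= andbT.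
have mlt (g : Omega -> R) c : measurable_fun setT g -> measurable [set w | c < g w].
  move=> mg; rewrite (_ : [set w | _] = g @^-1` `]c, +oo[%classic).
    by rewrite -[X in measurable X]setTI; apply: mg => //; exact: measurable_itv.
  by apply/seteqP; split => w; rewrite /= in_itv/= andbT.
have mA : measurable [set w | eps < `|n%:R^-1 * Z n w - L|].
  apply: mlt; apply: measurableT_comp => //; apply: measurable_funB => //.
  exact: (bounded_rvZ _ bZ).1.
have [nn1|n1n] := ltnP n n1.
  apply: le_trans (probability_le1 P mA) _; rewrite lee_fin.
  apply: (@le_trans _ _ (q ^- n1 * q ^+ n)); last by rewrite ler_wpM2r ?exprn_ge0 ?(ltW q0)// le_max lexx orbT.
  rewrite ler_pdivlMl ?exprn_gt0// mulr1.
  by apply: ler_wiXn2l; rewrite ?(ltW q0) ?(ltW q1)// ltnW.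
set M := mean_rv P (Z n) in Hn1 *.
have ML := Hn1 n n1n; rewrite /= distrC -/M in ML.
pose A1 := [set w | n%:R * (b * eps / 2) <= b * (Z n w - M)].
pose A2 := [set w | n%:R * (b * eps / 2) <= - b * (Z n w - M)].
have bZM : bounded_rv (fun w => Z n w - M) by apply: bounded_rvB => //; exact: bounded_rv_cst.
have mA1 : measurable A1 by apply: mle; exact: bounded_rvZ.
have mA2 : measurable A2 by apply: mle; exact: bounded_rvZ.
apply: (@le_trans _ _ (P A1 + P A2)%E).
  apply: le_trans (measureU2 P mA1 mA2); apply: le_measure; rewrite ?inE//; first exact: measurableU.
  move=> w /= Ew.
  have : eps / 2 <= `|n%:R^-1 * Z n w - M / n%:R|.
    have := ler_normD (n%:R^-1 * Z n w - M / n%:R) (M / n%:R - L).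
    rewrite addrA subrK; lra.
  rewrite [M / _]mulrC -mulrBr normrM gtr0_norm ?invr_gt0// ler_pdivlMl// => H.
  rewrite /A1 /A2 /=.
  have -> : n%:R * (b * eps / 2) = b * (n%:R * (eps / 2)) by ring.
  case: (lerP 0 (Z n w - M)) => s0.
    by left; rewrite ler_pM2l//; rewrite ger0_norm in H.
  by right; rewrite mulNr -mulrN ler_pM2l//; rewrite ltr0_norm in H.
have ch b' : `|b'| = b -> (P [set w | (n%:R * (b * eps / 2) <= b' * (Z n w - M))%R] <= (q ^+ n)%:E)%E.
  move=> b'b; apply: le_trans (npk_sample_chernoff _ n_gt0 _) _; first by rewrite b'b.
  rewrite lee_fin /q -expRM_natl ler_expR -mulrN ler_pM2l//.
  have -> : b' ^+ 2 = b ^+ 2 by rewrite -b'b real_normK ?num_real.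
  have : b * b <= b * (eps / 8) by rewrite ler_pM2l.
  rewrite expr2; lra.
have := leeD (ch b (gtr0_norm b0)) (ch (- b) _); rewrite normrN => /(_ (gtr0_norm b0)) H.
apply: le_trans H _; rewrite -EFinD lee_fin -mulr2n -mulr_natl.
by rewrite ler_wpM2r// exprn_ge0// ltW.
Qed.

Lemma npk_sample_converges_completely (L : R) : mean_rv P (Z n) / n%:R @[n --> \oo] --> L ->
  converges_completely P (fun n w => n%:R^-1 * Z n w) L.
Proof.
move=> lim eps e0; have [K [q [K0 /andP[q0 q1] H]]] := npk_sample_tail lim e0.
have q1' : 0 < 1 - q by rewrite subr_gt0.
apply: (@le_lt_trans _ _ (K / (1 - q))%:E); last by rewrite ltry.
apply: lime_le; first by apply: is_cvg_nneseries => n _ _; exact: measure_ge0.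
apply: nearW => N.
apply: (@le_trans _ _ (\sum_(1 <= n < N) (K * q ^+ n)%:E)%E).
  by rewrite big_nat [leRHS]big_nat; apply: lee_sum => n /andP[n1 _]; exact: H.
rewrite sumEFin lee_fin -mulr_sumr ler_wpM2l// -[leRHS]mul1r ler_pdivlMr//.
apply: (@le_trans _ _ ((\sum_(n < N) q ^+ n) * (1 - q))).
  rewrite ler_pM2r//; case: N => [|N]; first by rewrite big_geq// big_ord0.
  rewrite -(big_mkord xpredT (fun n => q ^+ n)) [leRHS]big_ltn// lerDr expr0 //.
have := subrX1 q N; have := exprn_ge0 N (ltW q0); nra.
Qed.

Lemma npk_sample_converges_L2 (L : R) : mean_rv P (Z n) / n%:R @[n --> \oo] --> L ->
  converges_L2 P (fun n w => n%:R^-1 * Z n w) L.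
Proof.
move=> lim.
pose V n := mean_rv P (fun w => (n%:R^-1 * Z n w - L) ^+ 2).
have bV n : (0 < n)%N -> bounded_rv (fun w => (n%:R^-1 * Z n w - L) ^+ 2).
  move=> n_gt0; have bZ := bounded_rv_npk_sample a h_gt0 X n (r_gt0 n_gt0).
  have bD : bounded_rv (fun w => n%:R^-1 * Z n w - L).
    by apply: bounded_rvB; [exact: bounded_rvZ|exact: bounded_rv_cst].
  exact: (bounded_rvM bD bD).
suff VL : V n @[n --> \oo] --> 0.
  have : (V n)%:E @[n --> \oo] --> 0%:E by apply: cvg_EFin => //; exact: nearW.
  apply: cvg_trans; apply: near_eq_cvg; exists 1%N => // n /= n_gt0.
  by rewrite mean_rvE//; exact: bV.
apply/cvgrPdist_le => eps e0.
(* [e1 <= 1] gives [e1 ^+ 2 <= e1], so outcomes of small deviation contribute at most [eps / 2]. *)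
pose e1 := Num.min 1 (eps / 2); have e10 : 0 < e1 by rewrite lt_min ltr01 divr_gt0.
have e11 : e1 <= 1 by rewrite ge_min lexx.
have e12 : e1 <= eps / 2 by rewrite ge_min lexx orbT.
have [K [q [K0 /andP[q0 q1] H]]] := npk_sample_tail lim e10.
(* The normalised packing number lies in the unit interval, so [D] bounds the squared deviation on
   the rare event. *)
pose D := (1 + `|L|) ^+ 2; have D0 : 0 <= D by exact: sqr_ge0.
have lq : D * (K * q ^+ n) @[n --> \oo] --> 0.
  rewrite -(mulr0 D); apply: cvgM; first exact: cvg_cst.
  rewrite -(mulr0 K); apply: cvgM; first exact: cvg_cst.
  by apply: cvg_expr; rewrite gtr0_norm.
have e2 : 0 < eps / 2 by rewrite divr_gt0.
have /cvgrPdist_le/(_ _ e2)[n1 _ Hn1] := lq.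
exists (maxn 1 n1) => // n; rewrite /= geq_max => /andP[n_gt0 nn1].
have rn := r_gt0 n_gt0; have nR : 0 < n%:R :> R by rewrite ltr0n.
have bZ := bounded_rv_npk_sample a h_gt0 X n rn.
have V0 : 0 <= V n by apply: Rintegral_ge0 => w _; exact: sqr_ge0.
rewrite sub0r normrN ger0_norm//.
pose A := [set w | e1 < `|n%:R^-1 * Z n w - L|].
have mA : measurable A.
  have mg : measurable_fun setT (fun w => `|n%:R^-1 * Z n w - L|).
    by apply: measurableT_comp => //; apply: measurable_funB => //; exact: (bounded_rvZ _ bZ).1.
  rewrite (_ : A = (fun w => `|n%:R^-1 * Z n w - L|) @^-1` `]e1, +oo[%classic).
    by rewrite -[X in measurable X]setTI; apply: mg => //; exact: measurable_itv.
  by apply/seteqP; split => w; rewrite /A /= in_itv/= andbT.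
apply: (@le_trans _ _ (mean_rv P (fun w => e1 + D * \1_A w))).
  apply: mean_rv_le; first exact: bV.
    apply: bounded_rvD; first exact: bounded_rv_cst.
    exact/bounded_rvZ/bounded_rv_indic.
  move=> w; rewrite indicE; have [wA|wA] := boolP (w \in A).
    rewrite mulr1; apply: ler_wpDl; first exact: ltW.
    rewrite /D -real_normK ?num_real// ler_sqr ?nnegrE ?addr_ge0//.
    apply: le_trans (ler_normB _ _) _; rewrite lerD2r ger0_norm; last first.
      by rewrite mulr_ge0 ?invr_ge0 ?(ltW nR)// npk_ge0.
    rewrite ler_pdivrMl// mulr1.
    have /andP[_ Zn] := npk_sample_le (h := h) a X n (r n) w.
    by apply: le_trans Zn; rewrite ler_peMl ?npk_ge0// ler1n.
  rewrite mulr0 addr0; move: wA; rewrite notin_setE /A /= => /negP; rewrite -leNgt => Aw.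
  rewrite -real_normK ?num_real//; apply: le_trans (_ : e1 ^+ 2 <= _).
    by rewrite ler_sqr ?nnegrE ?(ltW e10).
  by rewrite expr2 ler_piMr// ltW.
have bA := bounded_rv_indic mA.
rewrite mean_rvD; [|exact: bounded_rv_cst|exact: bounded_rvZ].
rewrite mean_rv_cst mean_rvZ// mean_rv_indic//.
have PA : P A \is a fin_num by rewrite ge0_fin_numE// (le_lt_trans (probability_le1 P mA)) ?ltry.
have PAq : fine (P A) <= K * q ^+ n by rewrite -lee_fin fineK//; exact: H.
have := Hn1 n nn1; rewrite /= sub0r normrN => /(le_trans (ler_norm _)) Dq.
have : D * fine (P A) <= D * (K * q ^+ n) by rewrite ler_wpM2l.
lra.
Qed.

End concentration.

(** * Poisson processes *)

Section multinomial.
Context {R : realType} {C : eqType}.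
Implicit Types (cs l : seq C) (F : seq C -> R).

(* The sum of [F] over the multisets of [k] elements of [cs], the multiset with
   multiplicities [n_c] having weight [\prod_c 1 / n_c!]. *)
Fixpoint multiset_sum cs (k : nat) F : R :=
  if cs is c :: cs' then
    \sum_(j < k.+1) j`!%:R^-1 * multiset_sum cs' (k - j) (fun l => F (nseq j c ++ l))
  else (k == 0)%:R * F [::].

Definition symmetric_fun F := forall l1 l2, perm_eq l1 l2 -> F l1 = F l2.

Lemma symmetric_fun_cat l F : symmetric_fun F -> symmetric_fun (fun l' => F (l ++ l')).
Proof. by move=> FS l1 l2 l12; apply: FS; rewrite perm_cat2l. Qed.

Lemma multiset_sum0 cs F : multiset_sum cs 0 F = F [::].
Proof.
elim: cs F => [|c cs IH] F /=; first by rewrite mul1r.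
by rewrite big_ord_recl big_ord0 addr0 IH fact0 invr1 mul1r.
Qed.

(* Both sides sum over the multisets with one marked element. *)
Lemma multiset_sumS cs k F : symmetric_fun F ->
  k.+1%:R * multiset_sum cs k.+1 F = \sum_(c <- cs) multiset_sum cs k (fun l => F (c :: l)).
Proof.
elim: cs k F => [|c0 cs IH] k F FS; first by rewrite big_nil /= mul0r mulr0.
rewrite [multiset_sum _ _ _]/= big_cons.
pose G j l := F (nseq j c0 ++ l).
have GS j : symmetric_fun (G j) by exact: symmetric_fun_cat.
rewrite mulr_sumr (eq_bigr (fun j : 'I_k.+2 =>
    j%:R * (j`!%:R^-1 * multiset_sum cs (k.+1 - j) (G j)) +
    j`!%:R^-1 * ((k.+1 - j)%:R * multiset_sum cs (k.+1 - j) (G j)))); last first.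
  move=> j _; have -> : k.+1%:R = j%:R + (k.+1 - j)%:R :> R.
    by rewrite -natrD subnKC// -ltnS.
  by rewrite -/(G j); ring.
rewrite big_split/=; congr (_ + _).
  rewrite big_ord_recl/= mul0r add0r; apply: eq_bigr => i _.
  rewrite /bump/= add1n factS natrM invfM mulrA mulrA mulfV ?mul1r ?pnatr_eq0//.
rewrite big_ord_recr/= subnn mul0r mulr0 addr0.
rewrite exchange_big/=; apply: eq_bigr => j _.
have jk : (j <= k)%N by rewrite -ltnS.
rewrite subSn// IH// mulr_sumr; apply: eq_bigr => c _; congr (_ * _).
congr multiset_sum; apply/funext => l; apply: FS.
by rewrite perm_catC /= perm_cons perm_catC.
Qed.

(** The multinomial formula for the uniform law on [cs]: a multiset of size [k] with multiplicities
    [n_c] is the content of [k!] over the product of the [n_c!] many words. *)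
Lemma multiset_sum_iid cs (M : mean R C) k F : symmetric_fun F ->
  (forall f, (size cs)%:R * M f = \sum_(c <- cs) f c) ->
  k`!%:R * multiset_sum cs k F = (size cs)%:R ^+ k * iid M k F.
Proof.
move=> + HM; elim: k F => [|k IH] F FS.
  by rewrite multiset_sum0 iid0 fact0 expr0.
rewrite factS mulnC natrM -mulrA multiset_sumS// mulr_sumr.
rewrite (eq_bigr (fun c => (size cs)%:R ^+ k * iid M k (fun l => F (c :: l)))) => [|c _].
  by rewrite -mulr_sumr -HM -iidS exprSr mulrA.
by apply: IH; exact: (@symmetric_fun_cat [:: c]).
Qed.

End multinomial.

Section independent_counts.
Context {R : realType} {C : eqType} {dO : measure_display} {Omega : measurableType dO}.
Variables (P : probability Omega R) (cnt : C -> Omega -> nat) (cs0 : seq C) (p : R).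
Hypothesis p_gt0 : 0 < p.
Hypothesis cnt_meas : forall c j, measurable [set w | cnt c w = j].
Hypothesis cnt_indep : forall l (v : C -> nat), uniq l -> {subset l <= cs0} ->
  P [set w | forall c, c \in l -> cnt c w = v c] = (\prod_(c <- l) (poisson_pmf p (v c))%:E)%E.
Implicit Types (cs l : seq C) (F : seq C -> R).

(** Fixing the total makes the variable bounded and dependent on finitely many values of the
    counts. *)
Definition counted_fun cs (k : nat) F (w : Omega) : R :=
  (\sum_(c <- cs) cnt c w == k)%N%:R * F (flatten [seq nseq (cnt c w) c | c <- cs]).

Lemma counted_fun_cons c cs k F w : counted_fun (c :: cs) k F w =
  \sum_(j < k.+1) (cnt c w == j)%:R * counted_fun cs (k - j) (fun l => F (nseq j c ++ l)) w.
Proof.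
rewrite /counted_fun big_cons/=.
have [ck|ck] := leqP (cnt c w) k; last first.
  rewrite [RHS]big1 => [|j _]; last first.
    rewrite (_ : (cnt c w == j) = false) ?mul0r//.
    by apply/negbTE/eqP => E; move: ck; rewrite E ltnNge -ltnS ltn_ord.
  rewrite (_ : (_ + _ == k)%N = false) ?mul0r//.
  by apply/negbTE/eqP => E; move: ck; rewrite -E ltnNge leq_addr.
rewrite [RHS](bigD1 (Ordinal (ck : cnt c w < k.+1)%N))//= eqxx mul1r [X in _ = _ + X]big1 ?addr0 => [|j /eqP jc]; last first.
  by case: eqP => [E|_]; [case: jc; apply: val_inj|rewrite mul0r].
by rewrite -(eqn_add2l (cnt c w) _ (k - _)) subnKC.
Qed.

Let bounded_rv_cnt c j : bounded_rv (fun w => (cnt c w == j)%:R : R).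
Proof.
rewrite (_ : (fun w => _) = \1_[set w | cnt c w = j]).
  by apply: bounded_rv_indic; exact: cnt_meas.
apply/funext => w; rewrite indicE; congr ((nat_of_bool _)%:R).
by apply/idP/idP => [/eqP E|]; [rewrite inE|rewrite inE => /eqP].
Qed.

Let bounded_rv_prod l (v : C -> nat) :
  bounded_rv (fun w => \prod_(c <- l) (cnt c w == v c)%:R : R).
Proof.
elim: l => [|c l IH].
  by under eq_fun do rewrite big_nil; exact: bounded_rv_cst.
by under eq_fun do rewrite big_cons; exact: bounded_rvM.
Qed.

Lemma bounded_rv_counted_fun cs k F : bounded_rv (counted_fun cs k F).
Proof.
elim: cs k F => [|c cs IH] k F.
  rewrite (_ : counted_fun _ _ _ = fun=> (0 == k)%:R * F [::]); first exact: bounded_rv_cst.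
  by apply/funext => w; rewrite /counted_fun big_nil.
rewrite (_ : counted_fun _ _ _ = fun w => \sum_(j < k.+1) (cnt c w == j)%:R *
    counted_fun cs (k - j) (fun l => F (nseq j c ++ l)) w).
  by apply: bounded_rv_sum => j; exact: bounded_rvM.
by apply/funext => w; exact: counted_fun_cons.
Qed.

Lemma mean_prod_cnt l (v : C -> nat) : uniq l -> {subset l <= cs0} ->
  mean_rv P (fun w => \prod_(c <- l) (cnt c w == v c)%:R) = \prod_(c <- l) poisson_pmf p (v c).
Proof.
move=> lu lcs; pose A := [set w | forall c, c \in l -> cnt c w = v c].
have mA : measurable A.
  rewrite (_ : A = \bigcap_(c in [set` l]) [set w | cnt c w = v c]).
    by apply: fin_bigcap_measurable => // c _; exact: cnt_meas.
  by apply/seteqP; split => w H c; exact: H.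
rewrite (_ : (fun w => _) = \1_A).
  by rewrite mean_rv_indic// cnt_indep// prodEFin.
apply/funext => w; rewrite indicE; have [wA|wA] := boolP (w \in A).
  rewrite big_seq big1// => c cl; move: wA; rewrite inE => /(_ c cl) ->.
  by rewrite eqxx.
have : ~~ all (fun c => cnt c w == v c) l.
  apply: contra wA => /allP H; rewrite inE => c cl; exact/eqP/H.
move=> /allPn[c cl nc]; rewrite (big_rem c)//= (negPf nc) mul0r//.
Qed.

(** The product over [l] records the counts already fixed, so that joint independence is used only
    once [cs] is exhausted. Each cell of [cs] contributes [expR (- p)], each point a factor [p]. *)
Lemma mean_counted_fun l v cs k F : uniq (l ++ cs) -> {subset l ++ cs <= cs0} ->
  mean_rv P (fun w => (\prod_(c <- l) (cnt c w == v c)%:R) * counted_fun cs k F w) =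
  (\prod_(c <- l) poisson_pmf p (v c)) * (expR (- p) ^+ size cs * p ^+ k * multiset_sum cs k F).
Proof.
elim: cs l v k F => [|c cs IH] l v k F.
  rewrite cats0 => lu lcs.
  rewrite (_ : (fun w => _) = fun w => ((0%N == k)%:R * F [::]) * (\prod_(c <- l) (cnt c w == v c)%:R)).
    rewrite mean_rvZ ?mean_prod_cnt//= expr0 mul1r mulrC eq_sym; congr (_ * _).
    by case: eqP => [->|_]; rewrite ?mul0r ?mulr0// expr0 !mul1r.
  by apply/funext => w; rewrite /counted_fun big_nil mulrC.
move=> lu lcs.
have cl : c \notin l.
  by move: lu; rewrite cat_uniq /= => /and3P[_ /norP[]].
rewrite (_ : (fun w => _) = fun w => \sum_(j < k.+1)
   (\prod_(i <- c :: l) (cnt i w == (if i == c then (j : nat) else v i))%:R) *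
   counted_fun cs (k - j) (fun l => F (nseq j c ++ l)) w); last first.
  apply/funext => w; rewrite counted_fun_cons mulr_sumr; apply: eq_bigr => j _.
  rewrite big_cons eqxx mulrCA mulrA; congr (_ * _ * _).
  by apply: eq_big_seq => i il; rewrite ifN//; apply: contraNneq cl => <-.
have pu : perm_eq ((c :: l) ++ cs) (l ++ c :: cs) by rewrite /= -cat1s perm_catCA.
rewrite mean_rv_sum => [|j]; last by apply: bounded_rvM; [exact: bounded_rv_prod|exact: bounded_rv_counted_fun].
rewrite [in RHS]/= mulr_sumr mulr_sumr; apply: eq_bigr => j _.
rewrite IH; last 2 first.
- by rewrite (perm_uniq pu).
- by move=> i; rewrite (perm_mem pu) => /lcs.
rewrite big_cons eqxx {1}/poisson_pmf p_gt0.
rewrite (_ : \prod_(i <- l) _ = \prod_(i <- l) poisson_pmf p (v i)); last first.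
  by apply: eq_big_seq => i il; rewrite ifN//; apply: contraNneq cl => <-.
have jk : (j <= k)%N by rewrite -ltnS.
rewrite exprS -[in p ^+ k](subnKC jk) exprD; ring.
Qed.

End independent_counts.

Lemma perm_flatten_nseq (C : eqType) (cs l : seq C) : uniq cs -> {subset l <= cs} ->
  perm_eq (flatten [seq nseq (count_mem c l) c | c <- cs]) l.
Proof.
elim: cs l => [|c cs IH] l; first by case: l => // x l _ /(_ x (mem_head _ _)).
move=> /= /andP[cn cu] lcs; set l' := seq.filter (predC1 c) l.
have -> : [seq nseq (count_mem b l) b | b <- cs] = [seq nseq (count_mem b l') b | b <- cs].
  apply/eq_in_map => b bcs; congr (nseq _ b); rewrite count_filter; apply: seq.eq_count => x /=.
  by case: eqVneq => //= ->; apply/esym; apply: contraNneq cn => <-.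
apply: perm_trans (_ : perm_eq (nseq (count_mem c l) c ++ l') _).
  rewrite perm_cat2l; apply: IH => // x; rewrite mem_filter => /andP[/= xc /lcs].
  by rewrite inE (negPf xc).
rewrite perm_sym -(perm_filterC (pred1 c) l) perm_sym perm_cat2r -size_filter.
by have /all_pred1P <- : all (pred1 c) (seq.filter (pred1 c) l) by exact: filter_all.
Qed.

Section poisson_cube.
Context {R : realType} {d h : nat} (a : rel nat).
Hypotheses (d_gt0 : (0 < d)%N) (h_gt0 : (0 < h)%N).
Local Notation pt := (d.-tuple R).
Variable lambda : R.
Hypothesis lambda_gt0 : 0 < lambda.
Context {dO : measure_display} {Omega : measurableType dO}.
Variables (P : probability Omega R) (N : Omega -> set pt).
Hypothesis N_poisson : poisson_process P lambda N.
Variable s : R.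
Hypothesis s0 : 0 < s.

Definition cube_points w : seq pt := enum_fset (fset_set (N w `&` cube s)).

Lemma mem_cube_points w x : x \in cube_points w <-> N w x /\ incube s x.
Proof.
have [fin _ _ _] := N_poisson.
have -> : (x \in cube_points w) = (x \in fset_set (N w `&` cube s)) by [].
by rewrite in_fset_set// inE; split=> -[? /incubeP ?]; split => //; apply/incubeP.
Qed.

Lemma uniq_cube_points w : uniq (cube_points w).
Proof. exact: fset_uniq. Qed.

Section grid.
Variable n : nat.
Hypothesis n_gt0 : (0 < n)%N.
Let p := lambda * (s / n%:R) ^+ d.
Let p_gt0 : 0 < p. Proof. by rewrite mulr_gt0// exprn_gt0// divr_gt0// ltr0n. Qed.

Definition cell_count c w : nat :=
  if c \in cells d n then count_in N (cell_set s n c) w else 0%N.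

Lemma cell_set_subcube c : c \in cells d n -> cell_set s n c `<=` (cube s : set pt).
Proof.
move=> cn x; rewrite -(ocell_Some s0 n_gt0 cn) /= /ocell.
by case: incubeP.
Qed.

Lemma cell_countE c w : c \in cells d n ->
  cell_count c w = count_mem c (map (cell_at s n) (cube_points w)).
Proof.
move=> cn; rewrite /cell_count cn /count_in count_map -size_filter.
have [fin _ _ _] := N_poisson.
apply: perm_size; apply: uniq_perm; [exact: fset_uniq|by rewrite filter_uniq// uniq_cube_points|].
move=> x; rewrite mem_filter.
have fc : finite_set (N w `&` cell_set s n c).
  by apply: sub_finite_set (fin w s) => y [Ny yc]; split => //; exact: (cell_set_subcube cn).
have -> : (x \in enum_fset (fset_set (N w `&` cell_set s n c))) =
    (x \in fset_set (N w `&` cell_set s n c)) by [].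
rewrite in_fset_set// inE -(ocell_Some s0 n_gt0 cn).
apply/idP/andP => [/set_mem[Nx]|].
  rewrite /= /ocell; case: ifP => // xs [/eqP]; split => //.
  by apply/mem_cube_points.
move=> [/= /eqP xc /mem_cube_points[Nx xs]]; apply/mem_set; split => //.
by rewrite /= /ocell xs xc.
Qed.

Lemma cells_cube_points w : {subset map (cell_at s n) (cube_points w) <= cells d n}.
Proof.
move=> _ /mapP[x /mem_cube_points[_ xs] ->]; exact: cell_at_cells.
Qed.

Lemma counted_funE k (F : seq (cell d) -> R) w : symmetric_fun F ->
  counted_fun cell_count (cells d n) k F w =
  (size (cube_points w) == k)%:R * F (map (cell_at s n) (cube_points w)).
Proof.
move=> FS; rewrite /counted_fun.
have -> : [seq nseq (cell_count c w) c | c <- cells d n] =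
    [seq nseq (count_mem c (map (cell_at s n) (cube_points w))) c | c <- cells d n].
  by apply/eq_in_map => c cn; rewrite cell_countE.
have pe := perm_flatten_nseq (cells_uniq d n) (@cells_cube_points w).
rewrite (FS _ _ pe); congr ((_ == k)%:R * _).
rewrite -(size_map (cell_at s n)) -(perm_size pe) size_flatten /shape -map_comp sumnE big_map.
by rewrite big_seq [RHS]big_seq; apply: eq_bigr => c cn /=; rewrite size_nseq cell_countE.
Qed.

Lemma cell_count_meas c j : measurable [set w | cell_count c w = j].
Proof.
have [_ mN _ _] := N_poisson; rewrite /cell_count; case: (boolP (c \in cells d n)) => cn.
  rewrite (_ : [set w | _] = count_in N (cell_set s n c) @^-1` [set j]); last by [].
  rewrite -[X in measurable X]setTI; apply: mN => //; split; first exact: measurable_cell_set.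
  by exists s; exact: (cell_set_subcube cn).
case: (eqVneq 0%N j) => [<-|j0].
  by rewrite (_ : [set w | _] = setT)//; apply/seteqP; split.
by rewrite (_ : [set w | _] = set0)//; apply/seteqP; split => // w /= E; rewrite E eqxx in j0.
Qed.

Lemma cell_count_indep l (v : cell d -> nat) : uniq l -> {subset l <= cells d n} ->
  P [set w | forall c, c \in l -> cell_count c w = v c] =
  (\prod_(c <- l) (poisson_pmf p (v c))%:E)%E.
Proof.
move=> lu lcs; have [_ _ law indep] := N_poisson.
pose cs := cells d n; pose c0 : cell d := [ffun=> 0%N].
(* [poisson_process] speaks of sequences of disjoint sets, so the cells are enumerated and followed
   by empty sets. *)
pose A i : set pt := if (i < size cs)%N then cell_set s n (nth c0 cs i) else set0.
have bA i : bounded_borel (A i).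
  rewrite /A; case: ifP => i_n; last by split; [exact: measurable0|exists s].
  split; first exact: measurable_cell_set.
  by exists s; apply: cell_set_subcube; exact: mem_nth.
have tA : trivIset setT A.
  apply/trivIsetP => i j _ _ ij; rewrite /A; case: ifP => i_n; last by rewrite set0I.
  case: ifP => j_n; last by rewrite setI0.
  rewrite -!(ocell_Some s0 n_gt0) ?mem_nth//; apply/seteqP; split => // x /= [-> [/eqP]].
  by rewrite nth_uniq ?cells_uniq// (negPf ij).
pose J := [fset i in [seq index c cs | c <- l]]%fset.
pose B i : set nat := [set v (nth c0 cs i)].
have Ai c : c \in l -> A (index c cs) = cell_set s n c.
  by move=> /lcs cl; rewrite /A index_mem cl nth_index.
have := indep A bA tA J B (fun i => I).
rewrite (_ : \bigcap_(i in [set` J]) _ = [set w | forall c, c \in l -> cell_count c w = v c]); last first.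
  apply/seteqP; split => w /= H.
    move=> c cl; have := H (index c cs).
    rewrite /= /B /= nth_index ?lcs// Ai// /cell_count lcs//; apply.
    by apply/imfsetP; exists (index c cs) => //=; exact: map_f.
  move=> i /= /imfsetP[j /= /mapP[c cl ->] ->].
  by rewrite /B /= nth_index ?lcs// Ai// -H// /cell_count lcs.
move=> ->; have pJ : perm_eq (enum_fset J) [seq index c cs | c <- l].
  apply: uniq_perm; first exact: fset_uniq.
    rewrite map_inj_in_uniq// => b c /lcs bl /lcs cl bc.
    by rewrite -(nth_index c0 bl) bc nth_index.
  by move=> i; apply/imfsetP/idP => [[j /= jl ->]//|il]; exists i.
rewrite (perm_big _ pJ) big_map/= big_seq [RHS]big_seq; apply: eq_bigr => c cl.
rewrite Ai// /B nth_index ?lcs// law; last first.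
  by split; [exact: measurable_cell_set|exists s; apply: cell_set_subcube; exact: lcs].
rewrite lebesgue_cell_set//= -/p /poisson_prob p_gt0 esum_set1// lee_fin.
exact: poisson_pmf_ge0.
Qed.

(** Given their number, the points of a Poisson process in a cube are uniform. The [n ^ d] cells
    have parameter [p] each, the total [lambda * s ^+ d]. *)
Lemma mean_poisson_cells k (F : seq (cell d) -> R) : symmetric_fun F ->
  bounded_rv (fun w => (size (cube_points w) == k)%:R * F (map (cell_at s n) (cube_points w))) /\
  mean_rv P (fun w => (size (cube_points w) == k)%:R * F (map (cell_at s n) (cube_points w))) =
    poisson_pmf (lambda * s ^+ d) k * iid (unif d n) k F.
Proof.
move=> FS.
rewrite (_ : (fun w => _) = counted_fun cell_count (cells d n) k F); last first.
  by apply/funext => w; rewrite counted_funE.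
split; first exact: (bounded_rv_counted_fun cell_count_meas).
have := @mean_counted_fun _ _ _ _ P _ _ _ p_gt0 cell_count_meas cell_count_indep [::] (fun=> 0%N)
  (cells d n) k F (cells_uniq d n) (fun c cn => cn).
under eq_fun do rewrite big_nil mul1r.
move=> ->; rewrite big_nil mul1r.
have nd : 0 < (n ^ d)%:R :> R by rewrite ltr0n expn_gt0 n_gt0.
have HM (f : cell d -> R) : (size (cells d n))%:R * unif d n f = \sum_(c <- cells d n) f c.
  by rewrite size_cells unifE// mulrA divff ?mul1r// gt_eqF.
have H := multiset_sum_iid k FS HM; rewrite size_cells in H *.
have k0 : k`!%:R != 0 :> R by rewrite pnatr_eq0 -lt0n fact_gt0.
have -> : multiset_sum (cells d n) k F = (n ^ d)%:R ^+ k / k`!%:R * iid (unif d n) k F.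
  by rewrite mulrAC -H mulrC mulKf.
rewrite /poisson_pmf mulr_gt0 ?exprn_gt0//.
have -> : expR (- p) ^+ (n ^ d) = expR (- (lambda * s ^+ d)).
  rewrite -expRM_natl; congr expR; rewrite /p expr_div_n natrX mulrN; congr (- _).
  by field; rewrite expf_neq0// pnatr_eq0 -lt0n.
have -> : lambda * s ^+ d = p * (n ^ d)%:R.
  by rewrite /p expr_div_n natrX; field; rewrite expf_neq0// pnatr_eq0 -lt0n.
rewrite [in RHS]exprMn; move: ((n ^ d)%:R ^+ k) (p ^+ k) (expR _) (iid _ _ _) (k`!%:R^-1) => x y z u v.
by ring.
Qed.

End grid.

End poisson_cube.

(** * Variance of the Poisson law *)

Section poisson_moments.
Context {R : realType}.
Variable L : R.
Hypothesis L_gt0 : 0 < L.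
Local Notation pmf := (poisson_pmf L).
Definition poisson_cdf n : R := \sum_(k < n) pmf k.

Lemma poisson_pmfS k : k.+1%:R * pmf k.+1 = L * pmf k.
Proof.
rewrite /poisson_pmf L_gt0 factS natrM exprS; field.
by rewrite nat1r !pnatr_eq0 /= -lt0n fact_gt0.
Qed.

Lemma poisson_cdf_cvg : poisson_cdf n @[n --> \oo] --> (1 : R).
Proof.
have H : expR (- L) * series (exp_coeff L) n @[n --> \oo] --> expR (- L) * expR L.
  apply: cvgM; first exact: cvg_cst.
  exact: is_cvg_series_exp_coeff.
rewrite -expRD addNr expR0 in H; apply: cvg_trans H; apply: near_eq_cvg; apply: nearW => n.
rewrite /series/= big_mkord mulr_sumr; apply: eq_bigr => k _.
by rewrite /poisson_pmf L_gt0 /exp_coeff /= mulrC.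
Qed.

Lemma poisson_cdf_le1 n : poisson_cdf n <= 1.
Proof.
have nd : nondecreasing_seq poisson_cdf.
  by apply/nondecreasing_seqP => k; rewrite /poisson_cdf big_ord_recr/= lerDl poisson_pmf_ge0.
have := nondecreasing_cvgn_le nd (cvgP _ poisson_cdf_cvg) n.
by rewrite (cvg_lim (@Rhausdorff R) poisson_cdf_cvg).
Qed.

(** The exact truncated sum replaces an infinite series: its boundary term is not positive for
    [n >= L]. *)
Lemma poisson_variance_partial n : \sum_(k < n) pmf k * (k%:R - L) ^+ 2 =
  L * poisson_cdf n + n%:R * pmf n * (L - n%:R).
Proof.
elim: n => [|n IH]; first by rewrite big_ord0 /poisson_cdf big_ord0 mulr0 !mul0r addr0.
rewrite big_ord_recr/= IH /poisson_cdf big_ord_recr/= -/(poisson_cdf n) poisson_pmfS.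
by rewrite -(natr1 n); ring.
Qed.

Lemma poisson_variance_le n : \sum_(k < n) pmf k * (k%:R - L) ^+ 2 <= L.
Proof.
pose m := maxn n (Num.truncn L).+1.
have Lm : L <= m%:R.
  by apply: le_trans (ltW (Num.Theory.truncnS_gt L)) _; rewrite ler_nat leq_maxr.
apply: (@le_trans _ _ (\sum_(k < m) pmf k * (k%:R - L) ^+ 2)).
  rewrite -!(big_mkord xpredT (fun k => pmf k * (k%:R - L) ^+ 2)).
  rewrite (big_cat_nat (leq0n n) (leq_maxl n _))/= lerDl sumr_ge0// => k _.
  by rewrite mulr_ge0 ?sqr_ge0// poisson_pmf_ge0.
rewrite poisson_variance_partial.
have A : L * poisson_cdf m <= L by rewrite -[leRHS]mulr1 ler_wpM2l ?poisson_cdf_le1// ltW.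
have B : m%:R * pmf m * (L - m%:R) <= 0.
  by rewrite mulr_ge0_le0 ?mulr_ge0 ?poisson_pmf_ge0// subr_le0.
by rewrite -[leRHS]addr0 lerD.
Qed.

(** The bound is uniform in the truncation. The summand 1 pays for replacing [L] by the integer
    [k0], and [t] is the parameter of [norm_le_quad]. *)
Lemma poisson_mean_lipschitz (u : nat -> R) k0 t n : 0 < t -> `|k0%:R - L| <= 1 ->
  (forall j k, `|u j - u k| <= `|j%:R - k%:R|) ->
  `|\sum_(k < n) pmf k * u k - u k0 * poisson_cdf n| <= 1 + t + L / t.
Proof.
move=> t0 k0L ul.
rewrite /poisson_cdf mulr_sumr -sumrB; apply: le_trans (ler_norm_sum _ _ _) _.
apply: (@le_trans _ _ (\sum_(k < n) ((1 + t) * pmf k + t^-1 * (pmf k * (k%:R - L) ^+ 2)))).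
  apply: ler_sum => k _; rewrite [u k0 * _]mulrC -mulrBr normrM ger0_norm ?poisson_pmf_ge0//.
  rewrite [leRHS](_ : _ = pmf k * (1 + t + (k%:R - L) ^+ 2 / t)); last by ring.
  apply: ler_wpM2l; first exact: poisson_pmf_ge0.
  apply: le_trans (ul _ _) _.
  rewrite (_ : k%:R - k0%:R = (k%:R - L) - (k0%:R - L)); last by ring.
  apply: le_trans (ler_normB _ _) _.
  have := norm_le_quad (k%:R - L) t0; lra.
rewrite big_split/= -!mulr_sumr -/(poisson_cdf n); apply: lerD.
  by rewrite -[leRHS]mulr1 ler_wpM2l ?poisson_cdf_le1// addr_ge0// ltW.
by rewrite mulrC ler_wpM2r ?invr_ge0 ?(ltW t0)// poisson_variance_le.
Qed.

End poisson_moments.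

Section poisson_packing.
Context {R : realType} {d h : nat} (a : rel nat).
Hypotheses (d_gt0 : (0 < d)%N) (h_gt0 : (0 < h)%N).
Local Notation pt := (d.-tuple R).
Variable lambda : R.
Hypothesis lambda_gt0 : 0 < lambda.
Context {dO : measure_display} {Omega : measurableType dO}.
Variables (P : probability Omega R) (N : Omega -> set pt).
Hypothesis N_poisson : poisson_process P lambda N.

Section fixed_cube.
Variable s : R.
Hypothesis s0 : 0 < s.
Let L := lambda * s ^+ d.
Let L_gt0 : 0 < L. Proof. by rewrite mulr_gt0// exprn_gt0. Qed.
Local Notation pts := (cube_points N s).
Local Notation Z k := (fun w => (size (pts w) == k)%:R * npk h a (close 1) (pts w) : R).

(** Every grid size divides the later factorials, along which the infimum is therefore a limit. *)
Lemma psi_grid_fact_cvg k :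
  psi_grid d h a (j.+1)`! k s @[j --> \oo] --> psi_unif d h a k s.
Proof.
apply/cvgrPdist_le => e e0.
have [m m0 Hm] := psi_unif_approx d a h_gt0 k (ltW s0) e0.
exists m => // j /= mj; rewrite distrC ger0_norm; last first.
  by rewrite subr_ge0 psi_unif_le// fact_gt0.
rewrite lerBlDl; apply: Hm; first exact: fact_gt0.
by rewrite dvdn_fact// m0 leqW.
Qed.

Lemma mean_poisson_packing k :
  bounded_rv (Z k) /\ mean_rv P (Z k) = poisson_pmf L k * psi_unif d h a k s.
Proof.
pose n j := (j.+1)`!; have n0 j : (0 < n j)%N by exact: fact_gt0.
pose F j : seq (cell d) -> R := npk h a (near_cells (s / (n j)%:R)).
have FS j : symmetric_fun (F j).
  by move=> l1 l2 l12; rewrite /F /npk (pk_perm a h_gt0 _ l12).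
pose f_ j w := (size (pts w) == k)%:R * F j (map (cell_at s (n j)) (pts w)).
have Hf j := mean_poisson_cells lambda_gt0 N_poisson s0 (n0 j) k (FS j).
(* On the event of [k] points the packing number is at most [k], so bounded convergence applies to
   each [k] separately. *)
have [j||w|bf lim] := @bounded_cvg R _ _ P f_ (Z k) k%:R.
- exact: (Hf j).1.1.
- move=> j w; rewrite /f_; case: eqP => [<-|_]; last by rewrite mul0r normr0.
  rewrite mul1r ger0_norm ?npk_ge0//.
  apply: le_trans (_ : h%:R * F j (map (cell_at s (n j)) (pts w)) <= _).
    by rewrite ler_peMl ?npk_ge0// ler1n.
  by apply: le_trans (npk_size _ _ _ _) _; rewrite size_map.
- have [eta e0 H] := eventually_near_close (pts w) (@ltr01 R).
  apply: cvg_near_cst; exists (Num.truncn (s / eta)).+1 => // j /= jn.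
  rewrite /f_ /F /npk; congr (_ * _%:R); apply: pk_map => // x y xs ys.
  rewrite -[s in near_cells (s / _)]divr1; apply: H => //.
  + rewrite ltr_pdivrMr ?ltr0n// -ltr_pdivrMl// mulrC.
    apply: lt_le_trans (Num.Theory.truncnS_gt _) _; rewrite ler_nat (leq_trans jn)//.
    by rewrite /n factS (leq_trans (leqnSn j))// leq_pmulr// fact_gt0.
  + by case/(mem_cube_points N_poisson): xs.
  + by case/(mem_cube_points N_poisson): ys.
split => //; apply/esym/(cvg_unique _ _ lim) => //.
have : poisson_pmf L k * psi_grid d h a (n j) k s @[j --> \oo] --> poisson_pmf L k * psi_unif d h a k s.
  by apply: cvgM; [exact: cvg_cst|exact: psi_grid_fact_cvg].
apply: cvg_trans; apply: near_eq_cvg; apply: nearW => j.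
by rewrite /= (Hf j).2.
Qed.

(** The number of points is unbounded, so the expectation is split according to it and summed by
    monotone convergence. *)
Lemma expectation_poisson_packing :
  ('E_P[fun w => npk h a (close 1) (pts w) : R] =
  \sum_(0 <= k <oo) (poisson_pmf L k * psi_unif d h a k s)%:E)%E.
Proof.
rewrite unlock.
rewrite (eq_integral (fun w => \sum_(0 <= k <oo) (Z k w)%:E)%E) => [|w _]; last first.
  apply/esym/cvg_lim => //; apply: cvg_near_cst; exists (size (pts w)).+1 => // K /= sK.
  rewrite sumEFin big_mkord (bigD1 (Ordinal sK))//= eqxx mul1r big1 ?addr0// => k /eqP ks.
  by case: eqP => [E|]; rewrite ?mul0r//; case: ks; apply: val_inj.
rewrite integral_nneseries//; last 2 first.
- by move=> k; apply/measurable_EFinP; exact: (mean_poisson_packing k).1.1.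
- by move=> k w _; rewrite lee_fin mulr_ge0// npk_ge0.
apply: eq_eseriesr => k _; have [bZ mZ] := mean_poisson_packing k.
by rewrite -mZ -(mean_rvE P bZ) unlock.
Qed.

Lemma expectation_poisson_packing_approx k0 t : 0 < t -> `|k0%:R - L| <= 1 ->
  exists2 v, ('E_P[fun w => npk h a (close 1) (pts w) : R] = v%:E)%E &
    `|v - psi_unif d h a k0 s| <= 1 + t + L / t.
Proof.
move=> t0 k0L; rewrite expectation_poisson_packing.
set u := fun k => psi_unif d h a k s; set D := _ + _.
pose E n := \sum_(k < n) poisson_pmf L k * u k.
have ED n : `|E n - u k0 * poisson_cdf L n| <= D.
  by apply: poisson_mean_lipschitz => // j k; apply: psi_unif_lipschitz => //; exact: ltW.
have u0 k : 0 <= u k by exact: psi_unif_ge0.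
have au0 k : 0 <= poisson_pmf L k * u k by rewrite mulr_ge0 ?poisson_pmf_ge0.
have Ele n : E n <= u k0 + D.
  have := ED n; rewrite ler_norml => /andP[_]; rewrite lerBlDl => /le_trans; apply.
  by rewrite lerD2r -[leRHS]mulr1 ler_wpM2l// poisson_cdf_le1.
have ndE : nondecreasing_seq E.
  by apply/nondecreasing_seqP => n; rewrite /E big_ord_recr/= lerDl.
have cE : cvgn E.
  by apply: nondecreasing_is_cvgn => //; exists (u k0 + D) => _ [n _ <-].
exists (limn E).
  rewrite -EFin_lim//; congr (limn _); apply/funext => n.
  by rewrite /= sumEFin big_mkord.
have lim : E n - u k0 * poisson_cdf L n @[n --> \oo] --> limn E - u k0 * 1.
  by apply: cvgB => //; apply: cvgM; [exact: cvg_cst|exact: poisson_cdf_cvg].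
rewrite mulr1 in lim.
have nl : `|E n - u k0 * poisson_cdf L n| @[n --> \oo] --> `|limn E - u k0| by exact: cvg_norm.
rewrite -(cvg_lim (@Rhausdorff R) nl); apply: limr_le; first exact: cvgP nl.
exact: nearW.
Qed.

End fixed_cube.

Lemma expectation_poisson_packing_cvg :
  ('E_P[fun w => npk h a (close 1) (cube_points N s w) : R] * ((lambda * s ^+ d)^-1)%:E)%E
    @[s --> +oo] --> (packing_limit d h a lambda / lambda)%:E.
Proof.
pose v s := fine ('E_P[fun w => npk h a (close 1) (cube_points N s w) : R]).
have vE s k0 t : 0 < s -> 0 < t -> `|k0%:R - lambda * s ^+ d| <= 1 ->
    ('E_P[fun w => npk h a (close 1) (cube_points N s w) : R] = (v s)%:E)%E /\
    `|v s - psi_unif d h a k0 s| <= 1 + t + lambda * s ^+ d / t.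
  by move=> s0 t0 k0L; have [w E Ew] := expectation_poisson_packing_approx s0 t0 k0L; rewrite /v E.
have trunc s : 0 < s -> `|(Num.truncn (lambda * s ^+ d))%:R - lambda * s ^+ d| <= 1.
  move=> s0; have L0 : 0 <= lambda * s ^+ d by rewrite mulr_ge0 ?exprn_ge0// ltW.
  have /andP[k1 k2] := Num.Theory.truncn_itv L0; rewrite -natr1 in k2.
  by rewrite ler_norml; apply/andP; split; lra.
suff lim : v s * (lambda * s ^+ d)^-1 @[s --> +oo] --> packing_limit d h a lambda / lambda.
  apply: cvg_trans (_ : (v s * (lambda * s ^+ d)^-1)%:E @[s --> +oo] --> _); last first.
    by apply: cvg_EFin => //; exact: nearW.
  apply: near_eq_cvg; near=> s.
  have s0 : 0 < s by near: s; exact: nbhs_pinfty_gt.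
  by have [-> _] := vE s _ 1 s0 ltr01 (trunc s s0); rewrite EFinM.
apply/cvgrPdist_le => eps e0.
(* The limit costs [3 * e], the fluctuations [2 * e]: with [t = e * s ^+ d] their bound is
   [1 + e * s ^+ d + lambda / e], at most [2 * e * s ^+ d] once [C <= s ^+ d]. *)
pose e := eps * lambda / 5; have e_gt0 : 0 < e by rewrite divr_gt0 ?mulr_gt0.
have [S S0 HS] := packing_limitP a d_gt0 h_gt0 (ltW lambda_gt0) e_gt0.
pose C := (1 + lambda / e) / e.
have C0 : 0 < C by apply: divr_gt0 => //; apply: addr_gt0 => //; exact: divr_gt0.
near=> s.
have s0 : 0 < s by near: s; exact: nbhs_pinfty_gt.
have s1 : 1 <= s by near: s; exact: nbhs_pinfty_ge.
have sS : S <= s by near: s; apply: nbhs_pinfty_ge; rewrite num_real.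
have sC : C <= s by near: s; apply: nbhs_pinfty_ge; rewrite num_real.
have sdC : C <= s ^+ d.
  by apply: le_trans sC _; rewrite ler_eXnr.
have sd0 : 0 < s ^+ d by rewrite exprn_gt0.
have esd : 1 + lambda / e <= e * s ^+ d by rewrite [leRHS]mulrC -ler_pdivrMr.
have le0 : 0 <= lambda / e by apply: divr_ge0; exact: ltW.
set k0 := Num.truncn (lambda * s ^+ d).
have [_ H1] := vE s k0 (e * s ^+ d) s0 (mulr_gt0 e_gt0 sd0) (trunc s s0).
have H2 : `|psi_unif d h a k0 s / s ^+ d - packing_limit d h a lambda| <= 3 * e.
  by apply: HS => //; apply: le_trans (trunc s s0) _; lra.
have H3 : `|v s / s ^+ d - psi_unif d h a k0 s / s ^+ d| <= 2 * e.
  rewrite -mulrBl normrM (@gtr0_norm _ (_^-1)) ?invr_gt0// ler_pdivrMr//.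
  apply: le_trans H1 _.
  have -> : lambda * s ^+ d / (e * s ^+ d) = lambda / e by field; rewrite !gt_eqF.
  by lra.
rewrite (_ : _ - _ = (packing_limit d h a lambda - v s / s ^+ d) / lambda); last first.
  by field; rewrite !gt_eqF.
rewrite normrM (@gtr0_norm _ (_^-1)) ?invr_gt0// ler_pdivrMr//.
have -> : eps * lambda = 3 * e + 2 * e by rewrite /e; field.
rewrite distrC (_ : _ - _ = (v s / s ^+ d - psi_unif d h a k0 s / s ^+ d) +
  (psi_unif d h a k0 s / s ^+ d - packing_limit d h a lambda)); last by ring.
by apply: le_trans (ler_normD _ _) _; rewrite addrC lerD.
Unshelve. all: by end_near. Qed.

End poisson_packing.

Theorem theorem3p15 (R : realType) (d : nat) (d_gt0 : (0 < d)%N)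
  (U : choiceType) (H : graph U) (h : nat)
  (H_connected : connected_graph H)
  (H_card : #|` vertices H| = h) (h_ge2 : (2 <= h)%N) :
  exists rho : R -> R,
    (forall (lambda : R), 0 < lambda ->
     forall (dO : measure_display) (Omega : measurableType dO)
       (P : probability Omega R) (N : Omega -> set (d.-tuple R)),
     poisson_process P lambda N ->
     ('E_P[fun w => (psi H (fset_set (N w `&` cube s)))%:R%R]
        * ((lambda * s ^+ d)^-1)%R%:E)%E @[s --> +oo] --> (rho lambda)%:E)
    /\
    (forall (mu : probability (d.-tuple R) R)
       (f : d.-tuple R -> R) (mu_perp : {measure set (d.-tuple R) -> \bar R})
       (dO : measure_display) (Omega : measurableType dO)
       (P : probability Omega R) (X : nat -> {RV P >-> d.-tuple R})
       (r : nat -> R) (t : R),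
     (forall x, mu [set x] = 0%E) ->
     measurable_fun setT f -> (forall x, 0 <= f x) ->
     (forall A, measurable A ->
        mu A = (\int[lebesgue_tuple d]_(x in A) (f x)%:E + mu_perp A)%E) ->
     mutually_singular mu_perp (lebesgue_tuple d) ->
     (forall i A, measurable A -> distribution P (X i) A = mu A) ->
     mutually_independent P X ->
     (forall n, (0 < n)%N -> 0 < r n) ->
     0 < t -> n%:R * r n ^+ d @[n --> \oo] --> t ->
     let xi := fun (n : nat) (w : Omega) =>
       n%:R^-1 *
       (psi H (dilate_fset (r n)^-1 [fset X i w | i in iota 0 n]%fset))%:R in
     let c := \int[lebesgue_tuple d]_x (rho (t * f x) * f x)
              + h%:R^-1 * fine (mu_perp setT) in
     converges_completely P xi c /\ converges_L2 P xi c).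
Proof.
have h_gt0 : (0 < h)%N by exact: ltnW.
have /fset0Pn[u0 _] : vertices H != fset0 by rewrite -cardfs_gt0 H_card.
pose a := index_adj H u0.
have a_conn : index_connected h a by rewrite -H_card; exact: index_adj_connected.
(* [packing_limit] is normalised by volume, [rho] by the expected number of points. *)
exists (fun l => packing_limit d h a l / l); split.
  move=> lambda l0 dO Omega P N NP.
  apply: cvg_trans (expectation_poisson_packing_cvg d_gt0 h_gt0 l0 NP (a := a)).
  apply: near_eq_cvg; apply: nearW => s /=; congr (_ * _)%E; congr ('E_P[_])%E.
  by apply/funext => w; rewrite (psiE u0) H_card.
move=> mu f mu_perp dO Omega P X r t mu_diff mf f0 muE sing X_law X_indep r_gt0 t_gt0 r_lim xi c.
have -> : xi = fun n w => n%:R^-1 * npk_sample (h := h) a X n (r n) w.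
  (* For [n = 0] both sides vanish because the inverse of 0 is 0; [r 0] need not be positive. *)
  apply/funext => -[|n]; apply/funext => w; first by rewrite /xi invr0 !mul0r.
  by rewrite /xi (psi_dilate u0 h_gt0 H_card)// r_gt0.
have cE : c = \int[lebesgue_tuple d]_x limit_density (h := h) a t f x + fine (mu_perp setT) / h%:R.
  rewrite /c [h%:R^-1 * _]mulrC; congr (_ + _); apply: eq_Rintegral => x _.
  rewrite /limit_density; have [->|fx] := eqVneq (f x) 0.
    by rewrite !mulr0 packing_limit0// mul0r.
  by field; rewrite fx gt_eqF.
have lim := npk_sample_mean_cvg d_gt0 h_gt0 mf f0 muE sing mu_diff r_gt0 t_gt0 r_lim a_conn X_law X_indep.
rewrite cE; split.
  exact: (npk_sample_converges_completely h_gt0 X_law X_indep r_gt0 lim).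
exact: (npk_sample_converges_L2 h_gt0 X_law X_indep r_gt0 lim).
Qed.
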